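(* Let $f:[0,1]^2\to\mathbb{R}$, $(s,c)\mapsto f(s,c)$, satisfy: (F1) $f\in C^2([0,1]^2)$, $f(0,c)=0$, $f(1,c)=1$ for all $c\in[0,1]$; (F2) $f_s(s,c)>0$ for $0<s<1$, $0\le c\le 1$, and $f_s(0,c)=f_s(1,c)=0$; (F3) for each $c\in[0,1]$ the function $f(\cdot,c)$ has a unique inflection point $s^I(c)\in(0,1)$, with $f_{ss}(s,c)>0$ for $0<s<s^I(c)$ and $f_{ss}(s,c)<0$ for $s^I(c)<s<1$; (F4) for every $s\in(0,1)$ there is $c^*(s)\in(0,1)$ with $f_c(s,c)<0$ for $0<c<c^*(s)$ and $f_c(s,c)>0$ for $c^*(s)<c<1$. Let $a:[0,1]\to\mathbb{R}$ satisfy: (A1) $a\in C^2[0,1]$, $a(0)=0$; (A2) $a'(c)>0$ for $0<c<1$; (A3) $a''(c)<0$ for $0<c<1$. Consider the system of conservation laws $$s_t+f(s,c)_x=0,\qquad (cs+a(c))_t+(cf(s,c))_x=0,$$ with Riemann data $(s^L,c^L)=(1,1)$ for $x\le 0$ and $(s^R,c^R)=(0,0)$ for $x>0$, and the dissipative system $$s_t+f(s,c)_x=\varepsilon_c(A(s,c)s_x)_x,\qquad (cs+\alpha)_t+(cf(s,c))_x=\varepsilon_c(cA(s,c)s_x)_x,\qquad \varepsilon_r\alpha_t=a(c)-\alpha,$$ where $\varepsilon_c,\varepsilon_r>0$. Then there exist $0<v_{\min}<v_{\max}<\infty$ such that for every $\kappa=\varepsilon_r/\varepsilon_c\in(0,+\infty)$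 there exist unique points $s^-(\kappa)\in[0,1]$, $s^+(\kappa)\in[0,1]$ and a unique velocity $v(\kappa)\in[v_{\min},v_{\max}]$ such that the $c$-shock wave connecting $u^-(\kappa)=(s^-(\kappa),1)$ and $u^+(\kappa)=(s^+(\kappa),0)$ with velocity $v(\kappa)$ is admissible (for this $\kappa$) and compatible by speeds in the sequence of waves $$(1,1)\xrightarrow{\ s\ }u^-(\kappa)\xrightarrow{\ c\text{-shock}\ }u^+(\kappa)\xrightarrow{\ s\ }(0,0).$$ Moreover, $v$ is a monotone and continuous function of $\kappa$, $v(\kappa)\to v_{\min}$ as $\kappa\to\infty$, and $v(\kappa)\to v_{\max}$ as $\kappa\to0$.
   Context: Here $s,c$ take values in $[0,1]$, and $A=A(s,c)$ is the capillary pressure function, bounded and separated from zero. Shock: a shock wave between $u^-=(s^-,c^-)$ and $u^+=(s^+,c^+)$ with velocity $v$ is the function equal to $u^-$ for $x<vt$ and $u^+$ for $x>vt$, satisfying the Rankine–Hugoniot conditions $v[s]=[f(s,c)]$, $v[cs+a(c)]=[cf(s,c)]$, where $[q]=q(s^-,c^-)-q(s^+,c^+)$. It is a $c$-shock if $c^-\ne c^+$. Admissible: for fixed $\kappa=\varepsilon_r/\varepsilon_c$, a $c$-shock from $u^-$ to $u^+$ with velocity $v$ is admissible if it is the limit, as $\varepsilon_c,\varepsilon_r\to0$ with $\varepsilon_r/\varepsilon_c=\kappa$, of smooth travelling wave solutions of the dissipative system, i.e. of solutions of the form $s=s(\xi)$, $c=c(\xi)$, $\alpha=\alpha(\xi)$,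 $\xi=\varepsilon_c^{-1}(x-vt)$, with $s(\pm\infty)=s^\pm$, $c(\pm\infty)=c^\pm$, $\alpha(\pm\infty)=a(c^\pm)$. $s$-wave: for a fixed concentration $c$ and $s_1>s_2$, the $s$-wave $(s_1,c)\xrightarrow{s}(s_2,c)$ is the entropy solution of the scalar Riemann problem for $s_t+f(s,c)_x=0$ with left state $s_1$ and right state $s_2$: with $f_U$ the upper envelope (least concave majorant) of $f(\cdot,c)$ on $[s_2,s_1]$ and $g=\partial_s f_U$, the solution is $s_1$ for $x/t<g(s_1)$, $s$ for $x/t=g(s)$, and $s_2$ for $x/t>g(s_2)$. Its initial speed is $g(s_1)$ and its final speed is $g(s_2)$. A shock with velocity $v$ has initial and final speed $v$. Compatibility: consecutive waves $u_1\xrightarrow{a}u_2\xrightarrow{b}u_3$ are compatible by speed if their combination solves the Riemann problem with left state $u_1$ and right state $u_3$; equivalently, if the final speed of the wave $a$ is at most the initial speed of the wave $b$. A sequence of waves is compatible by speeds if each consecutive pair is.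
   Formalization: The capillary pressure function A is assumed continuous on the unit square and bounded below by a positive constant, not merely bounded and separated from zero; for an A with a jump in c, smooth travelling waves need not exist. *)

(* Defs.v *)
(* Stdlib real numbers with Coquelicot. *)
From Stdlib Require Export Reals List.
From Coquelicot Require Export Coquelicot.
Export ListNotations.
Open Scope R_scope.

Definition unit_interval (x : R) : Prop := 0 <= x <= 1.

Definition unit_square (p : R * R) : Prop :=
  unit_interval (fst p) /\ unit_interval (snd p).

Definition continuous_on_square (g : R -> R -> R) : Prop :=
  continuous_on unit_square (fun p : R * R => g (fst p) (snd p)).

(* [D_in] is the derivative relative to a set, hence one-sided at the ends of
   the interval: nothing is said about values outside [0,1] or [0,1]^2. *)
Definition partial1 (g g1 : R -> R -> R) : Prop :=
  forall s c, unit_interval s -> unit_interval c ->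
    D_in (fun x => g x c) (fun x => g1 x c) unit_interval s.

Definition partial2 (g g2 : R -> R -> R) : Prop :=
  forall s c, unit_interval s -> unit_interval c ->
    D_in (fun y => g s y) (fun y => g2 s y) unit_interval c.

Definition C1_square (g g1 g2 : R -> R -> R) : Prop :=
  partial1 g g1 /\ partial2 g g2 /\
  continuous_on_square g /\ continuous_on_square g1 /\ continuous_on_square g2.

(* [g12] is the derivative of [g1] in the second variable. *)
Definition C2_square (g g1 g2 g11 g12 g21 g22 : R -> R -> R) : Prop :=
  C1_square g g1 g2 /\ C1_square g1 g11 g12 /\ C1_square g2 g21 g22.

Definition C2_interval (g g1 g2 : R -> R) : Prop :=
  (forall x, unit_interval x -> D_in g g1 unit_interval x) /\
  (forall x, unit_interval x -> D_in g1 g2 unit_interval x) /\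
  continuous_on unit_interval g2.

Definition F1 (f fs fc fss fsc fcs fcc : R -> R -> R) : Prop :=
  C2_square f fs fc fss fsc fcs fcc /\
  forall c, unit_interval c -> f 0 c = 0 /\ f 1 c = 1.

Definition F2 (fs : R -> R -> R) : Prop :=
  (forall s c, 0 < s < 1 -> unit_interval c -> 0 < fs s c) /\
  (forall c, unit_interval c -> fs 0 c = 0 /\ fs 1 c = 0).

(* The sign pattern makes [sI] the unique inflection point of f(., c). *)
Definition F3 (fss : R -> R -> R) : Prop :=
  forall c, unit_interval c -> exists sI, 0 < sI < 1 /\
    (forall s, 0 < s < sI -> 0 < fss s c) /\
    (forall s, sI < s < 1 -> fss s c < 0).

Definition F4 (fc : R -> R -> R) : Prop :=
  forall s, 0 < s < 1 -> exists cstar, 0 < cstar < 1 /\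
    (forall c, 0 < c < cstar -> fc s c < 0) /\
    (forall c, cstar < c < 1 -> 0 < fc s c).

Definition A1 (a a1 a2 : R -> R) : Prop := C2_interval a a1 a2 /\ a 0 = 0.

Definition A2 (a1 : R -> R) : Prop := forall c, 0 < c < 1 -> 0 < a1 c.

Definition A3 (a2 : R -> R) : Prop := forall c, 0 < c < 1 -> a2 c < 0.

(* Continuity is what gives the term (A(s,c) s_x)_x a classical meaning: with a
   discontinuous A there need be no continuously differentiable profile. *)
Definition capillary_pressure (A : R -> R -> R) : Prop :=
  continuous_on_square A /\
  exists Amin Amax, 0 < Amin /\
    forall s c, unit_interval s -> unit_interval c -> Amin <= A s c <= Amax.

(* A state is a pair (s, c). *)
Definition state : Type := (R * R)%type.

Definition rankine_hugoniot (f : R -> R -> R) (a : R -> R)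
    (um up : state) (v : R) : Prop :=
  let (sm, cm) := um in let (sp, cp) := up in
  v * (sm - sp) = f sm cm - f sp cp /\
  v * ((cm * sm + a cm) - (cp * sp + a cp)) = cm * f sm cm - cp * f sp cp.

Definition c_shock (f : R -> R -> R) (a : R -> R)
    (um up : state) (v : R) : Prop :=
  rankine_hugoniot f a um up v /\ snd um <> snd up.

(* The value on the line x = v t is irrelevant. *)
Definition shock_function (um up : state) (v x t : R) : state :=
  if Rlt_dec x (v * t) then um else up.

Definition Dx (u : R -> R -> R) (x t : R) : R := Derive (fun y => u y t) x.
Definition Dt (u : R -> R -> R) (x t : R) : R := Derive (fun r => u x r) t.

(* [Derive] is total; for the profiles used below every derivative occurring
   here exists, by [smooth_profile]. *)
Definition dissipative_solution (f : R -> R -> R) (a : R -> R)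
    (A : R -> R -> R) (ec er : R) (s c alpha : R -> R -> R) : Prop :=
  forall x t, 0 < t ->
    unit_interval (s x t) /\ unit_interval (c x t) /\
    Dt s x t + Dx (fun y r => f (s y r) (c y r)) x t
      = ec * Dx (fun y r => A (s y r) (c y r) * Dx s y r) x t /\
    Dt (fun y r => c y r * s y r + alpha y r) x t
        + Dx (fun y r => c y r * f (s y r) (c y r)) x t
      = ec * Dx (fun y r => c y r * A (s y r) (c y r) * Dx s y r) x t /\
    er * Dt alpha x t = a (c x t) - alpha x t.

Definition C1 (g : R -> R) : Prop :=
  forall x, ex_derive g x /\ continuous (Derive g) x.

(* Smooth in the classical sense: all the derivatives that occur in the
   dissipative system exist and are continuous. *)
Definition smooth_profile (A : R -> R -> R) (s c alpha : R -> R) : Prop :=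
  C1 s /\ C1 c /\ C1 alpha /\ C1 (fun xi => A (s xi) (c xi) * Derive s xi).

Definition travelling (g : R -> R) (v ec x t : R) : R := g ((x - v * t) / ec).

Definition admissible (f : R -> R -> R) (a : R -> R) (A : R -> R -> R)
    (kappa : R) (um up : state) (v : R) : Prop :=
  exists s c alpha : R -> R,
    smooth_profile A s c alpha /\
    (is_lim s m_infty (fst um) /\ is_lim s p_infty (fst up)) /\
    (is_lim c m_infty (snd um) /\ is_lim c p_infty (snd up)) /\
    (is_lim alpha m_infty (a (snd um)) /\ is_lim alpha p_infty (a (snd up))) /\
    (forall ec er, 0 < ec -> 0 < er -> er / ec = kappa ->
      dissipative_solution f a A ec er
        (travelling s v ec) (travelling c v ec) (travelling alpha v ec)) /\
    (forall x t, 0 < t -> x <> v * t ->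
      filterlim (fun ec => (travelling s v ec x t, travelling c v ec x t))
        (at_right 0) (locally (shock_function um up v x t))).

Definition concave_on (D : R -> Prop) (g : R -> R) : Prop :=
  forall x y l, D x -> D y -> 0 <= l <= 1 ->
    l * g x + (1 - l) * g y <= g (l * x + (1 - l) * y).

Definition concave_majorant (D : R -> Prop) (h g : R -> R) : Prop :=
  concave_on D g /\ forall x, D x -> h x <= g x.

Definition upper_envelope (D : R -> Prop) (h hU : R -> R) : Prop :=
  concave_majorant D h hU /\
  forall g, concave_majorant D h g -> forall x, D x -> hU x <= g x.

(* [g] is the speed s |-> x/t along the s-wave from (s1, c) to (s2, c). *)
Definition s_wave (f : R -> R -> R) (c s1 s2 : R) (g : R -> R) : Prop :=
  s2 < s1 /\
  exists fU : R -> R,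
    upper_envelope (fun x => s2 <= x <= s1) (fun x => f x c) fU /\
    forall s, s2 <= s <= s1 -> D_in fU g (fun x => s2 <= x <= s1) s.

(* [SWave c s1 s2] goes from (s1, c) to (s2, c). *)
Inductive wave : Type :=
  | SWave (c s1 s2 : R)
  | Shock (um up : state) (v : R).

Definition left_state (w : wave) : state :=
  match w with SWave c s1 _ => (s1, c) | Shock um _ _ => um end.

Definition right_state (w : wave) : state :=
  match w with SWave c _ s2 => (s2, c) | Shock _ up _ => up end.

Definition wave_speeds (f : R -> R -> R) (w : wave) (vi vf : R) : Prop :=
  match w with
  | SWave c s1 s2 => exists g, s_wave f c s1 s2 g /\ vi = g s1 /\ vf = g s2
  | Shock _ _ v => vi = v /\ vf = v
  end.

Definition compatible_by_speed (f : R -> R -> R) (w1 w2 : wave) : Prop :=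
  right_state w1 = left_state w2 /\
  exists vi1 vf1 vi2 vf2,
    wave_speeds f w1 vi1 vf1 /\ wave_speeds f w2 vi2 vf2 /\ vf1 <= vi2.

Fixpoint compatible_by_speeds (f : R -> R -> R) (ws : list wave) : Prop :=
  match ws with
  | w1 :: ((w2 :: _) as ws') =>
      compatible_by_speed f w1 w2 /\ compatible_by_speeds f ws'
  | _ => True
  end.

Definition monotone_on (D : R -> Prop) (g : R -> R) : Prop :=
  (forall x y, D x -> D y -> x <= y -> g x <= g y) \/
  (forall x y, D x -> D y -> x <= y -> g y <= g x).

(* Main.v *)
Require Import Defs.
From Stdlib Require Import ZArith Lra Lia Psatz Classical FunctionalExtensionality IndefiniteDescription
  Ranalysis5.

(** Integrating the profile equations and using the limits at infinity gives alpha = a(1) c and,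
    in a rescaled time, c' = -(a(c) - a(1) c), which does not involve kappa or v, together with
    s' = kappa a(1) v (f(s,c) - v (s + a(1))) / A(s,c).  Admissible shocks are therefore the orbits of
    this scalar nonautonomous equation that connect a root of the right-hand side at c = 1 to a root at
    c = 0; compatibility by speeds singles out the upper root at c = 1 and the lower root at c = 0.

    The value vmin = max_s min_c f(s,c)/(s + a(1)) is attained at a saddle point (sb,cb).  For v >= vmin
    the region where the right-hand side is positive does not meet c = cb, and on each side of cb it
    can be left, respectively entered, only in one direction.  Hence s' <= 0 along connecting orbits.
    At a crossing of two of them with v < v' and kappa v <= kappa' v' the second has the smaller
    derivative, while their end states are ordered the other way round.  So v < v' forces
    kappa' v' < kappa v, which yields uniqueness, monotonicity and continuity of v(kappa) at once.

    Since A is only continuous, the equation need not have unique solutions.  Existence rests on the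
    fact that upper and lower limits, maxima and minima of solutions of a scalar equation are again
    solutions: v(kappa) is the supremum of the velocities for which some orbit leaving the upper root
    lies, at c = cb, above some orbit entering the lower root. *)

(** * Calculus on the unit interval and the unit square *)

(** The Rankine-Hugoniot conditions say that the quotient f(s,c)/(s + a(1)) equals v at both end
    states, and the right-hand side of the s-equation has the sign of this quotient minus v.
    Condition (F4) enters here: where the quotient exceeds vmin, f(s,c) exceeds f(s,cb), so f(s,.)
    has passed its valley on the way from cb to c and keeps rising beyond c. Hence positivity
    persists up to the end value of c, and the half-lines t <= 0 and t >= 0 can be studied
    separately, the second as a mirror image of the first.

    At v = vmin the row s = sb is a barrier between the two end states, so vmin is approached but
    never attained. For vmax no formula is given: it is the supremum of all v(kappa), and
    monotonicity makes it the limit at 0.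

    The delicate case of existence is a supremum of admissible velocities at which an end root sits
    at the maximum of its quotient. The root is then double, no velocity beyond it can be tried, and
    the connection comes instead from the fact that every orbit passing on the right side of a given
    one is also attracted to the double root. *)

Definition clamp (x : R) : R := Rmax 0 (Rmin 1 x).

Lemma clamp_unit x : 0 <= clamp x <= 1.
Proof. unfold clamp, Rmax, Rmin; repeat destruct Rle_dec; lra. Qed.

Lemma clamp_id x : 0 <= x <= 1 -> clamp x = x.
Proof. intros H; unfold clamp, Rmax, Rmin; repeat destruct Rle_dec; lra. Qed.

Lemma clamp_low x : x <= 0 -> clamp x = 0.
Proof. intros H; unfold clamp, Rmax, Rmin; repeat destruct Rle_dec; lra. Qed.

Lemma clamp_high x : 1 <= x -> clamp x = 1.
Proof. intros H; unfold clamp, Rmax, Rmin; repeat destruct Rle_dec; lra. Qed.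

Lemma clamp_lip x y : Rabs (clamp y - clamp x) <= Rabs (y - x).
Proof.
  unfold clamp, Rmax, Rmin; repeat destruct Rle_dec;
    apply Rabs_le; unfold Rabs; destruct Rcase_abs; lra.
Qed.

Lemma clamp_opp x : clamp (1 - x) = 1 - clamp x.
Proof. unfold clamp, Rmax, Rmin; repeat destruct Rle_dec; lra. Qed.

Lemma clamp_idem x : clamp (clamp x) = clamp x.
Proof. apply clamp_id, clamp_unit. Qed.

Definition uc2 (G : R -> R -> R) : Prop :=
  forall e, 0 < e -> exists d, 0 < d /\ forall s s' c c',
    Rabs (s' - s) < d -> Rabs (c' - c) < d -> Rabs (G s' c' - G s c) < e.

(** Constant continuation across the edges of the square: a function continuous on the square
    becomes bounded and uniformly continuous on the plane, so that solutions are defined for all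
    time without checking that they stay inside. *)
Definition clamped (g : R -> R -> R) (s c : R) : R := g (clamp s) (clamp c).

Lemma clamped_in g s c : 0 <= s <= 1 -> 0 <= c <= 1 -> clamped g s c = g s c.
Proof. intros; unfold clamped; rewrite !clamp_id; auto. Qed.

Lemma continuous_on_square_eps g (H : continuous_on_square g) s c :
  0 <= s <= 1 -> 0 <= c <= 1 -> forall e, 0 < e -> exists d, 0 < d /\
  forall s' c', 0 <= s' <= 1 -> 0 <= c' <= 1 ->
    Rabs (s' - s) < d -> Rabs (c' - c) < d -> Rabs (g s' c' - g s c) < e.
Proof.
  intros Hs Hc e He.
  specialize (H (s, c) (conj Hs Hc)); simpl in H.
  destruct (proj1 (filterlim_locally _ _) H (mkposreal e He)) as [d Hd].
  exists d; split. { apply cond_pos. }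
  intros s' c' Hs' Hc' H1 H2.
  apply (Hd (s', c')); split; assumption.
Qed.

Lemma square_uc g : continuous_on_square g -> uc2 (clamped g).
Proof.
  intros H e He.
  destruct (uniform_continuity_2d (clamped g) 0 1 0 1) with (eps := mkposreal e He)
    as [d Hd].
  { intros x y Hx Hy eps.
    destruct (continuous_on_square_eps g H x y Hx Hy eps (cond_pos eps)) as [d [Hd K]].
    exists (mkposreal d Hd); simpl; intros u v Hu Hv.
    rewrite (clamped_in g x y) by assumption. unfold clamped.
    apply K; try apply clamp_unit.
    - rewrite <- (clamp_id x) by assumption. eapply Rle_lt_trans; [apply clamp_lip|]; assumption.
    - rewrite <- (clamp_id y) by assumption. eapply Rle_lt_trans; [apply clamp_lip|]; assumption. }
  exists d; split. { apply cond_pos. }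
  intros s s' c c' Hs Hc.
  specialize (Hd (clamp s) (clamp c) (clamp s') (clamp c')).
  unfold clamped in *. rewrite !clamp_idem in Hd. simpl in Hd.
  apply Hd; try apply clamp_unit.
  - eapply Rle_lt_trans; [apply clamp_lip|]; assumption.
  - eapply Rle_lt_trans; [apply clamp_lip|]; assumption.
Qed.

(** Walking from the corner (0,0) to any point of the square takes N steps shorter than d, and each
    changes the value by less than 1; N does not depend on the point. *)
Lemma uc2_bounded g : uc2 (clamped g) -> exists B, 0 < B /\ forall s c, Rabs (clamped g s c) <= B.
Proof.
  intros H. destruct (H 1 Rlt_0_1) as [d [Hd K]].
  destruct (nfloor_ex (/ d)) as [n Hn]. { left; apply Rinv_0_lt_compat; assumption. }
  assert (HdN : / INR (S n) < d).
  { rewrite <- (Rinv_inv d). apply Rinv_lt_contravar.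
    - apply Rmult_lt_0_compat; [apply Rinv_0_lt_compat; assumption|apply lt_0_INR; lia].
    - rewrite S_INR; lra. }
  assert (HN : 0 < INR (S n)) by (apply lt_0_INR; lia).
  revert HdN HN. generalize (S n). clear n Hn. intros N HdN HN.
  assert (P : forall s c k, 0 <= s <= 1 -> 0 <= c <= 1 -> (k <= N)%nat ->
     Rabs (clamped g (s * (INR k / INR N)) (c * (INR k / INR N)) - clamped g 0 0) <= INR k).
  { intros s c k Hs Hc. induction k as [|k IH]; intros Hk.
    - change (INR 0) with 0. replace (s * (0 / INR N)) with 0 by (field; lra).
      replace (c * (0 / INR N)) with 0 by (field; lra).
      rewrite Rminus_diag, Rabs_R0; lra.
    - assert (IH' := IH ltac:(lia)).
      assert (Hst : forall x, 0 <= x <= 1 ->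
        Rabs (x * (INR (S k) / INR N) - x * (INR k / INR N)) < d).
      { intros x Hx. rewrite S_INR.
        replace (x * ((INR k + 1) / INR N) - x * (INR k / INR N)) with (x * / INR N) by (field; lra).
        assert (0 < / INR N) by (apply Rinv_0_lt_compat; assumption).
        rewrite Rabs_pos_eq by nra. nra. }
      assert (Q := K _ _ _ _ (Hst s Hs) (Hst c Hc)).
      replace (clamped g (s * (INR (S k) / INR N)) (c * (INR (S k) / INR N)) - clamped g 0 0)
        with ((clamped g (s * (INR (S k) / INR N)) (c * (INR (S k) / INR N)) -
               clamped g (s * (INR k / INR N)) (c * (INR k / INR N))) +
              (clamped g (s * (INR k / INR N)) (c * (INR k / INR N)) - clamped g 0 0)) by ring.
      eapply Rle_trans; [apply Rabs_triang|]. assert (Ek := S_INR k). lra. }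
  exists (Rabs (clamped g 0 0) + INR N). split.
  { assert (0 <= Rabs (clamped g 0 0)) by apply Rabs_pos. lra. }
  intros s c.
  assert (Q := P (clamp s) (clamp c) N (clamp_unit s) (clamp_unit c) (le_n N)).
  replace (INR N / INR N) with 1 in Q by (field; lra). rewrite !Rmult_1_r in Q.
  assert (E : clamped g (clamp s) (clamp c) = clamped g s c)
    by (unfold clamped; rewrite !clamp_idem; reflexivity).
  rewrite E in Q.
  replace (clamped g s c) with ((clamped g s c - clamped g 0 0) + clamped g 0 0) by ring.
  eapply Rle_trans; [apply Rabs_triang|]. lra.
Qed.

Lemma square_bounded g : continuous_on_square g ->
  exists B, 0 < B /\ forall s c, 0 <= s <= 1 -> 0 <= c <= 1 -> Rabs (g s c) <= B.
Proof.
  intros H. destruct (uc2_bounded g (square_uc g H)) as [B [HB K]].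
  exists B; split; auto. intros s c Hs Hc.
  rewrite <- (clamped_in g s c) by assumption. apply K.
Qed.

Lemma D_in_eps g g1 D x : D_in g g1 D x -> forall e, 0 < e -> exists d, 0 < d /\
  forall y, D y -> Rabs (y - x) < d -> Rabs (g y - g x - g1 x * (y - x)) <= e * Rabs (y - x).
Proof.
  intros H e He. destruct (H e He) as [d [Hd K]].
  exists d; split; [exact Hd|]. intros y Hy Hyx.
  destruct (Req_dec y x) as [->|Hne].
  { rewrite !Rminus_diag, Rmult_0_r, Rminus_0_r, Rabs_R0; lra. }
  assert (Q : Rabs ((g y - g x) / (y - x) - g1 x) < e).
  { apply (K y). split; [split; [exact Hy|congruence]|exact Hyx]. }
  replace (g y - g x - g1 x * (y - x)) with (((g y - g x) / (y - x) - g1 x) * (y - x))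
    by (field; lra).
  rewrite Rabs_mult. apply Rmult_le_compat_r; [apply Rabs_pos|lra].
Qed.

Lemma eps_D_in g g1 D x : (forall e, 0 < e -> exists d, 0 < d /\
  forall y, D y -> Rabs (y - x) < d -> Rabs (g y - g x - g1 x * (y - x)) <= e * Rabs (y - x)) ->
  D_in g g1 D x.
Proof.
  intros H e He. destruct (H (e / 2) ltac:(lra)) as [d [Hd K]].
  exists d; split; [exact Hd|]. intros y [[Hy Hne] Hyx].
  simpl. unfold Rdist. specialize (K y Hy Hyx).
  assert (0 < Rabs (y - x)) by (apply Rabs_pos_lt; lra).
  replace ((g y - g x) / (y - x) - g1 x) with ((g y - g x - g1 x * (y - x)) / (y - x))
    by (field; lra).
  unfold Rdiv at 1. rewrite Rabs_mult, Rabs_inv.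
  apply Rmult_lt_reg_r with (Rabs (y - x)); [assumption|].
  rewrite Rmult_assoc, Rinv_l, Rmult_1_r by lra. nra.
Qed.

Lemma is_derive_eps (g : R -> R) x l : is_derive g x l <-> forall e, 0 < e -> exists d, 0 < d /\
  forall y, Rabs (y - x) < d -> Rabs (g y - g x - l * (y - x)) <= e * Rabs (y - x).
Proof.
  rewrite is_derive_Reals. split.
  - intros H e He. destruct (H e He) as [d K].
    exists d; split; [apply cond_pos|]. intros y Hy.
    destruct (Req_dec y x) as [->|Hne].
    { rewrite !Rminus_diag, Rmult_0_r, Rminus_0_r, Rabs_R0; lra. }
    specialize (K (y - x) ltac:(lra) Hy).
    replace (x + (y - x)) with y in K by ring.
    replace (g y - g x - l * (y - x)) with (((g y - g x) / (y - x) - l) * (y - x)) by (field; lra).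
    rewrite Rabs_mult. apply Rmult_le_compat_r; [apply Rabs_pos|lra].
  - intros H e He. destruct (H (e / 2) ltac:(lra)) as [d [Hd K]].
    exists (mkposreal d Hd). intros h Hh Hhd. simpl in Hhd.
    specialize (K (x + h)). replace (x + h - x) with h in K by ring. specialize (K Hhd).
    assert (0 < Rabs h) by (apply Rabs_pos_lt; lra).
    replace ((g (x + h) - g x) / h - l) with ((g (x + h) - g x - l * h) / h) by (field; lra).
    unfold Rdiv at 1. rewrite Rabs_mult, Rabs_inv.
    apply Rmult_lt_reg_r with (Rabs h); [assumption|].
    rewrite Rmult_assoc, Rinv_l, Rmult_1_r by lra. nra.
Qed.

Lemma exists_below a b c : 0 < a -> 0 < b -> 0 < c -> exists h, 0 < h /\ h <= a /\ h <= b /\ h <= c.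
Proof.
  intros Ha Hb Hc. exists (Rmin a (Rmin b c)). split; [repeat apply Rmin_pos; auto|].
  split; [apply Rmin_l|]. split; (eapply Rle_trans; [apply Rmin_r|]); [apply Rmin_l|apply Rmin_r].
Qed.

(* The linear extension makes the calculus of functions on the whole line available for
   functions that are differentiable relative to [0,1] only. *)
Definition linear_ext (g g1 : R -> R) (x : R) : R :=
  g (clamp x) + g1 (clamp x) * (x - clamp x).

Lemma linear_ext_in g g1 x : 0 <= x <= 1 -> linear_ext g g1 x = g x.
Proof. intros H; unfold linear_ext; rewrite clamp_id by assumption; ring. Qed.

Lemma linear_ext_derive g g1 : (forall x, unit_interval x -> D_in g g1 unit_interval x) ->
  forall x, is_derive (linear_ext g g1) x (g1 (clamp x)).
Proof.
  intros H x. apply is_derive_eps. intros e He.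
  destruct (D_in_eps _ _ _ _ (H (clamp x) (clamp_unit x)) e He) as [d [Hd K]].
  destruct (Rlt_le_dec x 0) as [H0|H0].
  { exists (- x). split; [lra|]. intros y Hy.
    assert (y <= 0) by (apply Rabs_def2 in Hy; lra).
    unfold linear_ext. rewrite !clamp_low by lra.
    match goal with |- Rabs ?a <= _ => replace a with 0 by ring end.
    rewrite Rabs_R0. apply Rmult_le_pos; [lra|apply Rabs_pos]. }
  destruct (Rlt_le_dec 1 x) as [H1|H1].
  { exists (x - 1). split; [lra|]. intros y Hy.
    assert (1 <= y) by (apply Rabs_def2 in Hy; lra).
    unfold linear_ext. rewrite !clamp_high by lra.
    match goal with |- Rabs ?a <= _ => replace a with 0 by ring end.
    rewrite Rabs_R0. apply Rmult_le_pos; [lra|apply Rabs_pos]. }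
  rewrite clamp_id in * by lra.
  destruct (Req_dec x 0) as [Hx0|Hx0].
  { subst x. exists (Rmin d 1). split; [apply Rmin_pos; lra|]. intros y Hy.
    assert (Rabs (y - 0) < d /\ Rabs (y - 0) < 1) as [Hy1 Hy2]
      by (split; (eapply Rlt_le_trans; [exact Hy|]); [apply Rmin_l|apply Rmin_r]).
    destruct (Rle_dec y 0).
    - unfold linear_ext. rewrite !clamp_low by lra.
      match goal with |- Rabs ?a <= _ => replace a with 0 by ring end.
      rewrite Rabs_R0. apply Rmult_le_pos; [lra|apply Rabs_pos].
    - rewrite !linear_ext_in by (apply Rabs_def2 in Hy2; lra).
      apply K; [apply Rabs_def2 in Hy2; red; lra | assumption]. }
  destruct (Req_dec x 1) as [Hx1|Hx1].
  { subst x. exists (Rmin d 1). split; [apply Rmin_pos; lra|]. intros y Hy.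
    assert (Rabs (y - 1) < d /\ Rabs (y - 1) < 1) as [Hy1 Hy2]
      by (split; (eapply Rlt_le_trans; [exact Hy|]); [apply Rmin_l|apply Rmin_r]).
    destruct (Rle_dec 1 y).
    - unfold linear_ext. rewrite !clamp_high by lra.
      match goal with |- Rabs ?a <= _ => replace a with 0 by ring end.
      rewrite Rabs_R0. apply Rmult_le_pos; [lra|apply Rabs_pos].
    - rewrite !linear_ext_in by (apply Rabs_def2 in Hy2; lra).
      apply K; [apply Rabs_def2 in Hy2; red; lra | assumption]. }
  destruct (exists_below d x (1 - x)) as [h [Hh [B1 [B2 B3]]]]; try lra.
  exists h. split; auto. intros y Hy. assert (Hy' := Rabs_def2 _ _ Hy).
  rewrite !linear_ext_in by lra. apply K; [red|]; lra.
Qed.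

Lemma MVT_R (g g1 : R -> R) x y : (forall z, x <= z <= y -> is_derive g z (g1 z)) -> x < y ->
  exists z, x < z < y /\ g y - g x = g1 z * (y - x).
Proof.
  intros H Hxy. destruct (MVT_cor2 g g1 x y Hxy) as [z [E Hz]].
  { intros c Hc. apply is_derive_Reals, H, Hc. }
  exists z; auto.
Qed.

Lemma MVT_unit g g1 x y : (forall z, unit_interval z -> D_in g g1 unit_interval z) ->
  0 <= x -> x < y -> y <= 1 -> exists z, x < z < y /\ g y - g x = g1 z * (y - x).
Proof.
  intros H Hx Hxy Hy.
  destruct (MVT_R (linear_ext g g1) (fun z => g1 (clamp z)) x y) as [z [Hz E]]; auto.
  { intros; apply linear_ext_derive, H. }
  exists z; split; auto. rewrite !linear_ext_in in E by lra. rewrite clamp_id in E by lra. exact E.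
Qed.

Lemma derive_increasing (g g1 : R -> R) x y :
  (forall z, x <= z <= y -> is_derive g z (g1 z)) -> (forall z, x < z < y -> 0 < g1 z) ->
  x < y -> g x < g y.
Proof.
  intros H P Hxy. destruct (MVT_R g g1 x y H Hxy) as [z [Hz E]]. specialize (P z Hz). nra.
Qed.

Lemma derive_nonincreasing (g g1 : R -> R) x y :
  (forall z, x <= z <= y -> is_derive g z (g1 z)) -> (forall z, x < z < y -> g1 z <= 0) ->
  x <= y -> g y <= g x.
Proof.
  intros H P Hxy. destruct (Req_dec x y) as [->|Hne]; [lra|].
  destruct (MVT_R g g1 x y H ltac:(lra)) as [z [Hz E]]. specialize (P z Hz). nra.
Qed.

Lemma unit_increasing g g1 x y :
  (forall z, unit_interval z -> D_in g g1 unit_interval z) ->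
  0 <= x -> x < y -> y <= 1 -> (forall z, x < z < y -> 0 < g1 z) -> g x < g y.
Proof.
  intros H Hx Hxy Hy P. destruct (MVT_unit g g1 x y H Hx Hxy Hy) as [z [Hz E]].
  specialize (P z Hz). nra.
Qed.

Lemma unit_decreasing g g1 x y :
  (forall z, unit_interval z -> D_in g g1 unit_interval z) ->
  0 <= x -> x < y -> y <= 1 -> (forall z, x < z < y -> g1 z < 0) -> g y < g x.
Proof.
  intros H Hx Hxy Hy P. destruct (MVT_unit g g1 x y H Hx Hxy Hy) as [z [Hz E]].
  specialize (P z Hz). nra.
Qed.

Lemma is_derive_cont (g : R -> R) x l : is_derive g x l -> continuous g x.
Proof. intros H. apply (ex_derive_continuous g). exists l; exact H. Qed.

Lemma continuity_eps (g : R -> R) x : continuous g x <->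
  forall e, 0 < e -> exists d, 0 < d /\ forall y, Rabs (y - x) < d -> Rabs (g y - g x) < e.
Proof.
  split.
  - intros H e He. destruct (proj1 (filterlim_locally _ _) H (mkposreal e He)) as [d Hd].
    exists d; split; [apply cond_pos|]. intros y Hy. apply (Hd y Hy).
  - intros H. apply filterlim_locally. intros e. destruct (H e (cond_pos e)) as [d [Hd K]].
    exists (mkposreal d Hd). intros y Hy. apply K, Hy.
Qed.

Lemma lipschitz_continuous (g : R -> R) K : 0 < K ->
  (forall x y, Rabs (g y - g x) <= K * Rabs (y - x)) -> forall x, continuous g x.
Proof.
  intros HK P x. apply continuity_eps. intros e He. exists (e / K).
  split; [apply Rdiv_lt_0_compat; lra|]. intros y Hy. eapply Rle_lt_trans; [apply P|].
  replace e with (K * (e / K)) by (field; lra). apply Rmult_lt_compat_l; lra.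
Qed.

Lemma locally_eps (P : R -> Prop) x : locally x P <->
  exists d, 0 < d /\ forall y, Rabs (y - x) < d -> P y.
Proof.
  split.
  - intros [d Hd]. exists d; split; [apply cond_pos|]. intros y Hy; apply Hd, Hy.
  - intros [d [Hd K]]. exists (mkposreal d Hd). intros y Hy; apply K, Hy.
Qed.

(* The segments joining (s,c) to (s',c') through (s,c') stay in the square, so no differentiability
   across its boundary is needed. *)
Lemma square_differentiable g g1 g2 s c : C1_square g g1 g2 ->
  0 <= s <= 1 -> 0 <= c <= 1 -> forall e, 0 < e -> exists d, 0 < d /\
  forall s' c', 0 <= s' <= 1 -> 0 <= c' <= 1 -> Rabs (s' - s) < d -> Rabs (c' - c) < d ->
    Rabs (g s' c' - g s c - g1 s c * (s' - s) - g2 s c * (c' - c))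
      <= e * (Rabs (s' - s) + Rabs (c' - c)).
Proof.
  intros [P1 [P2 [_ [K1 K2]]]] Hs Hc e He.
  destruct (continuous_on_square_eps g1 K1 s c Hs Hc e He) as [d1 [Hd1 L1]].
  destruct (continuous_on_square_eps g2 K2 s c Hs Hc e He) as [d2 [Hd2 L2]].
  exists (Rmin d1 d2). split; [apply Rmin_pos; assumption|].
  intros s' c' Hs' Hc' Hss Hcc.
  assert (Hss1 := Rlt_le_trans _ _ _ Hss (Rmin_l d1 d2)).
  assert (Hcc1 := Rlt_le_trans _ _ _ Hcc (Rmin_l d1 d2)).
  assert (Hcc2 := Rlt_le_trans _ _ _ Hcc (Rmin_r d1 d2)).
  assert (E1 : exists z, Rabs (z - s) <= Rabs (s' - s) /\ 0 <= z <= 1 /\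
     g s' c' - g s c' = g1 z c' * (s' - s)).
  { destruct (Rtotal_order s s') as [H|[H|H]].
    - destruct (MVT_unit (fun x => g x c') (fun x => g1 x c') s s') as [z [Hz E]]; try lra.
      { intros x Hx; apply (P1 x c'); assumption. }
      exists z; split; [|split; [lra|exact E]].
      rewrite !Rabs_pos_eq by lra; lra.
    - subst; exists s'; split; [lra|split; [lra|ring]].
    - destruct (MVT_unit (fun x => g x c') (fun x => g1 x c') s' s) as [z [Hz E]]; try lra.
      { intros x Hx; apply (P1 x c'); assumption. }
      exists z; split; [|split; [lra|lra]].
      rewrite !Rabs_left by lra; lra. }
  assert (E2 : exists w, Rabs (w - c) <= Rabs (c' - c) /\ 0 <= w <= 1 /\
     g s c' - g s c = g2 s w * (c' - c)).
  { destruct (Rtotal_order c c') as [H|[H|H]].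
    - destruct (MVT_unit (fun x => g s x) (fun x => g2 s x) c c') as [z [Hz E]]; try lra.
      { intros x Hx; apply (P2 s x); assumption. }
      exists z; split; [|split; [lra|exact E]].
      rewrite !Rabs_pos_eq by lra; lra.
    - subst; exists c'; split; [lra|split; [lra|ring]].
    - destruct (MVT_unit (fun x => g s x) (fun x => g2 s x) c' c) as [z [Hz E]]; try lra.
      { intros x Hx; apply (P2 s x); assumption. }
      exists z; split; [|split; [lra|lra]].
      rewrite !Rabs_left by lra; lra. }
  destruct E1 as [z [Hz [Uz E1]]]. destruct E2 as [w [Hw [Uw E2]]].
  replace (g s' c' - g s c - g1 s c * (s' - s) - g2 s c * (c' - c))
    with ((g1 z c' - g1 s c) * (s' - s) + (g2 s w - g2 s c) * (c' - c)) by lra.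
  assert (B1 : Rabs (g1 z c' - g1 s c) < e) by (apply L1; lra).
  assert (B2 : Rabs (g2 s w - g2 s c) < e).
  { apply L2; try lra. rewrite Rminus_diag, Rabs_R0; lra. }
  eapply Rle_trans; [apply Rabs_triang|]. rewrite !Rabs_mult.
  assert (0 <= Rabs (s' - s)) by apply Rabs_pos.
  assert (0 <= Rabs (c' - c)) by apply Rabs_pos.
  nra.
Qed.

Lemma square_chain g g1 g2 (S C : R -> R) t s1 c1 : C1_square g g1 g2 ->
  (forall x, 0 <= S x <= 1) -> (forall x, 0 <= C x <= 1) ->
  is_derive S t s1 -> is_derive C t c1 ->
  is_derive (fun x => g (S x) (C x)) t (g1 (S t) (C t) * s1 + g2 (S t) (C t) * c1).
Proof.
  intros HG US UC DS DC.
  apply is_derive_eps. intros e He.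
  (* B bounds the sum of the difference quotients of S and C near t, and M the size of the gradient
     of g. The error of linearising g and the errors of linearising S and C then get e / 2 each. *)
  set (B := Rabs s1 + Rabs c1 + 2).
  set (M := Rabs (g1 (S t) (C t)) + Rabs (g2 (S t) (C t)) + 1).
  assert (HB : 2 <= B) by (unfold B; assert (0 <= Rabs s1) by apply Rabs_pos;
    assert (0 <= Rabs c1) by apply Rabs_pos; lra).
  assert (0 <= Rabs (g1 (S t) (C t))) by apply Rabs_pos.
  assert (0 <= Rabs (g2 (S t) (C t))) by apply Rabs_pos.
  assert (HM : 1 <= M) by (unfold M; lra).
  destruct (square_differentiable g g1 g2 (S t) (C t) HG (US t) (UC t) (e / (2 * B)))
    as [d [Hd K]]. { apply Rdiv_lt_0_compat; lra. }
  set (e' := Rmin 1 (e / (2 * M))).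
  assert (He' : 0 < e') by (apply Rmin_pos; [lra|apply Rdiv_lt_0_compat; lra]).
  destruct (proj1 (is_derive_eps _ _ _) DS e' He') as [d1 [Hd1 K1]].
  destruct (proj1 (is_derive_eps _ _ _) DC e' He') as [d2 [Hd2 K2]].
  destruct (proj1 (continuity_eps _ _) (is_derive_cont _ _ _ DS) d Hd) as [d3 [Hd3 K3]].
  destruct (proj1 (continuity_eps _ _) (is_derive_cont _ _ _ DC) d Hd) as [d4 [Hd4 K4]].
  destruct (exists_below d1 d2 (Rmin d3 d4)) as [h [Hh [B1 [B2 B3]]]]; auto using Rmin_pos.
  assert (B4 := Rmin_l d3 d4). assert (B5 := Rmin_r d3 d4).
  exists h. split; auto. intros y Hy.
  specialize (K1 y ltac:(lra)). specialize (K2 y ltac:(lra)). specialize (K3 y ltac:(lra)).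
  specialize (K4 y ltac:(lra)).
  specialize (K (S y) (C y) (US y) (UC y) K3 K4).
  set (a := Rabs (y - t)) in *. assert (Ha : 0 <= a) by apply Rabs_pos.
  assert (L1 : Rabs (S y - S t) <= (Rabs s1 + 1) * a).
  { replace (S y - S t) with ((S y - S t - s1 * (y - t)) + s1 * (y - t)) by ring.
    eapply Rle_trans; [apply Rabs_triang|]. rewrite (Rabs_mult s1). fold a.
    assert (e' <= 1) by apply Rmin_l. nra. }
  assert (L2 : Rabs (C y - C t) <= (Rabs c1 + 1) * a).
  { replace (C y - C t) with ((C y - C t - c1 * (y - t)) + c1 * (y - t)) by ring.
    eapply Rle_trans; [apply Rabs_triang|]. rewrite (Rabs_mult c1). fold a.
    assert (e' <= 1) by apply Rmin_l. nra. }
  match goal with |- Rabs ?X <= _ => replace X with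
    ((g (S y) (C y) - g (S t) (C t) - g1 (S t) (C t) * (S y - S t) - g2 (S t) (C t) * (C y - C t))
     + (g1 (S t) (C t) * (S y - S t - s1 * (y - t)) + g2 (S t) (C t) * (C y - C t - c1 * (y - t))))
     by ring end.
  eapply Rle_trans; [apply Rabs_triang|].
  assert (Q1 : Rabs (g1 (S t) (C t) * (S y - S t - s1 * (y - t)) +
     g2 (S t) (C t) * (C y - C t - c1 * (y - t))) <= M * (e' * a)).
  { eapply Rle_trans; [apply Rabs_triang|]. rewrite !Rabs_mult. unfold M.
    assert (0 <= e' * a) by nra. nra. }
  assert (Q2 : e / (2 * B) * (Rabs (S y - S t) + Rabs (C y - C t)) <= e / 2 * a).
  { replace (e / 2 * a) with (e / (2 * B) * (B * a)) by (field; lra).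
    apply Rmult_le_compat_l; [left; apply Rdiv_lt_0_compat; lra|]. unfold B; lra. }
  assert (Q3 : M * (e' * a) <= e / 2 * a).
  { assert (e' <= e / (2 * M)) by apply Rmin_r.
    replace (e / 2 * a) with (M * (e / (2 * M) * a)) by (field; lra).
    apply Rmult_le_compat_l; [lra|]. apply Rmult_le_compat_r; lra. }
  lra.
Qed.

Lemma square_comp_continuous g (S C : R -> R) t : continuous_on_square g ->
  (forall x, 0 <= S x <= 1) -> (forall x, 0 <= C x <= 1) ->
  continuous S t -> continuous C t -> continuous (fun x => g (S x) (C x)) t.
Proof.
  intros HG US UC KS KC. apply continuity_eps. intros e He.
  destruct (continuous_on_square_eps g HG (S t) (C t) (US t) (UC t) e He) as [d [Hd K]].
  destruct (proj1 (continuity_eps _ _) KS d Hd) as [d1 [Hd1 K1]].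
  destruct (proj1 (continuity_eps _ _) KC d Hd) as [d2 [Hd2 K2]].
  exists (Rmin d1 d2). split; [apply Rmin_pos; assumption|]. intros y Hy.
  apply K; auto; [apply K1|apply K2]; eapply Rlt_le_trans; try exact Hy; [apply Rmin_l|apply Rmin_r].
Qed.

Lemma last_zero (x : R -> R) t0 t1 : (forall t, t0 <= t <= t1 -> continuous x t) ->
  t0 < t1 -> x t0 <= 0 -> 0 < x t1 ->
  exists t, t0 <= t < t1 /\ x t = 0 /\ forall r, t < r <= t1 -> 0 < x r.
Proof.
  intros K Ht H0 H1.
  destruct (completeness (fun t => t0 <= t <= t1 /\ x t <= 0)) as [m [Hub Hl]].
  { exists t1. intros t [Ht' _]; lra. }
  { exists t0; lra. }
  assert (Hm0 : t0 <= m) by (apply Hub; lra).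
  assert (Hm1 : m <= t1) by (apply Hl; intros t [Ht' _]; lra).
  assert (Pos : forall r, m < r <= t1 -> 0 < x r).
  { intros r Hr. destruct (Rlt_le_dec 0 (x r)); auto.
    assert (r <= m) by (apply Hub; lra). lra. }
  assert (Neg : x m <= 0).
  { destruct (Rle_lt_dec (x m) 0) as [|Hp]; auto.
    destruct (proj1 (continuity_eps _ _) (K m ltac:(lra)) (x m) Hp) as [d [Hd Q]].
    assert (m <= m - d / 2); [|lra].
    apply Hl. intros t [Ht' Hx].
    destruct (Rle_lt_dec t (m - d / 2)); auto.
    assert (t <= m) by (apply Hub; lra).
    specialize (Q t ltac:(apply Rabs_def1; lra)). apply Rabs_def2 in Q. lra. }
  assert (Hmt : m < t1) by (destruct (Req_dec m t1); [subst; lra|lra]).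
  exists m. split; [lra|]. split; [|exact Pos].
  destruct (Rle_lt_or_eq_dec _ _ Neg) as [Hn|]; auto.
  destruct (proj1 (continuity_eps _ _) (K m ltac:(lra)) (- x m) ltac:(lra)) as [d [Hd Q]].
  set (r := Rmin (m + d / 2) t1).
  assert (m < r <= t1 /\ r < m + d) as [Hr Hr'].
  { unfold r, Rmin; destruct Rle_dec; lra. }
  specialize (Q r ltac:(apply Rabs_def1; lra)). apply Rabs_def2 in Q.
  specialize (Pos r Hr). lra.
Qed.

(** After its last zero x would be positive, and there x exp(-M t) is nonincreasing. Only an upper
    bound on the derivative is needed, which is what makes the lemma fit fields that are not
    Lipschitz. *)
Lemma gronwall_sign (x x1 : R -> R) M t0 t1 :
  (forall t, t0 <= t <= t1 -> is_derive x t (x1 t)) ->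
  (forall t, t0 <= t <= t1 -> x1 t <= M * Rabs (x t)) ->
  t0 <= t1 -> x t0 <= 0 -> x t1 <= 0.
Proof.
  intros D B Ht H0. destruct (Rle_lt_dec (x t1) 0) as [|H1]; auto.
  destruct (Req_dec t0 t1) as [E|E]; [subst; lra|].
  destruct (last_zero x t0 t1) as [m [Hm [Zm Pm]]]; auto; try lra.
  { intros t Ht'; exact (is_derive_cont _ _ _ (D t Ht')). }
  assert (Q : x t1 * exp (- M * t1) <= x m * exp (- M * m)).
  { apply derive_nonincreasing with (g := fun t => x t * exp (- M * t))
      (g1 := fun t => (x1 t - M * x t) * exp (- M * t)); try lra.
    - intros z Hz. assert (Dz := D z ltac:(lra)).
      auto_derive. { exists (x1 z); exact Dz. }
      replace (Derive (fun x0 => x x0) z) with (x1 z) by (symmetry; apply is_derive_unique, Dz).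
      ring.
    - intros z Hz. specialize (B z ltac:(lra)). specialize (Pm z ltac:(lra)).
      rewrite Rabs_pos_eq in B by lra.
      assert (0 < exp (- M * z)) by apply exp_pos. nra. }
  rewrite Zm in Q. assert (0 < exp (- M * t1)) by apply exp_pos. nra.
Qed.

(** * Scalar differential equations with a continuous right-hand side *)

Definition ode_sol (g : R -> R -> R) (y : R -> R) : Prop :=
  forall t, is_derive y t (g (y t) t).

(** Asymptotic consistency with the equation. The relative error e is uniform in n over short
    intervals, while the absolute error eta disappears as n grows; it is there because Euler
    approximations are step functions. Solutions of nearby equations fit the same pattern. *)
Definition approximates (g : R -> R -> R) (u : nat -> R -> R) : Prop :=
  forall e, 0 < e -> exists d, 0 < d /\ forall t t', t <= t' -> t' < t + d ->
    forall eta, 0 < eta -> exists N, forall n, (N <= n)%nat ->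
      Rabs (u n t' - u n t - g (u n t) t * (t' - t)) <= e * (t' - t) + eta.

(** The hypothesis linearises forward from the earlier time only. For an increment to the left of t
    the slope at the earlier point must be exchanged for the slope at t, which costs another e / 2
    by uniform continuity. *)
Lemma ode_sol_of_increments g y L : uc2 g -> (forall s t, Rabs (g s t) <= L) ->
  (forall e, 0 < e -> exists d, 0 < d /\ forall t t', t <= t' -> t' < t + d ->
    Rabs (y t' - y t - g (y t) t * (t' - t)) <= e * (t' - t)) -> ode_sol g y.
Proof.
  intros U B H t. apply is_derive_eps. intros e He.
  assert (HL : 0 <= L) by (eapply Rle_trans; [apply Rabs_pos|apply (B 0 0)]).
  destruct (U (e / 2) ltac:(lra)) as [dd [Hdd K]].
  destruct (H (e / 2) ltac:(lra)) as [d [Hd Q]].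
  (* D exceeds both 1 and the rate at which y can move, so times within dd / D of each other keep
     both arguments of g within dd. *)
  set (D := L + e + 1). assert (HD : 1 <= D) by (unfold D; lra).
  exists (Rmin d (dd / D)). split; [apply Rmin_pos; [lra|apply Rdiv_lt_0_compat; lra]|].
  intros y' Hy. assert (Hy1 := Rlt_le_trans _ _ _ Hy (Rmin_l _ _)).
  assert (Hy2 := Rlt_le_trans _ _ _ Hy (Rmin_r _ _)).
  apply Rabs_def2 in Hy1.
  destruct (Rle_dec t y') as [Hle|Hgt].
  { eapply Rle_trans; [apply Q; lra|]. rewrite Rabs_pos_eq by lra. nra. }
  assert (E := Q y' t ltac:(lra) ltac:(lra)).
  assert (Hlt : Rabs (y' - t) * D < dd).
  { replace dd with (dd / D * D) by (field; lra). apply Rmult_lt_compat_r; lra. }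
  rewrite (Rabs_left (y' - t)) in * by lra.
  assert (Bg := B (y y') y'). apply Rabs_le_between in Bg.
  assert (E' := E). apply Rabs_le_between in E'.
  assert (Hyd : Rabs (y y' - y t) < dd).
  { apply Rabs_def1; unfold D in Hlt; nra. }
  assert (Htd : Rabs (y' - t) < dd) by (rewrite Rabs_left by lra; unfold D in Hlt; nra).
  assert (G := K _ _ _ _ Hyd Htd). apply Rabs_def2 in G.
  assert (P1 : (g (y y') y' - g (y t) t) * (t - y') <= e / 2 * (t - y')) by nra.
  assert (P2 : - (e / 2) * (t - y') <= (g (y y') y' - g (y t) t) * (t - y')) by nra.
  apply Rabs_le. split; lra.
Qed.

(** In its main use the three errors are that of the increment and those of the upper limits at the
    two times. *)
Lemma Rle_of_eta a b eta0 : 0 < eta0 -> (forall eta, 0 < eta -> eta < eta0 -> a <= b + 3 * eta) ->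
  a <= b.
Proof.
  intros H0 H. destruct (Rle_lt_dec a b) as [|Hab]; auto.
  set (eta := Rmin (eta0 / 2) ((a - b) / 6)).
  assert (0 < eta) by (apply Rmin_pos; lra).
  assert (eta <= eta0 / 2) by apply Rmin_l. assert (eta <= (a - b) / 6) by apply Rmin_r.
  specialize (H eta ltac:(lra) ltac:(lra)). lra.
Qed.

(* For a scalar equation the supremum of solutions is again a solution; this replaces a compactness
   argument. *)
Lemma limsup_solution g L u (y : R -> R) : uc2 g -> (forall s t, Rabs (g s t) <= L) ->
  approximates g u -> (forall t, is_LimSup_seq (fun n => u n t) (y t)) -> ode_sol g y.
Proof.
  intros U B A Y. apply ode_sol_of_increments with L; auto.
  assert (HL : 0 <= L) by (eapply Rle_trans; [apply Rabs_pos|apply (B 0 0)]).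
  intros e He. destruct (U (e / 2) ltac:(lra)) as [dd [Hdd K]].
  set (e1 := Rmin 1 (e / 2)).
  assert (He1 : 0 < e1) by (apply Rmin_pos; lra).
  assert (e1 <= 1) by apply Rmin_l. assert (e1 <= e / 2) by apply Rmin_r.
  destruct (A e1 He1) as [d1 [Hd1 Q]].
  set (d := Rmin d1 (dd / (4 * (L + 1)))).
  assert (Hd : 0 < d) by (apply Rmin_pos; [lra|apply Rdiv_lt_0_compat; lra]).
  assert (Hdd1 : d <= d1) by apply Rmin_l.
  assert (Hdd2 : d * (4 * (L + 1)) <= dd).
  { replace dd with (dd / (4 * (L + 1)) * (4 * (L + 1))) at 1 by (field; lra).
    apply Rmult_le_compat_r; [lra|apply Rmin_r]. }
  exists d. split; [exact Hd|]. intros t t' Ht Ht'.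
  set (D := t' - t). assert (HD0 : 0 <= D) by (unfold D; lra). assert (HDd : D < d) by (unfold D; lra).
  (* Lower bounds on the increment: for an index n with u n t close to its upper limit at t, the
     value u n t' cannot exceed the upper limit at t' by more than eta. The second, coarser bound is
     needed for the reverse direction. *)
  assert (Low : forall eta, 0 < eta -> eta < dd / 10 ->
     g (y t) t * D - e * D <= (y t' - y t) + 3 * eta /\ - (L + 1) * D <= (y t' - y t) + 3 * eta).
  { intros eta Heta Hsm. destruct (Q t t' Ht ltac:(lra) eta Heta) as [N1 P1].
    destruct (Y t (mkposreal eta Heta)) as [I1 [N2 P2]].
    destruct (Y t' (mkposreal eta Heta)) as [_ [N3 P3]]. simpl in *.
    destruct (I1 (N1 + N2 + N3)%nat) as [n [Hn I]].
    specialize (P1 n ltac:(lia)). specialize (P2 n ltac:(lia)). specialize (P3 n ltac:(lia)).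
    fold D in P1. apply Rabs_le_between in P1.
    assert (G := K (y t) (u n t) t t ltac:(apply Rabs_def1; lra)
                   ltac:(rewrite Rminus_diag, Rabs_R0; lra)).
    apply Rabs_def2 in G.
    assert (Bg := B (u n t) t). apply Rabs_le_between in Bg.
    split; nra. }
  apply Rabs_le_between; split.
  - apply Rplus_le_reg_l with (g (y t) t * D + e * D).
    apply Rle_of_eta with (dd / 10); [lra|]. intros eta H1 H2.
    destruct (Low eta H1 H2) as [P _]. fold D. lra.
  - apply Rplus_le_reg_l with (g (y t) t * D).
    apply Rle_of_eta with (dd / 10); [lra|]. intros eta Heta Hsm.
    (* Now n is chosen with u n t' close to its upper limit, and u n t is known a priori only to lie
       below y t + eta. The coarse bound shows that it is not far below y t either, so the slopes at
       the two points can be compared. *)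
    destruct (Low eta Heta Hsm) as [_ Lo].
    destruct (Q t t' Ht ltac:(lra) eta Heta) as [N1 P1].
    destruct (Y t (mkposreal eta Heta)) as [_ [N2 P2]].
    destruct (Y t' (mkposreal eta Heta)) as [I3 _]. simpl in *.
    destruct (I3 (N1 + N2)%nat) as [n [Hn I]].
    specialize (P1 n ltac:(lia)). specialize (P2 n ltac:(lia)).
    fold D in P1. apply Rabs_le_between in P1.
    assert (Bg := B (u n t) t). apply Rabs_le_between in Bg.
    assert (Hc : Rabs (u n t - y t) < dd) by (apply Rabs_def1; nra).
    assert (G := K (y t) (u n t) t t Hc ltac:(rewrite Rminus_diag, Rabs_R0; lra)).
    apply Rabs_def2 in G. fold D. nra.
Qed.

Definition eventually_bounded (u : nat -> R) : Prop :=
  exists B N, forall n, (N <= n)%nat -> Rabs (u n) <= B.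

Lemma bounded_limsup (u : nat -> R) : eventually_bounded u -> exists l : R, is_LimSup_seq u l.
Proof.
  intros [B [N0 H]]. destruct (ex_LimSup_seq u) as [[l| |] Hl].
  - exists l; exact Hl.
  - destruct (Hl B N0) as [n [Hn Hn']]. specialize (H n Hn). apply Rabs_le_between in H. lra.
  - destruct (Hl (- B)) as [N HN]. specialize (HN (N + N0)%nat ltac:(lia)).
    specialize (H (N + N0)%nat ltac:(lia)). apply Rabs_le_between in H. lra.
Qed.

Lemma exists_limsup_solution g L u : uc2 g -> (forall s t, Rabs (g s t) <= L) ->
  approximates g u -> (forall t, eventually_bounded (fun n => u n t)) ->
  exists y : R -> R, ode_sol g y /\ forall t, is_LimSup_seq (fun n => u n t) (y t).
Proof.
  intros U B A H.
  assert (Y : forall t, is_LimSup_seq (fun n => u n t) (real (LimSup_seq (fun n => u n t)))).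
  { intros t. destruct (bounded_limsup _ (H t)) as [l Hl].
    rewrite (is_LimSup_seq_unique _ _ Hl). exact Hl. }
  exists (fun t => real (LimSup_seq (fun n => u n t))). split; [|exact Y].
  eapply limsup_solution; eauto.
Qed.

Lemma exists_liminf_solution g L u : uc2 g -> (forall s t, Rabs (g s t) <= L) ->
  approximates g u -> (forall t, eventually_bounded (fun n => u n t)) ->
  exists y : R -> R, ode_sol g y /\ forall t, is_LimInf_seq (fun n => u n t) (y t).
Proof.
  intros U B A H.
  destruct (exists_limsup_solution (fun s t => - g (- s) t) L (fun n t => - u n t))
    as [y [Sy Ly]].
  - intros e He. destruct (U e He) as [d [Hd K]]. exists d; split; auto.
    intros s s' c c' H1 H2. specialize (K (- s) (- s') c c').
    replace (- g (- s') c' - - g (- s) c) with (- (g (- s') c' - g (- s) c)) by ring.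
    rewrite Rabs_Ropp. apply K; auto.
    replace (- s' - - s) with (- (s' - s)) by ring. rewrite Rabs_Ropp; auto.
  - intros s t. rewrite Rabs_Ropp. apply B.
  - intros e He. destruct (A e He) as [d [Hd K]]. exists d; split; auto.
    intros t t' H1 H2 eta H3. destruct (K t t' H1 H2 eta H3) as [N P]. exists N.
    intros n Hn. specialize (P n Hn). rewrite Ropp_involutive.
    match goal with |- Rabs ?X <= _ =>
      replace X with (- (u n t' - u n t - g (u n t) t * (t' - t))) by ring end.
    rewrite Rabs_Ropp. exact P.
  - intros t. destruct (H t) as [b [N Hb]]. exists b, N. intros n Hn. rewrite Rabs_Ropp. apply Hb, Hn.
  - exists (fun t => - y t). split.
    + intros t. specialize (Sy t).
      replace (g (- y t) t) with (- - g (- y t) t) by ring. apply (is_derive_opp y), Sy.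
    + intros t. specialize (Ly t).
      apply is_LimSup_opp_LimInf_seq. simpl. rewrite Ropp_involutive. exact Ly.
Qed.

(** What upper and lower limits have in common; it suffices for passing weak inequalities to the
    limit. *)
Definition cluster (u : nat -> R) (l : R) : Prop :=
  forall e N, 0 < e -> exists n, (N <= n)%nat /\ Rabs (u n - l) < e.

Lemma limsup_cluster u (l : R) : is_LimSup_seq u l -> cluster u l.
Proof.
  intros H e N He. destruct (H (mkposreal e He)) as [I [M P]]. simpl in *.
  destruct (I (N + M)%nat) as [n [Hn Q]]. exists n. split; [lia|].
  specialize (P n ltac:(lia)). apply Rabs_def1; lra.
Qed.

Lemma liminf_cluster u (l : R) : is_LimInf_seq u l -> cluster u l.
Proof.
  intros H e N He. destruct (H (mkposreal e He)) as [I [M P]]. simpl in *.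
  destruct (I (N + M)%nat) as [n [Hn Q]]. exists n. split; [lia|].
  specialize (P n ltac:(lia)). apply Rabs_def1; lra.
Qed.

Lemma cluster_le u l b N : cluster u l -> (forall n, (N <= n)%nat -> u n <= b) -> l <= b.
Proof.
  intros H P. destruct (Rle_lt_dec l b) as [|Hl]; auto.
  destruct (H (l - b) N ltac:(lra)) as [n [Hn Q]]. specialize (P n Hn). apply Rabs_def2 in Q. lra.
Qed.

Lemma cluster_ge u l b N : cluster u l -> (forall n, (N <= n)%nat -> b <= u n) -> b <= l.
Proof.
  intros H P. destruct (Rle_lt_dec b l) as [|Hl]; auto.
  destruct (H (b - l) N ltac:(lra)) as [n [Hn Q]]. specialize (P n Hn). apply Rabs_def2 in Q. lra.
Qed.

(** The mean value theorem is applied twice: once to express the increment by the field at an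
    intermediate time, once to bound the motion up to that time. *)
Lemma solutions_approximate g gn u : uc2 g -> forall L, 0 <= L ->
  (forall n s t, Rabs (gn n s t) <= L) ->
  (forall e, 0 < e -> exists N, forall n, (N <= n)%nat -> forall s t, Rabs (gn n s t - g s t) <= e) ->
  (forall n, ode_sol (gn n) (u n)) -> approximates g u.
Proof.
  intros U L HL B H S e He.
  destruct (U (e / 2) ltac:(lra)) as [d [Hd K]].
  exists (d / (L + 1)). split; [apply Rdiv_lt_0_compat; lra|].
  intros t t' H1 H2 eta Heta. destruct (H (e / 2) ltac:(lra)) as [N P].
  exists N. intros n Hn.
  destruct (Req_dec t t') as [->|Hne].
  { rewrite !Rminus_diag, !Rmult_0_r, Rminus_0_r, Rabs_R0; lra. }
  assert (Hlt : (t' - t) * (L + 1) < d).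
  { replace d with (d / (L + 1) * (L + 1)) by (field; lra). apply Rmult_lt_compat_r; lra. }
  destruct (MVT_R (u n) (fun r => gn n (u n r) r) t t') as [z [Hz E]]; try lra.
  { intros r _; apply S. }
  destruct (MVT_R (u n) (fun r => gn n (u n r) r) t z) as [w [Hw E']]; try lra.
  { intros r _; apply S. }
  assert (Bw := B n (u n w) w). apply Rabs_le_between in Bw.
  assert (G := K (u n t) (u n z) t z ltac:(apply Rabs_def1; nra) ltac:(apply Rabs_def1; nra)).
  assert (G' := P n Hn (u n z) z).
  apply Rabs_def2 in G. apply Rabs_le_between in G'.
  apply Rabs_le. rewrite E. nra.
Qed.

Definition nat_floor (x : R) : nat := Z.to_nat (Int_part x).

Lemma nat_floor_spec x : 0 <= x -> INR (nat_floor x) <= x < INR (nat_floor x) + 1.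
Proof.
  intros Hx. destruct (base_Int_part x) as [H1 H2]. unfold nat_floor.
  assert (0 <= Int_part x)%Z. { apply Z.lt_succ_r. apply lt_IZR. rewrite succ_IZR. simpl. lra. }
  rewrite INR_IZR_INZ, Z2Nat.id by assumption. lra.
Qed.

(** * Euler approximations started at ever earlier times *)

Section Euler.
Variables (g : R -> R -> R) (L p : R).
Hypotheses (Ug : uc2 g) (Bg : forall s t, Rabs (g s t) <= L).

Fixpoint euler (h t0 : R) (k : nat) : R :=
  match k with
  | O => p
  | S k => euler h t0 k + h * g (euler h t0 k) (t0 + INR k * h)
  end.

(** The n-th approximation starts from p at time -n with steps 1/(n+1), so the start recedes to
    minus infinity while the mesh shrinks. It is constant between nodes; before time -n the floor is
    0 and the value is p. *)
Definition euler_approx (n : nat) (t : R) : R :=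
  euler (/ INR (S n)) (- INR n) (nat_floor ((t + INR n) * INR (S n))).

Lemma euler_node (n : nat) t : - INR n <= t ->
  let k := nat_floor ((t + INR n) * INR (S n)) in
  - INR n + INR k * / INR (S n) <= t < - INR n + INR k * / INR (S n) + / INR (S n).
Proof.
  intros Ht k. assert (HN : 0 < INR (S n)) by (apply lt_0_INR; lia).
  destruct (nat_floor_spec ((t + INR n) * INR (S n))) as [H1 H2]. { apply Rmult_le_pos; lra. }
  fold k in H1, H2. revert H1 H2 HN. generalize (INR (S n)) (INR k). intros N j H1 H2 HN.
  assert (E : (t + INR n) = (t + INR n) * N * / N) by (field; lra).
  assert (Hi : 0 < / N) by (apply Rinv_0_lt_compat; lra).
  split.
  - apply Rmult_le_compat_r with (r := / N) in H1; lra.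
  - apply Rmult_lt_compat_r with (r := / N) in H2; lra.
Qed.

(** The two bounds are proved together: the second keeps the later nodes within reach of the modulus
    of continuity used for the first. The extra h in the last smallness condition allows t to lie
    anywhere in the step that starts at node k. *)
Lemma euler_increment h t0 k e d t j : 0 < h -> 0 <= L ->
  (forall s s' c c', Rabs (s' - s) < d -> Rabs (c' - c) < d -> Rabs (g s' c' - g s c) < e) ->
  t0 + INR k * h <= t -> t < t0 + INR k * h + h -> INR j * h * (L + 1) + h < d ->
  Rabs (euler h t0 (k + j) - euler h t0 k - INR j * h * g (euler h t0 k) t) <= INR j * h * e /\
  Rabs (euler h t0 (k + j) - euler h t0 k) <= INR j * h * L.
Proof.
  intros Hh HL K H1 H2. induction j as [|j IH]; intros Hj.
  - rewrite Nat.add_0_r. simpl. rewrite Rminus_diag, !Rmult_0_l, Rminus_0_r, Rabs_R0. lra.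
  - rewrite S_INR in *. assert (0 <= INR j) by apply pos_INR.
    destruct IH as [I1 I2]. { nra. }
    rewrite Nat.add_succ_r. simpl. set (E := euler h t0 (k + j)) in *.
    set (E0 := euler h t0 k) in *. rewrite plus_INR.
    set (tt := t0 + (INR k + INR j) * h).
    set (m := INR j * h) in *.
    assert (Hm : 0 <= m) by (apply Rmult_le_pos; lra).
    assert (Em : (INR j + 1) * h = m + h) by (unfold m; ring). rewrite Em in *.
    assert (Htt : tt = t0 + INR k * h + m) by (unfold tt, m; ring).
    assert (0 <= m * L) by (apply Rmult_le_pos; lra).
    assert (0 <= h * L) by (apply Rmult_le_pos; lra).
    assert (G : Rabs (g E tt - g E0 t) < e).
    { apply K.
      - eapply Rle_lt_trans; [exact I2|]. lra.
      - rewrite Htt. apply Rabs_def1; lra. }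
    assert (G2 := Bg E tt). apply Rabs_def2 in G.
    apply Rabs_le_between in G2. apply Rabs_le_between in I1. apply Rabs_le_between in I2.
    split; apply Rabs_le; nra.
Qed.

Lemma euler_lipschitz h t0 k j : 0 < h ->
  Rabs (euler h t0 (k + j) - euler h t0 k) <= INR j * h * L.
Proof.
  intros Hh. induction j as [|j IH].
  - rewrite Nat.add_0_r. simpl. rewrite Rminus_diag, Rabs_R0. lra.
  - rewrite S_INR, Nat.add_succ_r. simpl.
    assert (Q := Bg (euler h t0 (k + j)) (t0 + INR (k + j) * h)).
    apply Rabs_le_between in Q. apply Rabs_le_between in IH. apply Rabs_le. nra.
Qed.

Lemma euler_approximates : approximates g euler_approx.
Proof.
  assert (HL : 0 <= L) by (eapply Rle_trans; [apply Rabs_pos|apply (Bg 0 0)]).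
  intros e He. destruct (Ug e He) as [dd [Hdd K]].
  set (d := dd / (2 * (L + 1))).
  assert (Hd : 0 < d) by (apply Rdiv_lt_0_compat; lra).
  assert (Ed : d * (L + 1) = dd / 2) by (unfold d; field; lra).
  exists d; split; auto. intros t t' H1 H2 eta Heta.
  (* The first entry absorbs into eta the mismatch of up to one step between the times t, t' and
     their nodes; the second keeps the nodes within dd. *)
  set (h0 := Rmin (eta / (e + L + 1)) (dd / (4 * (L + 2)))).
  assert (Hh0 : 0 < h0) by (apply Rmin_pos; apply Rdiv_lt_0_compat; lra).
  destruct (INR_unbounded (Rabs t + / h0)) as [N HN].
  exists N. intros n Hn.
  assert (HnN : INR N <= INR n) by (apply le_INR; lia).
  assert (0 <= Rabs t) by apply Rabs_pos.
  assert (0 < / h0) by (apply Rinv_0_lt_compat; lra).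
  assert (Ht0 : - INR n <= t). { assert (Q := Rle_abs (- t)). rewrite Rabs_Ropp in Q. lra. }
  assert (HSn : 0 < INR (S n)) by (apply lt_0_INR; lia).
  set (h := / INR (S n)).
  assert (Hh : 0 < h) by (apply Rinv_0_lt_compat; lra).
  assert (Hhh : h < h0).
  { unfold h. rewrite <- (Rinv_inv h0). apply Rinv_lt_contravar; [nra|rewrite S_INR; lra]. }
  assert (Hb1 : h * (e + L + 1) <= eta).
  { replace eta with (eta / (e + L + 1) * (e + L + 1)) by (field; lra).
    apply Rmult_le_compat_r; [lra|]. assert (h0 <= eta / (e + L + 1)) by apply Rmin_l. lra. }
  assert (Hb2 : h * (L + 2) <= dd / 4).
  { replace (dd / 4) with (dd / (4 * (L + 2)) * (L + 2)) by (field; lra).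
    apply Rmult_le_compat_r; [lra|]. assert (h0 <= dd / (4 * (L + 2))) by apply Rmin_r. lra. }
  destruct (euler_node n t Ht0) as [A1 A2]. destruct (euler_node n t' ltac:(lra)) as [B1 B2].
  unfold euler_approx. fold h in A1, A2, B1, B2 |- *.
  set (k := nat_floor ((t + INR n) * INR (S n))) in *.
  set (k' := nat_floor ((t' + INR n) * INR (S n))) in *.
  assert (Hk : (k <= k')%nat).
  { assert (Q : INR k < INR k' + 1) by nra. rewrite <- S_INR in Q. apply INR_lt in Q. lia. }
  destruct (Nat.le_exists_sub k k' Hk) as [j [Ej _]].
  assert (Ejk : INR k' = INR k + INR j) by (rewrite Ej, plus_INR; ring).
  assert (0 <= INR j) by apply pos_INR.
  destruct (euler_increment h (- INR n) k e dd t j Hh HL K) as [I1 _]; try lra.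
  { rewrite Ejk in B1, B2. nra. }
  replace k' with (k + j)%nat by lia.
  set (E := euler h (- INR n) (k + j)) in *. set (E0 := euler h (- INR n) k) in *.
  assert (Q := Bg E0 t). apply Rabs_le_between in Q. apply Rabs_le_between in I1.
  assert (J1 : INR j * h - h <= t' - t) by nra.
  assert (J2 : t' - t <= INR j * h + h) by nra.
  apply Rabs_le. nra.
Qed.

(** A step from below hi overshoots by at most h L, and above hi no step goes up. *)
Lemma euler_below h t0 hi T k : 0 < h -> p <= hi -> (forall s t, t <= T -> hi <= s -> g s t <= 0) ->
  t0 + INR k * h <= T -> euler h t0 k <= hi + h * L.
Proof.
  assert (HL : 0 <= L) by (eapply Rle_trans; [apply Rabs_pos|apply (Bg 0 0)]).
  intros Hh Hp H. induction k as [|k IH]; intros Ht; simpl.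
  - nra.
  - rewrite S_INR in Ht. assert (Ht' : t0 + INR k * h <= T) by nra. specialize (IH Ht').
    destruct (Rle_dec hi (euler h t0 k)) as [Hc|Hc].
    + specialize (H _ _ Ht' Hc). nra.
    + assert (Q := Bg (euler h t0 k) (t0 + INR k * h)). apply Rabs_le_between in Q. nra.
Qed.

(** The sign of g is required only in a strip of width del under lo, because a step of height at
    most h L <= del cannot jump across it. *)
Lemma euler_above h t0 lo T del k : 0 < h -> lo <= p -> h * L <= del ->
  (forall s t, t <= T -> lo - del <= s <= lo -> 0 <= g s t) ->
  t0 + INR k * h <= T -> lo - h * L <= euler h t0 k.
Proof.
  assert (HL : 0 <= L) by (eapply Rle_trans; [apply Rabs_pos|apply (Bg 0 0)]).
  intros Hh Hp Hd H. induction k as [|k IH]; intros Ht; simpl.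
  - nra.
  - rewrite S_INR in Ht. assert (Ht' : t0 + INR k * h <= T) by nra. specialize (IH Ht').
    destruct (Rle_dec (euler h t0 k) lo) as [Hc|Hc].
    + specialize (H (euler h t0 k) _ Ht' ltac:(lra)). nra.
    + assert (Q := Bg (euler h t0 k) (t0 + INR k * h)). apply Rabs_le_between in Q. nra.
Qed.

Lemma euler_small_step t eps : 0 < eps -> exists N, forall n, (N <= n)%nat ->
  - INR n <= t /\ 0 < / INR (S n) /\ / INR (S n) * L <= eps.
Proof.
  assert (HL : 0 <= L) by (eapply Rle_trans; [apply Rabs_pos|apply (Bg 0 0)]).
  intros He.
  assert (0 <= Rabs t) by apply Rabs_pos.
  assert (0 <= L / eps) by (apply Rdiv_le_0_compat; lra).
  destruct (INR_unbounded (Rabs t + L / eps)) as [N HN].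
  exists N. intros n Hn. assert (HnN : INR N <= INR n) by (apply le_INR; lia).
  assert (HSn : 0 < INR (S n)) by (apply lt_0_INR; lia).
  repeat split.
  - assert (Q := Rle_abs (- t)). rewrite Rabs_Ropp in Q. lra.
  - apply Rinv_0_lt_compat; assumption.
  - apply Rmult_le_reg_l with (INR (S n)); auto.
    replace (INR (S n) * (/ INR (S n) * L)) with L by (field; lra).
    rewrite S_INR. replace L with (L / eps * eps) by (field; lra). nra.
Qed.

Lemma exists_solution_from_minus_infinity hi lo T1 T2 del :
  p <= hi -> (forall s t, t <= T1 -> hi <= s -> g s t <= 0) ->
  lo <= p -> 0 < del -> (forall s t, t <= T2 -> lo - del <= s <= lo -> 0 <= g s t) ->
  exists y, ode_sol g y /\ (forall t, t <= T1 -> y t <= hi) /\ (forall t, t <= T2 -> lo <= y t).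
Proof.
  intros Hp Hhi Hlo Hdel Hl.
  assert (HL : 0 <= L) by (eapply Rle_trans; [apply Rabs_pos|apply (Bg 0 0)]).
  destruct (exists_limsup_solution g L euler_approx) as [y [Sy Ly]]; auto.
  - apply euler_approximates.
  (* Up to time tm the two barriers bound the approximations independently of their starting time;
     from tm to t they move at most at rate L. *)
  - intros t. set (tm := Rmin t (Rmin T1 T2)).
    assert (Htm : tm <= t) by apply Rmin_l.
    assert (Htm12 : tm <= Rmin T1 T2) by apply Rmin_r.
    assert (Htm1 : tm <= T1) by (eapply Rle_trans; [exact Htm12|apply Rmin_l]).
    assert (Htm2 : tm <= T2) by (eapply Rle_trans; [exact Htm12|apply Rmin_r]).
    destruct (euler_small_step tm (Rmin del 1)) as [N HN]. { apply Rmin_pos; lra. }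
    exists (Rabs lo + Rabs hi + 2 + (t - tm) * L), N. intros n Hn.
    destruct (HN n Hn) as [H1 [H2 H3]].
    assert (H4 := Rle_trans _ _ _ H3 (Rmin_l _ _)).
    assert (H5 := Rle_trans _ _ _ H3 (Rmin_r _ _)).
    destruct (euler_node n tm H1) as [A1 A2]. destruct (euler_node n t ltac:(lra)) as [B1 B2].
    unfold euler_approx.
    assert (Q1 := euler_below (/ INR (S n)) (- INR n) hi T1 _ H2 Hp Hhi (Rle_trans _ _ _ A1 Htm1)).
    assert (Q2 := euler_above (/ INR (S n)) (- INR n) lo T2 del _ H2 Hlo H4 Hl
                    (Rle_trans _ _ _ A1 Htm2)).
    set (h := / INR (S n)) in *.
    set (k := nat_floor ((tm + INR n) * INR (S n))) in *.
    set (k' := nat_floor ((t + INR n) * INR (S n))) in *.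
    assert (Hk : (k <= k')%nat).
    { assert (Q : INR k < INR k' + 1) by nra. rewrite <- S_INR in Q. apply INR_lt in Q. lia. }
    destruct (Nat.le_exists_sub k k' Hk) as [j [Ej _]].
    assert (Ejk : INR k' = INR k + INR j) by (rewrite Ej, plus_INR; ring).
    assert (Q3 := euler_lipschitz h (- INR n) k j H2).
    replace k' with (k + j)%nat by lia.
    assert (Q4 : INR j * h <= t - tm + h) by (rewrite Ejk in B1; nra).
    assert (Q5 : INR j * h * L <= (t - tm) * L + 1) by nra.
    assert (M1 := Rle_abs hi). assert (M2 := Rle_abs (- lo)). rewrite Rabs_Ropp in M2.
    assert (M3 := Rabs_pos hi). assert (M4 := Rabs_pos lo).
    apply Rabs_le_between in Q3. apply Rabs_le. lra.
  - exists y. split; [exact Sy|]. split.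
    + intros t Ht. apply Rle_of_eta with 1; [lra|]. intros eta He _.
      destruct (euler_small_step t eta He) as [N HN].
      apply cluster_le with (fun n => euler_approx n t) N; [apply limsup_cluster, Ly|].
      intros n Hn. destruct (HN n Hn) as [H1 [H2 H3]].
      destruct (euler_node n t H1) as [A1 A2].
      assert (Q := euler_below (/ INR (S n)) (- INR n) hi T1
        (nat_floor ((t + INR n) * INR (S n))) H2 Hp Hhi ltac:(lra)).
      unfold euler_approx. lra.
    + intros t Ht. apply Rle_of_eta with del; [lra|]. intros eta He He'.
      destruct (euler_small_step t eta He) as [N HN].
      assert (lo - eta <= y t); [|lra].
      apply cluster_ge with (fun n => euler_approx n t) N; [apply limsup_cluster, Ly|].
      intros n Hn. destruct (HN n Hn) as [H1 [H2 H3]].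
      destruct (euler_node n t H1) as [A1 A2].
      assert (Q := euler_above (/ INR (S n)) (- INR n) lo T2 del
        (nat_floor ((t + INR n) * INR (S n))) H2 Hlo ltac:(lra) Hl ltac:(lra)).
      unfold euler_approx. lra.
Qed.
End Euler.

(** * Orbits leaving the left state *)

Definition tends_left (y : R -> R) (p : R) : Prop :=
  forall e, 0 < e -> exists T, forall t, t <= T -> Rabs (y t - p) < e.

Definition tends_right (y : R -> R) (p : R) : Prop :=
  forall e, 0 < e -> exists T, forall t, T <= t -> Rabs (y t - p) < e.

(** The concentration profile, which is the same for all kappa and v. Time 0 is normalised to the
    saddle concentration, so the sign of t tells on which side of [cb] the concentration lies. *)
Record clock (C : R -> R) (cb : R) : Prop := {
  clock_unit : forall t, 0 < C t < 1;
  clock_0 : C 0 = cb;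
  clock_decreasing : forall t t', t < t' -> C t' < C t;
  clock_lipschitz : exists K, 0 < K /\ forall t t', Rabs (C t' - C t) <= K * Rabs (t' - t);
  clock_left : tends_left C 1;
  clock_right : tends_right C 0 }.

(* The last two conditions make constants usable as barriers although [G] need not be Lipschitz. *)
Record field (G : R -> R -> R) (M L : R) : Prop := {
  field_uc : uc2 G;
  field_bounded : forall s c, Rabs (G s c) <= L;
  field_upper : forall b s c, 0 <= c <= 1 -> G b c <= 0 -> G s c <= M * Rabs (s - b);
  field_lower : forall b s c, 0 <= c <= 1 -> 0 <= G b c -> - (M * Rabs (s - b)) <= G s c }.

(** Since the concentration increases backward in time, a height that is positive for the field at
    some t <= 0 was positive at all earlier times. *)
Definition persistent (G : R -> R -> R) (cb : R) : Prop :=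
  forall s c c', cb <= c -> c <= c' -> c' <= 1 -> 0 < G s c -> 0 < G s c'.

Definition orbit (G : R -> R -> R) (C y : R -> R) : Prop := ode_sol (fun s t => G s (C t)) y.

Lemma clock_nonincreasing C cb : clock C cb -> forall t t', t <= t' -> C t' <= C t.
Proof.
  intros H t t' Ht. destruct (Req_dec t t') as [->|]; [lra|].
  left; apply (clock_decreasing _ _ H); lra.
Qed.

Lemma clock_continuous C cb : clock C cb -> forall t, continuous C t.
Proof.
  intros H. destruct (clock_lipschitz _ _ H) as [K [HK P]]. exact (lipschitz_continuous C K HK P).
Qed.

Lemma uc2_clock G C cb : uc2 G -> clock C cb -> uc2 (fun s t => G s (C t)).
Proof.
  intros U H e He. destruct (U e He) as [d [Hd Q]].
  destruct (clock_lipschitz _ _ H) as [K [HK P]].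
  exists (Rmin d (d / K)). split; [apply Rmin_pos; [lra|apply Rdiv_lt_0_compat; lra]|].
  intros s s' t t' H1 H2. apply Q.
  - eapply Rlt_le_trans; [exact H1|apply Rmin_l].
  - eapply Rle_lt_trans; [apply P|].
    assert (H3 := Rlt_le_trans _ _ _ H2 (Rmin_r _ _)).
    replace d with (K * (d / K)) by (field; lra). apply Rmult_lt_compat_l; lra.
Qed.

Lemma decreasing_tends_left y b t0 : (forall t t', t <= t' -> t' <= t0 -> y t' <= y t) ->
  (forall t, t <= t0 -> y t <= b) -> exists l, tends_left y l /\ l <= b /\ y t0 <= l.
Proof.
  intros D B. destruct (completeness (fun x => exists t, t <= t0 /\ x = y t)) as [l [Hu Hl]].
  { exists b. intros x [t [Ht ->]]. auto. }
  { exists (y t0), t0. split; [lra|auto]. }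
  exists l. split; [|split].
  - intros e He. destruct (classic (exists t, t <= t0 /\ l - e < y t)) as [[T [HT Q]]|N].
    + exists T. intros t Ht. assert (y T <= y t) by (apply D; lra).
      assert (y t <= l) by (apply Hu; exists t; split; [lra|auto]).
      apply Rabs_def1; lra.
    + assert (l <= l - e); [|lra]. apply Hl. intros x [t [Ht ->]].
      destruct (Rle_lt_dec (y t) (l - e)); auto. elim N; eauto.
  - apply Hl. intros x [t [Ht ->]]. auto.
  - apply Hu. exists t0. split; [lra|auto].
Qed.

Lemma increasing_tends_left y b t0 : (forall t t', t <= t' -> t' <= t0 -> y t <= y t') ->
  (forall t, t <= t0 -> b <= y t) -> exists l, tends_left y l /\ b <= l /\ l <= y t0.
Proof.
  intros D B.
  destruct (decreasing_tends_left (fun t => - y t) (- b) t0) as [l [H1 [H2 H3]]].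
  { intros t t' H1 H2. specialize (D t t' H1 H2). lra. }
  { intros t Ht. specialize (B t Ht). lra. }
  exists (- l). split; [|split; lra].
  intros e He. destruct (H1 e He) as [T Q]. exists T. intros t Ht. specialize (Q t Ht).
  replace (y t - - l) with (- (- y t - l)) by ring. rewrite Rabs_Ropp. exact Q.
Qed.

(** * Monotonicity and limits of orbits on the left half-line *)

Section HalfLine.
Variables (G : R -> R -> R) (M L cb : R) (C : R -> R).
Hypotheses (HG : field G M L) (HC : clock C cb).

Lemma orbit_continuous y : orbit G C y -> forall t, continuous y t.
Proof. intros Y t. exact (is_derive_cont _ _ _ (Y t)). Qed.

Lemma speed_continuous y : orbit G C y -> forall t, continuous (fun r => G (y r) (C r)) t.
Proof.
  intros Y t. apply continuity_eps. intros e He.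
  destruct (field_uc _ _ _ HG e He) as [d [Hd K]].
  destruct (proj1 (continuity_eps _ _) (orbit_continuous y Y t) d Hd) as [d1 [Hd1 K1]].
  destruct (proj1 (continuity_eps _ _) (clock_continuous C cb HC t) d Hd) as [d2 [Hd2 K2]].
  exists (Rmin d1 d2). split; [apply Rmin_pos; lra|]. intros r Hr. apply K.
  - apply K1. eapply Rlt_le_trans; [exact Hr|apply Rmin_l].
  - apply K2. eapply Rlt_le_trans; [exact Hr|apply Rmin_r].
Qed.

Lemma orbit_lipschitz y : orbit G C y -> forall t t', Rabs (y t' - y t) <= L * Rabs (t' - t).
Proof.
  intros Y.
  assert (P : forall t t', t < t' -> Rabs (y t' - y t) <= L * Rabs (t' - t)).
  { intros t t' Ht. destruct (MVT_R y (fun r => G (y r) (C r)) t t') as [z [_ ->]]; auto.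
    rewrite Rabs_mult. apply Rmult_le_compat_r; [apply Rabs_pos|apply (field_bounded _ _ _ HG)]. }
  intros t t'. destruct (Rtotal_order t t') as [H|[->|H]]; auto.
  - rewrite !Rminus_diag, Rabs_R0. lra.
  - rewrite Rabs_minus_sym, (Rabs_minus_sym t'). auto.
Qed.

(** Orbits through a point may branch, but [field_upper] bounds the growth of y - b by a multiple of
    its own size, and this is all that Gronwall's argument asks for. *)
Lemma upper_barrier y b t0 t1 : orbit G C y -> (forall t, t0 <= t <= t1 -> G b (C t) <= 0) ->
  t0 <= t1 -> y t0 <= b -> y t1 <= b.
Proof.
  intros Y B Ht H0.
  assert (Q : y t1 - b <= 0); [|lra].
  apply (gronwall_sign (fun t => y t - b) (fun t => G (y t) (C t)) M t0 t1); auto; try lra.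
  - intros t _. replace (G (y t) (C t)) with (G (y t) (C t) - 0) by ring.
    apply (is_derive_minus y); [apply Y|apply (is_derive_const b t)].
  - intros t H. apply (field_upper _ _ _ HG); auto.
    destruct (clock_unit _ _ HC t); lra.
Qed.

Lemma lower_barrier y b t0 t1 : orbit G C y -> (forall t, t0 <= t <= t1 -> 0 <= G b (C t)) ->
  t0 <= t1 -> b <= y t0 -> b <= y t1.
Proof.
  intros Y B Ht H0.
  assert (Q : b - y t1 <= 0); [|lra].
  apply (gronwall_sign (fun t => b - y t) (fun t => - G (y t) (C t)) M t0 t1); auto; try lra.
  - intros t _. replace (- G (y t) (C t)) with (0 - G (y t) (C t)) by ring.
    apply (is_derive_minus (fun _ => b) y); [apply (is_derive_const b t)|apply Y].
  - intros t H. assert (P := field_lower _ _ _ HG b (y t) (C t)).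
    rewrite Rabs_minus_sym. specialize (B t H). destruct (clock_unit _ _ HC t). lra.
Qed.

(** Otherwise, over a unit of time far to the left, the orbit would move by more than half of |G l
    1|, although both ends of the interval lie within a quarter of it from l. *)
Lemma root_at_left y l : orbit G C y -> tends_left y l -> G l 1 = 0.
Proof.
  intros Y Hl. destruct (Req_dec (G l 1) 0) as [|Hne]; auto. exfalso.
  set (a := Rabs (G l 1)). assert (Ha : 0 < a) by (apply Rabs_pos_lt; auto).
  destruct (field_uc _ _ _ HG (a / 2) ltac:(lra)) as [d [Hd K]].
  destruct (Hl (Rmin d (a / 4))) as [T1 K1]. { apply Rmin_pos; lra. }
  destruct (clock_left _ _ HC d Hd) as [T2 K2].
  set (T := Rmin T1 T2). assert (T <= T1) by apply Rmin_l. assert (T <= T2) by apply Rmin_r.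
  destruct (MVT_R y (fun r => G (y r) (C r)) (T - 1) T) as [z [Hz E]]; try lra.
  { intros r _; apply Y. }
  assert (Q1 := K1 z ltac:(lra)). assert (Q2 := K2 z ltac:(lra)).
  assert (Q3 := K _ _ _ _ (Rlt_le_trans _ _ _ Q1 (Rmin_l _ _)) Q2).
  assert (Q4 := Rlt_le_trans _ _ _ (K1 T ltac:(lra)) (Rmin_r _ _)).
  assert (Q5 := Rlt_le_trans _ _ _ (K1 (T - 1) ltac:(lra)) (Rmin_r _ _)).
  apply Rabs_def2 in Q3. apply Rabs_def2 in Q4. apply Rabs_def2 in Q5.
  unfold a, Rabs in *. destruct (Rcase_abs (G l 1)); lra.
Qed.

Hypothesis HP : persistent G cb.

Lemma clock_past t : t <= 0 -> cb <= C t.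
Proof. intros H. rewrite <- (clock_0 _ _ HC). apply (clock_nonincreasing _ _ HC); auto. Qed.

(** Let t2 be the last earlier zero of the velocity, after which y rises. By persistence the field
    at the fixed height y t2 is nonpositive from t2 on, for otherwise it would be positive at t2 as
    well; so y t2 is an upper barrier and y cannot rise. *)
Lemma past_positive y t0 : orbit G C y -> t0 <= 0 -> 0 < G (y t0) (C t0) ->
  forall t, t <= t0 -> 0 < G (y t) (C t).
Proof.
  intros Y H0 P t Ht. destruct (Rlt_le_dec 0 (G (y t) (C t))) as [|N]; auto. exfalso.
  destruct (Req_dec t t0) as [->|]; [lra|].
  destruct (last_zero (fun r => G (y r) (C r)) t t0) as [t2 [H2 [Z Q]]]; auto; try lra.
  { intros r _; apply speed_continuous, Y. }
  assert (I : y t2 < y t0).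
  { apply derive_increasing with (fun r => G (y r) (C r)); try lra.
    - intros; apply Y.
    - intros; apply Q; lra. }
  assert (y t0 <= y t2); [|lra].
  apply (upper_barrier y (y t2) t2 t0); auto; try lra.
  intros r Hr. destruct (Rle_lt_dec (G (y t2) (C r)) 0) as [|Hp]; auto.
  assert (0 < G (y t2) (C t2)); [|lra].
  apply HP with (C r); auto.
  - apply clock_past; lra.
  - apply (clock_nonincreasing _ _ HC); lra.
  - destruct (clock_unit _ _ HC t2); lra.
Qed.

Lemma past_increasing y t0 : orbit G C y -> t0 <= 0 -> 0 < G (y t0) (C t0) ->
  forall t t', t < t' -> t' <= t0 -> y t < y t'.
Proof.
  intros Y H0 P t t' H1 H2. apply derive_increasing with (fun r => G (y r) (C r)); auto.
  intros z Hz; apply (past_positive y t0 Y H0 P); lra.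
Qed.

(** An orbit rising at t has been rising since minus infinity, hence lies above p at t; persistence
    carries the positive sign at this height to c = 1, where it is excluded. *)
Lemma left_nonpositive y p : orbit G C y -> tends_left y p -> (forall s, p < s -> G s 1 <= 0) ->
  forall t, t <= 0 -> G (y t) (C t) <= 0.
Proof.
  intros Y Hp N t Ht. destruct (Rle_lt_dec (G (y t) (C t)) 0) as [|P]; auto. exfalso.
  assert (I := past_increasing y t Y Ht P).
  assert (Hyt : p < y t).
  { assert (I1 := I (t - 1) t ltac:(lra) ltac:(lra)).
    destruct (Rlt_le_dec p (y t)) as [|Hc]; auto.
    destruct (Hp (p - y (t - 1)) ltac:(lra)) as [T K].
    set (r := Rmin T (t - 2)). assert (r <= T) by apply Rmin_l. assert (r <= t - 2) by apply Rmin_r.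
    specialize (K r ltac:(lra)). assert (I2 := I r (t - 1) ltac:(lra) ltac:(lra)).
    apply Rabs_def2 in K. lra. }
  assert (0 < G (y t) 1); [|specialize (N _ Hyt); lra].
  destruct (clock_unit _ _ HC t).
  apply HP with (C t); auto; try lra. apply clock_past, Ht.
Qed.

Lemma nonpositive_decreasing y t0 : orbit G C y ->
  (forall t, t <= t0 -> G (y t) (C t) <= 0) -> forall t t', t <= t' -> t' <= t0 -> y t' <= y t.
Proof.
  intros Y N t t' H1 H2. apply derive_nonincreasing with (fun r => G (y r) (C r)); auto.
  intros; apply N; lra.
Qed.

Lemma left_decreasing y p : orbit G C y -> tends_left y p -> (forall s, p < s -> G s 1 <= 0) ->
  forall t t', t <= t' -> t' <= 0 -> y t' <= y t.
Proof.
  intros Y Hp N. apply nonpositive_decreasing; auto. apply left_nonpositive with p; auto.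
Qed.

Lemma left_below y p : orbit G C y -> tends_left y p -> (forall s, p < s -> G s 1 <= 0) ->
  forall t, t <= 0 -> y t <= p.
Proof.
  intros Y Hp N t Ht. destruct (Rle_lt_dec (y t) p) as [|Hc]; auto.
  destruct (Hp (y t - p) ltac:(lra)) as [T K].
  specialize (K (Rmin T t) (Rmin_l _ _)).
  assert (y t <= y (Rmin T t)) by (apply left_decreasing with p; auto; apply Rmin_r).
  apply Rabs_def2 in K. lra.
Qed.

(** By [past_positive] the orbit is monotone near minus infinity: either it rises at some early
    time, and then before it, or it never rises. Being bounded it has a limit, which is a root of
    the field at c = 1 between m and p, hence p. In the rising case the limit would be below p,
    which is impossible. *)
Lemma left_limit y p m T : orbit G C y -> (forall t, t <= 0 -> y t <= p) ->
  (forall t, t <= T -> m <= y t) -> (forall l, m <= l < p -> G l 1 <> 0) -> tends_left y p.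
Proof.
  intros Y Hp Hm Hr.
  set (T0 := Rmin T 0). assert (T0 <= T) by apply Rmin_l. assert (T0 <= 0) by apply Rmin_r.
  destruct (classic (exists t, t <= T0 /\ 0 < G (y t) (C t))) as [[t [Ht P]]|N].
  - assert (I := past_increasing y t Y ltac:(lra) P).
    destruct (increasing_tends_left y m (t - 1)) as [l [Hl [H1 H2]]].
    + intros r r' H1 H2. destruct (Req_dec r r') as [->|]; [lra|]. left; apply I; lra.
    + intros r Hr'; apply Hm; lra.
    + assert (y (t - 1) < y t) by (apply I; lra). assert (y t <= p) by (apply Hp; lra).
      elim (Hr l); [lra|]. apply root_at_left with y; auto.
  - assert (N' : forall t, t <= T0 -> G (y t) (C t) <= 0).
    { intros t Ht. apply Rnot_lt_le. intros P. apply N; eauto. }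
    destruct (decreasing_tends_left y p T0) as [l [Hl [H1 H2]]].
    + apply nonpositive_decreasing; auto.
    + intros t Ht; apply Hp; lra.
    + assert (m <= y T0) by (apply Hm; lra).
      destruct (Req_dec l p) as [<-|Hne]; auto.
      elim (Hr l); [lra|]. apply root_at_left with y; auto.
Qed.

(** The approximations start at the root p itself. By persistence the field is nonpositive above p
    throughout t <= 0, and by continuity it is positive near height m at early times. *)
Lemma left_exists p m : m < p -> (forall s, m <= s < p -> 0 < G s 1) ->
  (forall s, p <= s -> G s 1 <= 0) -> exists y, orbit G C y /\ tends_left y p.
Proof.
  intros Hm Pm Np.
  destruct (field_uc _ _ _ HG (G m 1) (Pm m ltac:(lra))) as [d [Hd K]].
  destruct (clock_left _ _ HC d Hd) as [T HT].
  destruct (exists_solution_from_minus_infinity (fun s t => G s (C t)) L p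
    (uc2_clock G C cb (field_uc _ _ _ HG) HC) (fun s t => field_bounded _ _ _ HG s (C t))
    p m 0 T (d / 2)) as [y [Y [H1 H2]]]; try lra.
  - intros s t Ht Hs. apply Rnot_lt_le. intros P.
    assert (0 < G s 1); [|specialize (Np s Hs); lra].
    destruct (clock_unit _ _ HC t). apply HP with (C t); auto; try lra. apply clock_past, Ht.
  - intros s t Ht Hs. assert (Q := K m s 1 (C t) ltac:(apply Rabs_def1; lra) (HT t Ht)).
    apply Rabs_def2 in Q. lra.
  - exists y. split; [exact Y|]. apply left_limit with m T; auto.
    intros l Hl E. specialize (Pm l Hl). lra.
Qed.

End HalfLine.

(** * Limits of departing orbits when the fields converge *)

Section Closure.
Variables (G : R -> R -> R) (M L cb : R) (C : R -> R).
Hypotheses (HG : field G M L) (HC : clock C cb) (HP : persistent G cb).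
Variables (Gn : nat -> R -> R -> R) (yn : nat -> R -> R) (pn : nat -> R) (p m : R).
Hypotheses
  (HGn : forall n, field (Gn n) M L) (HPn : forall n, persistent (Gn n) cb)
  (Hconv : forall e, 0 < e -> exists N, forall n, (N <= n)%nat ->
     forall s c, Rabs (Gn n s c - G s c) <= e)
  (Hpn : forall e, 0 < e -> exists N, forall n, (N <= n)%nat -> Rabs (pn n - p) < e)
  (Yn : forall n, orbit (Gn n) C (yn n)) (Tn : forall n, tends_left (yn n) (pn n))
  (Nn : forall n s, pn n < s -> Gn n s 1 <= 0)
  (Hm : (m < p /\ 0 < G m 1) \/ (forall n, m <= yn n 0)).

(** The two alternatives of [Hm] correspond to a simple and a double root. Below a simple root some
    height m is a barrier for all nearby fields; at a double root a bound at time 0 is assumed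
    instead, and it holds at earlier times because departing orbits decrease. *)
Lemma uniform_lower_bound : exists T N, T <= 0 /\
  forall n, (N <= n)%nat -> forall t, t <= T -> m <= yn n t.
Proof.
  destruct Hm as [[Hmp Pm]|H0].
  - destruct (field_uc _ _ _ HG (G m 1 / 2) ltac:(lra)) as [d [Hd K]].
    destruct (clock_left _ _ HC d Hd) as [T HT].
    destruct (Hconv (G m 1 / 2) ltac:(lra)) as [N1 K1].
    destruct (Hpn (p - m) ltac:(lra)) as [N2 K2].
    exists (Rmin T 0), (N1 + N2)%nat. split; [apply Rmin_r|]. intros n Hn t Ht.
    assert (HtT : t <= T) by (eapply Rle_trans; [exact Ht|apply Rmin_l]).
    specialize (K2 n ltac:(lia)). apply Rabs_def2 in K2.
    destruct (Tn n (pn n - m) ltac:(lra)) as [T' HT'].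
    specialize (HT' (Rmin T' t) (Rmin_l _ _)). apply Rabs_def2 in HT'.
    apply (lower_barrier (Gn n) M L cb C (HGn n) HC (yn n) m (Rmin T' t) t); auto; try lra.
    + intros r Hr. assert (Q := K1 n ltac:(lia) m (C r)). apply Rabs_le_between in Q.
      assert (Q2 := K m m 1 (C r) ltac:(rewrite Rminus_diag, Rabs_R0; lra) (HT r ltac:(lra))).
      apply Rabs_def2 in Q2. lra.
    + apply Rmin_r.
  - exists 0, 0%nat. split; [lra|]. intros n _ t Ht. eapply Rle_trans; [apply (H0 n)|].
    apply (left_decreasing (Gn n) M L cb C (HGn n) HC (HPn n) (yn n) (pn n)); auto; lra.
Qed.

Lemma closure_bounded t : eventually_bounded (fun n => yn n t).
Proof.
  destruct uniform_lower_bound as [T [N [HT K]]].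
  destruct (Hpn 1 ltac:(lra)) as [N1 K1].
  exists (Rabs m + Rabs p + 1 + L * Rabs (t - T)), (N + N1)%nat. intros n Hn.
  assert (Q1 := K n ltac:(lia) T ltac:(lra)).
  assert (Q2 := left_below (Gn n) M L cb C (HGn n) HC (HPn n) (yn n) (pn n) (Yn n) (Tn n)
    (Nn n) T HT).
  specialize (K1 n ltac:(lia)). apply Rabs_def2 in K1.
  assert (Q3 := orbit_lipschitz (Gn n) M L C (HGn n) (yn n) (Yn n) T t).
  assert (M1 := Rle_abs p). assert (M2 := Rle_abs (- m)). rewrite Rabs_Ropp in M2.
  assert (M3 := Rabs_pos p). assert (M4 := Rabs_pos m).
  apply Rabs_le_between in Q3. apply Rabs_le. lra.
Qed.

Lemma closure_approximates : approximates (fun s t => G s (C t)) yn.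
Proof.
  assert (HL : 0 <= L).
  { eapply Rle_trans; [apply Rabs_pos|apply (field_bounded _ _ _ HG 0 0)]. }
  apply solutions_approximate with (fun n s t => Gn n s (C t)) L; auto.
  - apply uc2_clock with cb; auto. apply (field_uc _ _ _ HG).
  - intros n s t. apply (field_bounded _ _ _ (HGn n)).
  - intros e He. destruct (Hconv e He) as [N K]. exists N. intros n Hn s t. apply K, Hn.
Qed.

Lemma closure_limit y : (forall l, m <= l < p -> G l 1 <> 0) ->
  orbit G C y -> (forall t, cluster (fun n => yn n t) (y t)) -> tends_left y p.
Proof.
  intros Hr Y K. destruct uniform_lower_bound as [T [N [HT B]]].
  apply (left_limit G M L cb C HG HC HP) with m T; auto.
  - intros t Ht. apply Rle_of_eta with 1; [lra|]. intros eta He _.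
    destruct (Hpn eta He) as [N1 K1].
    apply cluster_le with (fun n => yn n t) N1; auto. intros n Hn.
    assert (Q2 := left_below (Gn n) M L cb C (HGn n) HC (HPn n) (yn n) (pn n) (Yn n) (Tn n)
      (Nn n) t Ht).
    specialize (K1 n Hn). apply Rabs_def2 in K1. lra.
  - intros t Ht. apply cluster_ge with (fun n => yn n t) N; auto.
Qed.

Lemma left_limsup : (forall l, m <= l < p -> G l 1 <> 0) ->
  exists y : R -> R, orbit G C y /\ tends_left y p /\ forall t, is_LimSup_seq (fun n => yn n t) (y t).
Proof.
  intros Hr.
  destruct (exists_limsup_solution (fun s t => G s (C t)) L yn) as [y [Y Ly]].
  - apply uc2_clock with cb; auto. apply (field_uc _ _ _ HG).
  - intros s t; apply (field_bounded _ _ _ HG).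
  - apply closure_approximates.
  - apply closure_bounded.
  - exists y. split; [exact Y|]. split; [|exact Ly].
    apply closure_limit; auto. intros t; apply limsup_cluster, Ly.
Qed.

Lemma left_liminf : (forall l, m <= l < p -> G l 1 <> 0) ->
  exists y : R -> R, orbit G C y /\ tends_left y p /\ forall t, is_LimInf_seq (fun n => yn n t) (y t).
Proof.
  intros Hr.
  destruct (exists_liminf_solution (fun s t => G s (C t)) L yn) as [y [Y Ly]].
  - apply uc2_clock with cb; auto. apply (field_uc _ _ _ HG).
  - intros s t; apply (field_bounded _ _ _ HG).
  - apply closure_approximates.
  - apply closure_bounded.
  - exists y. split; [exact Y|]. split; [|exact Ly].
    apply closure_limit; auto. intros t; apply liminf_cluster, Ly.
Qed.
End Closure.

(* Exchanging the two ends of the line. *)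
Definition refl_field (G : R -> R -> R) (s c : R) : R := G (1 - s) (1 - c).
Definition refl (y : R -> R) (t : R) : R := 1 - y (- t).

Lemma refl_involutive y : refl (refl y) = y.
Proof. apply functional_extensionality. intros t. unfold refl. rewrite Ropp_involutive. ring. Qed.

Lemma refl_0 y : refl y 0 = 1 - y 0.
Proof. unfold refl. rewrite Ropp_0. reflexivity. Qed.

Lemma refl_field_field G M L : field G M L -> field (refl_field G) M L.
Proof.
  intros [U B P N]. unfold refl_field. split.
  - intros e He. destruct (U e He) as [d [Hd K]]. exists d; split; auto.
    intros s s' c c' H1 H2. apply K.
    + replace (1 - s' - (1 - s)) with (- (s' - s)) by ring. rewrite Rabs_Ropp; auto.
    + replace (1 - c' - (1 - c)) with (- (c' - c)) by ring. rewrite Rabs_Ropp; auto.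
  - auto.
  - intros b s c Hc H. replace (s - b) with (- ((1 - s) - (1 - b))) by ring. rewrite Rabs_Ropp.
    apply P; auto; lra.
  - intros b s c Hc H. replace (s - b) with (- ((1 - s) - (1 - b))) by ring. rewrite Rabs_Ropp.
    apply N; auto; lra.
Qed.

Lemma refl_tends_left y p : tends_right y p -> tends_left (refl y) (1 - p).
Proof.
  intros H e He. destruct (H e He) as [T K]. exists (- T). intros t Ht. unfold refl.
  replace (1 - y (- t) - (1 - p)) with (- (y (- t) - p)) by ring. rewrite Rabs_Ropp. apply K; lra.
Qed.

Lemma refl_tends_right y p : tends_left y p -> tends_right (refl y) (1 - p).
Proof.
  intros H e He. destruct (H e He) as [T K]. exists (- T). intros t Ht. unfold refl.
  replace (1 - y (- t) - (1 - p)) with (- (y (- t) - p)) by ring. rewrite Rabs_Ropp. apply K; lra.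
Qed.

Lemma refl_clock C cb : clock C cb -> clock (refl C) (1 - cb).
Proof.
  intros H. split.
  - intros t. unfold refl. destruct (clock_unit _ _ H (- t)). lra.
  - unfold refl. rewrite Ropp_0, (clock_0 _ _ H). reflexivity.
  - intros t t' Ht. unfold refl. assert (C (- t) < C (- t')) by (apply (clock_decreasing _ _ H); lra).
    lra.
  - destruct (clock_lipschitz _ _ H) as [K [HK P]]. exists K. split; auto. intros t t'. unfold refl.
    replace (1 - C (- t') - (1 - C (- t))) with (- (C (- t') - C (- t))) by ring.
    rewrite Rabs_Ropp. eapply Rle_trans; [apply P|]. apply Rmult_le_compat_l; [lra|].
    replace (- t' - - t) with (- (t' - t)) by ring. rewrite Rabs_Ropp; lra.
  - replace 1 with (1 - 0) at 1 by ring. apply refl_tends_left, (clock_right _ _ H).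
  - replace 0 with (1 - 1) by ring. apply refl_tends_right, (clock_left _ _ H).
Qed.

(** Reversing both time and height leaves the velocity unchanged, which is why [refl_field] carries
    no sign. *)
Lemma refl_derive (y : R -> R) t l : is_derive y (- t) l -> is_derive (refl y) t l.
Proof.
  intros H. apply is_derive_eps. intros e He.
  destruct (proj1 (is_derive_eps _ _ _) H e He) as [d [Hd K]]. exists d. split; auto.
  intros r Hr. replace (r - t) with (- (- r - - t)) in * by ring. rewrite Rabs_Ropp in *.
  unfold refl.
  replace (1 - y (- r) - (1 - y (- t)) - l * - (- r - - t))
    with (- (y (- r) - y (- t) - l * (- r - - t))) by ring.
  rewrite Rabs_Ropp. auto.
Qed.

Lemma refl_orbit G C y : orbit G C y -> orbit (refl_field G) (refl C) (refl y).
Proof.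
  intros H t. apply refl_derive. unfold refl_field, refl.
  replace (1 - (1 - y (- t))) with (y (- t)) by ring.
  replace (1 - (1 - C (- t))) with (C (- t)) by ring. apply H.
Qed.

Lemma refl_orbit_inv G C y : orbit (refl_field G) (refl C) y -> orbit G C (refl y).
Proof.
  intros H t. apply refl_derive. specialize (H (- t)). cbv beta in H.
  unfold refl_field in H. replace (1 - refl C (- t)) with (C t) in H.
  { exact H. }
  unfold refl. rewrite Ropp_involutive. ring.
Qed.

(** * Gluing orbits *)

(** Where the two solutions meet, the scalar equation gives them the same derivative, so the minimum
    has no corner there. *)
Lemma ode_min g y z : ode_sol g y -> ode_sol g z -> ode_sol g (fun t => Rmin (y t) (z t)).
Proof.
  assert (Lt : forall y z t, ode_sol g y -> ode_sol g z -> y t < z t ->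
    is_derive (fun t => Rmin (y t) (z t)) t (g (Rmin (y t) (z t)) t)).
  { intros y' z' t Y Z L. rewrite Rmin_left by lra.
    apply (is_derive_ext_loc y'); [|apply Y].
    assert (K : continuous (fun r => z' r - y' r) t).
    { apply (continuous_minus z' y'); [exact (is_derive_cont _ _ _ (Z t))|
        exact (is_derive_cont _ _ _ (Y t))]. }
    destruct (proj1 (continuity_eps _ _) K (z' t - y' t) ltac:(lra)) as [d [Hd Q]].
    apply locally_eps. exists d. split; auto. intros r Hr. specialize (Q r Hr).
    apply Rabs_def2 in Q. rewrite Rmin_left by lra. reflexivity. }
  intros Y Z t. destruct (Rtotal_order (y t) (z t)) as [L|[E|L]].
  - apply Lt; auto.
  - apply is_derive_eps. intros e He. rewrite (Rmin_left (y t)) by lra.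
    destruct (proj1 (is_derive_eps _ _ _) (Y t) e He) as [d1 [Hd1 K1]].
    destruct (proj1 (is_derive_eps _ _ _) (Z t) e He) as [d2 [Hd2 K2]].
    exists (Rmin d1 d2). split; [apply Rmin_pos; lra|]. intros r Hr.
    specialize (K1 r (Rlt_le_trans _ _ _ Hr (Rmin_l _ _))).
    specialize (K2 r (Rlt_le_trans _ _ _ Hr (Rmin_r _ _))).
    rewrite <- E in K2. unfold Rmin; destruct Rle_dec; assumption.
  - apply (is_derive_ext (fun t => Rmin (z t) (y t))); [intros; apply Rmin_comm|].
    rewrite Rmin_comm. apply Lt; auto.
Qed.

Lemma Rmax_opp_min x y : Rmax x y = - Rmin (- x) (- y).
Proof. unfold Rmax, Rmin. repeat destruct Rle_dec; lra. Qed.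

Lemma ode_max g y z : ode_sol g y -> ode_sol g z -> ode_sol g (fun t => Rmax (y t) (z t)).
Proof.
  intros Y Z t.
  assert (Q : forall u, ode_sol g u -> ode_sol (fun s t => - g (- s) t) (fun t => - u t)).
  { intros u U r. cbv beta. rewrite Ropp_involutive. apply (is_derive_opp u), U. }
  assert (M := ode_min _ _ _ (Q y Y) (Q z Z) t). cbv beta in M.
  apply (is_derive_ext (fun t => - Rmin (- y t) (- z t))); [intros; symmetry; apply Rmax_opp_min|].
  rewrite Rmax_opp_min.
  rewrite <- (Ropp_involutive (g (- Rmin (- y t) (- z t)) t)).
  apply (is_derive_opp (fun t => Rmin (- y t) (- z t))), M.
Qed.

Definition glue (y z : R -> R) (t : R) : R := if Rle_dec t 0 then y t else z t.

Lemma ode_glue g y z : ode_sol g y -> ode_sol g z -> y 0 = z 0 -> ode_sol g (glue y z).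
Proof.
  intros Y Z E t. destruct (Rtotal_order t 0) as [L|[->|L]].
  - replace (glue y z t) with (y t) by (unfold glue; destruct Rle_dec; [auto|lra]).
    apply (is_derive_ext_loc y); [|apply Y]. apply locally_eps. exists (- t). split; [lra|].
    intros r Hr. apply Rabs_def2 in Hr. unfold glue; destruct Rle_dec; [auto|lra].
  - apply is_derive_eps. intros e He.
    replace (glue y z 0) with (y 0) by (unfold glue; destruct Rle_dec; [auto|lra]).
    destruct (proj1 (is_derive_eps _ _ _) (Y 0) e He) as [d1 [Hd1 K1]].
    destruct (proj1 (is_derive_eps _ _ _) (Z 0) e He) as [d2 [Hd2 K2]].
    exists (Rmin d1 d2). split; [apply Rmin_pos; lra|]. intros r Hr.
    specialize (K1 r (Rlt_le_trans _ _ _ Hr (Rmin_l _ _))).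
    specialize (K2 r (Rlt_le_trans _ _ _ Hr (Rmin_r _ _))).
    rewrite <- E in K2. unfold glue; destruct Rle_dec; assumption.
  - replace (glue y z t) with (z t) by (unfold glue; destruct Rle_dec; [lra|auto]).
    apply (is_derive_ext_loc z); [|apply Z]. apply locally_eps. exists t. split; [lra|].
    intros r Hr. apply Rabs_def2 in Hr. unfold glue; destruct Rle_dec; [lra|auto].
Qed.

Lemma tends_left_ext y z T p : (forall t, t <= T -> y t = z t) -> tends_left y p -> tends_left z p.
Proof.
  intros E H e He. destruct (H e He) as [T' K]. exists (Rmin T T'). intros t Ht.
  rewrite <- E; [apply K|]; eapply Rle_trans; try exact Ht; [apply Rmin_r|apply Rmin_l].
Qed.

Lemma tends_right_ext y z T p : (forall t, T <= t -> y t = z t) -> tends_right y p -> tends_right z p.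
Proof.
  intros E H e He. destruct (H e He) as [T' K]. exists (Rmax T T'). intros t Ht.
  rewrite <- E; [apply K|]; eapply Rle_trans; try exact Ht; [apply Rmax_r|apply Rmax_l].
Qed.

Lemma tends_left_between (y lo hi : R -> R) p : tends_left lo p -> tends_left hi p ->
  (forall t, Rmin (lo t) (hi t) <= y t <= Rmax (lo t) (hi t)) -> tends_left y p.
Proof.
  intros H1 H2 B e He. destruct (H1 e He) as [T1 K1]. destruct (H2 e He) as [T2 K2].
  exists (Rmin T1 T2). intros t Ht.
  assert (Q1 := K1 t (Rle_trans _ _ _ Ht (Rmin_l _ _))).
  assert (Q2 := K2 t (Rle_trans _ _ _ Ht (Rmin_r _ _))).
  specialize (B t). apply Rabs_def2 in Q1. apply Rabs_def2 in Q2.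
  unfold Rmin, Rmax in B. apply Rabs_def1; destruct Rle_dec; lra.
Qed.

Lemma tends_right_between (y lo hi : R -> R) p : tends_right lo p -> tends_right hi p ->
  (forall t, Rmin (lo t) (hi t) <= y t <= Rmax (lo t) (hi t)) -> tends_right y p.
Proof.
  intros H1 H2 B e He. destruct (H1 e He) as [T1 K1]. destruct (H2 e He) as [T2 K2].
  exists (Rmax T1 T2). intros t Ht.
  assert (Q1 := K1 t (Rle_trans _ _ _ (Rmax_l _ _) Ht)).
  assert (Q2 := K2 t (Rle_trans _ _ _ (Rmax_r _ _) Ht)).
  specialize (B t). apply Rabs_def2 in Q1. apply Rabs_def2 in Q2.
  unfold Rmin, Rmax in B. apply Rabs_def1; destruct Rle_dec; lra.
Qed.

(* Where uniqueness fails the orbits leaving the left state need not hit those entering the right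
   state at time 0; lattice operations produce a connecting orbit nevertheless. *)
Lemma connect_pairs g p r S Z S' Z' : ode_sol g S -> ode_sol g Z -> ode_sol g S' -> ode_sol g Z' ->
  tends_left S p -> tends_left S' p -> tends_right Z r -> tends_right Z' r ->
  Z 0 <= S 0 -> S' 0 <= Z' 0 ->
  exists y, ode_sol g y /\ tends_left y p /\ tends_right y r.
Proof.
  intros HS HZ HS' HZ' LS LS' RZ RZ' H1 H2.
  destruct (Rle_lt_dec (Z 0) (S' 0)) as [L|L].
  (* Since Z 0 <= S' 0 <= Z' 0, this solution starts from S' 0; it stays between Z and Z' and so
     inherits their limit. The other case is dual, with z squeezed between S' and S. *)
  - set (z := fun t => Rmin (Z' t) (Rmax (Z t) (S' t))).
    exists (glue S' z). split; [|split].
    + apply ode_glue; auto.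
      * apply (ode_min g Z' (fun t => Rmax (Z t) (S' t))); auto. apply ode_max; auto.
      * unfold z, Rmin, Rmax; repeat destruct Rle_dec; lra.
    + apply tends_left_ext with S' 0; auto.
      intros t Ht. unfold glue; destruct Rle_dec; [auto|lra].
    + apply tends_right_ext with z 1.
      { intros t Ht. unfold glue; destruct Rle_dec; [lra|auto]. }
      apply tends_right_between with Z Z'; auto.
      intros t. unfold z, Rmin, Rmax; repeat destruct Rle_dec; lra.
  - set (z := fun t => Rmax (S' t) (Rmin (S t) (Z t))).
    exists (glue z Z). split; [|split].
    + apply ode_glue; auto.
      * apply (ode_max g S' (fun t => Rmin (S t) (Z t))); auto. apply ode_min; auto.
      * unfold z, Rmin, Rmax; repeat destruct Rle_dec; lra.
    + apply tends_left_ext with z 0.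
      { intros t Ht. unfold glue; destruct Rle_dec; [auto|lra]. }
      apply tends_left_between with S' S; auto.
      intros t. unfold z, Rmin, Rmax; repeat destruct Rle_dec; lra.
    + apply tends_right_ext with Z 1; auto.
      intros t Ht. unfold glue; destruct Rle_dec; [lra|auto].
Qed.

Lemma lower_from_left G M L cb C y p b t1 : field G M L -> clock C cb -> orbit G C y ->
  tends_left y p -> b < p -> (forall t, t <= t1 -> 0 <= G b (C t)) -> b <= y t1.
Proof.
  intros HG HC Y Hp Hb P. destruct (Hp (p - b) ltac:(lra)) as [T K].
  specialize (K (Rmin T t1) (Rmin_l _ _)). apply Rabs_def2 in K.
  apply (lower_barrier G M L cb C HG HC y b (Rmin T t1) t1); auto; try lra.
  - intros t Ht. apply P; lra.
  - apply Rmin_r.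
Qed.

(* If the left state is the only root above 0 of [G . 1], every orbit that passes below an orbit
   leaving it comes from it as well. *)
Lemma saddle_node_connection G M L cb C S Z p : field G M L -> clock C cb -> persistent G cb ->
  orbit G C S -> orbit G C Z -> tends_left S p -> (forall s, p < s -> G s 1 <= 0) ->
  0 <= Z 0 <= S 0 -> (forall b c, b <= 0 -> G b c <= 0) -> (forall l, 0 <= l < p -> G l 1 <> 0) ->
  exists y, orbit G C y /\ tends_left y p /\ forall t, 0 <= t -> y t = Z t.
Proof.
  intros HG HC HP HS HZ Hp N H0 Low Root.
  (* The past of Z need not stay below p; the minimum with S enforces this without changing the
     value at time 0. *)
  set (y := glue (fun t => Rmin (S t) (Z t)) Z).
  assert (E0 : Rmin (S 0) (Z 0) = Z 0) by (apply Rmin_right; lra).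
  assert (Y : orbit G C y) by (apply ode_glue; auto; apply ode_min; auto).
  assert (Y0 : y 0 = Z 0) by (unfold y, glue; destruct Rle_dec; auto).
  exists y. split; [exact Y|]. split.
  - apply (left_limit G M L cb C HG HC HP) with 0 0; auto.
    + intros t Ht. unfold y, glue. destruct Rle_dec; [|lra].
      eapply Rle_trans; [apply Rmin_l|].
      apply (left_below G M L cb C HG HC HP S p); auto.
    + intros t Ht. apply Rnot_lt_le. intros Neg.
      assert (y 0 <= y t); [|lra].
      apply (upper_barrier G M L cb C HG HC y (y t) t 0); auto; try lra.
      intros r _. apply Low; lra.
  - intros t Ht. unfold y, glue. destruct Rle_dec; [|auto].
    replace t with 0 by lra. exact E0.
Qed.

(** * Families of fields with a branch of left states *)

Definition seq_to (u : nat -> R) (l : R) : Prop :=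
  forall e, 0 < e -> exists N, forall n, (N <= n)%nat -> Rabs (u n - l) < e.

(* What both ends of the line have in common: at c = 1 the field [g v] vanishes where q = v, and q
   increases on [0,e] and decreases on [e,1].  The mirrored right end is another instance. *)
Record branch (g : R -> R -> R -> R) (cb vm e : R) (q : R -> R) : Prop := {
  branch_field : forall V, 0 < V -> exists M L, forall v, 0 < v <= V -> field (g v) M L;
  branch_lipschitz : forall V, 0 < V -> exists K, 0 < K /\ forall v v' s c,
    0 < v <= V -> 0 < v' <= V -> Rabs (g v' s c - g v s c) <= K * Rabs (v' - v);
  branch_persistent : forall v, vm <= v -> persistent (g v) cb;
  branch_sign : forall v s, vm <= v -> 0 < g v s 1 <-> v < q (clamp s);
  branch_zero : forall v s, vm <= v -> g v s 1 = 0 -> q (clamp s) = v;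
  branch_peak : 0 < e < 1;
  branch_up : forall x y, 0 <= x -> x < y -> y <= e -> q x < q y;
  branch_down : forall x y, e <= x -> x < y -> y <= 1 -> q y < q x;
  branch_continuous : exists K, 0 < K /\ forall x y, 0 <= x <= 1 -> 0 <= y <= 1 ->
    Rabs (q y - q x) <= K * Rabs (y - x);
  branch_vm : 0 < vm;
  branch_1 : q 1 < vm;
  branch_e : vm < q e }.

Definition root (q : R -> R) (e v p : R) : Prop := e <= p <= 1 /\ q p = v.

Definition departs (g : R -> R -> R -> R) (q : R -> R) (e : R) (C : R -> R) (v : R) (y : R -> R) : Prop :=
  orbit (g v) C y /\ exists p, root q e v p /\ tends_left y p.

Section Branch.
Variables (g : R -> R -> R -> R) (cb vm e : R) (q : R -> R) (C : R -> R).
Hypotheses (HB : branch g cb vm e q) (HC : clock C cb).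

Lemma exists_root v : vm <= v <= q e -> exists p, root q e v p.
Proof.
  intros Hv. assert (He := branch_peak _ _ _ _ _ HB). assert (H1 := branch_1 _ _ _ _ _ HB).
  destruct (branch_continuous _ _ _ _ _ HB) as [K [HK LK]].
  destruct (IVT_cor (fun s => q (clamp s) - v) e 1) as [z [Hz E]]; try lra.
  - intros s. apply continuity_pt_filterlim.
    apply (lipschitz_continuous (fun s => q (clamp s) - v) K HK). intros x y.
    assert (Q := LK (clamp x) (clamp y) (clamp_unit x) (clamp_unit y)).
    assert (Q2 := clamp_lip x y).
    replace (q (clamp y) - v - (q (clamp x) - v)) with (q (clamp y) - q (clamp x)) by ring. nra.
  - rewrite !clamp_id by lra. nra.
  - exists z. split; auto. rewrite clamp_id in E by lra. lra.
Qed.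

Lemma root_inside v p : vm <= v -> root q e v p -> 0 < p < 1.
Proof.
  intros Hv [Hp E]. assert (He := branch_peak _ _ _ _ _ HB). assert (H1 := branch_1 _ _ _ _ _ HB).
  split; [lra|]. destruct (Req_dec p 1) as [->|]; lra.
Qed.

Lemma root_decreasing v v' p p' : v < v' -> root q e v p -> root q e v' p' -> p' < p.
Proof.
  intros Hv [Hp E] [Hp' E']. apply Rnot_le_lt. intros N. destruct (Req_dec p p') as [<-|]; [lra|].
  assert (Q := branch_down _ _ _ _ _ HB p p'). lra.
Qed.

Lemma root_unique v p p' : root q e v p -> root q e v p' -> p = p'.
Proof.
  intros [Hp E] [Hp' E']. assert (Q := branch_down _ _ _ _ _ HB p p').
  assert (Q' := branch_down _ _ _ _ _ HB p' p). destruct (Rtotal_order p p') as [L|[L|L]]; auto; lra.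
Qed.

Lemma root_le_peak v p : root q e v p -> v <= q e.
Proof.
  intros [Hp <-]. destruct (Req_dec e p) as [<-|]; [lra|].
  left; apply (branch_down _ _ _ _ _ HB); lra.
Qed.

Lemma root_continuous vn pn v p : seq_to vn v -> (forall n, root q e (vn n) (pn n)) ->
  root q e v p -> seq_to pn p.
Proof.
  intros Hv Tn [Hp E] eps He. assert (Dn := branch_down _ _ _ _ _ HB).
  assert (U : exists N, forall n, (N <= n)%nat -> pn n < p + eps).
  { destruct (Rle_lt_dec 1 (p + eps / 2)) as [L|L].
    { exists 0%nat. intros n _. destruct (Tn n). lra. }
    assert (Q := Dn p (p + eps / 2)).
    destruct (Hv (q p - q (p + eps / 2))) as [N K]; [lra|].
    exists N. intros n Hn. specialize (K n Hn). apply Rabs_def2 in K. destruct (Tn n).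
    apply Rnot_le_lt. intros Z. assert (Q2 := Dn (p + eps / 2) (pn n)). lra. }
  assert (L : exists N, forall n, (N <= n)%nat -> p - eps < pn n).
  { destruct (Rle_lt_dec (p - eps / 2) e) as [L|L].
    { exists 0%nat. intros n _. destruct (Tn n). lra. }
    assert (Q := Dn (p - eps / 2) p).
    destruct (Hv (q (p - eps / 2) - q p)) as [N K]; [lra|].
    exists N. intros n Hn. specialize (K n Hn). apply Rabs_def2 in K. destruct (Tn n).
    apply Rnot_le_lt. intros Z. assert (Q2 := Dn (pn n) (p - eps / 2)). lra. }
  destruct U as [N1 K1]. destruct L as [N2 K2]. exists (N1 + N2)%nat. intros n Hn.
  specialize (K1 n ltac:(lia)). specialize (K2 n ltac:(lia)). apply Rabs_def1; lra.
Qed.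

Lemma above_root v p s : vm <= v -> root q e v p -> p <= s -> g v s 1 <= 0.
Proof.
  intros Hv [Hp E] Hs. apply Rnot_lt_le. intros P. apply (branch_sign _ _ _ _ _ HB) in P; auto.
  assert (He := branch_peak _ _ _ _ _ HB).
  assert (Cs : p <= clamp s <= 1).
  { split; [|apply clamp_unit]. unfold clamp, Rmax, Rmin; repeat destruct Rle_dec; lra. }
  assert (Q := branch_down _ _ _ _ _ HB p (clamp s)).
  destruct (Req_dec p (clamp s)) as [E'|]; [rewrite <- E' in P|]; lra.
Qed.

Lemma near_root v p s : vm <= v -> root q e v p -> e <= s < p -> 0 < g v s 1.
Proof.
  intros Hv [Hp E] Hs. assert (He := branch_peak _ _ _ _ _ HB).
  apply (branch_sign _ _ _ _ _ HB); auto. rewrite clamp_id by lra. rewrite <- E.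
  apply (branch_down _ _ _ _ _ HB); lra.
Qed.

Lemma departs_facts v y p : vm <= v -> orbit (g v) C y -> root q e v p -> tends_left y p ->
  forall t, t <= 0 -> g v (y t) (C t) <= 0 /\ y t <= p.
Proof.
  intros Hv Y Hp Lp t Ht. assert (V0 := branch_vm _ _ _ _ _ HB).
  destruct (branch_field _ _ _ _ _ HB v) as [M [L HG]]; [lra|].
  assert (HG' := HG v ltac:(lra)). assert (HP := branch_persistent _ _ _ _ _ HB v Hv).
  assert (N : forall s, p < s -> g v s 1 <= 0) by (intros s Hs; apply above_root with p; auto; lra).
  split.
  - apply (left_nonpositive (g v) M L cb C HG' HC HP y p); auto.
  - apply (left_below (g v) M L cb C HG' HC HP y p); auto.
Qed.

Lemma exists_departing v : vm <= v < q e -> exists y, departs g q e C v y.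
Proof.
  intros Hv. assert (V0 := branch_vm _ _ _ _ _ HB).
  destruct (exists_root v) as [p Hp]; [lra|].
  destruct (branch_field _ _ _ _ _ HB v) as [M [L HG]]; [lra|].
  destruct (left_exists (g v) M L cb C (HG v ltac:(lra)) HC
    (branch_persistent _ _ _ _ _ HB v ltac:(lra)) p e) as [y [Y Lp]].
  - destruct Hp as [Hp E]. destruct (Req_dec e p) as [E'|]; [rewrite E' in Hv|]; lra.
  - intros s Hs. apply near_root with p; auto; lra.
  - intros s Hs. apply above_root with p; auto; lra.
  - exists y. split; eauto.
Qed.

(** Both extremal limits are recorded: an order between orbits leaving and orbits entering at time 0
    survives in the limit only if the appropriate one is taken on each side. *)
Lemma departing_closure vn v yn : vm <= v <= q e -> (forall n, vm <= vn n) -> seq_to vn v ->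
  (forall n, departs g q e C (vn n) (yn n)) -> (v < q e \/ forall n, 0 <= yn n 0) ->
  (exists y : R -> R, departs g q e C v y /\ is_LimSup_seq (fun n => yn n 0) (y 0)) /\
  (exists y : R -> R, departs g q e C v y /\ is_LimInf_seq (fun n => yn n 0) (y 0)).
Proof.
  intros Hv Hvn Sv HL Hm. assert (V0 := branch_vm _ _ _ _ _ HB).
  assert (He := branch_peak _ _ _ _ _ HB).
  destruct (exists_root v Hv) as [p Hp].
  destruct (branch_field _ _ _ _ _ HB (q e)) as [M [L HG]]; [lra|].
  destruct (functional_choice (fun n p => root q e (vn n) p /\ tends_left (yn n) p)) as [pn Hpn].
  { intros n. apply (proj2 (HL n)). }
  assert (HV : forall n, 0 < vn n <= q e).
  { intros n. specialize (Hvn n). assert (Q := root_le_peak _ _ (proj1 (Hpn n))). lra. }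
  (* Below the maximal velocity the peak e is a height at which the field is positive. At v = q e
     the root is double and equal to e; there is no other root down to 0, and the assumed bound at
     time 0 takes over. *)
  assert (Hroot : exists m, (forall l, m <= l < p -> g v l 1 <> 0) /\
    ((m < p /\ 0 < g v m 1) \/ (forall n, m <= yn n 0))).
  { destruct (Rlt_le_dec v (q e)) as [Lt|Ge].
    - exists e. assert (e < p).
      { destruct Hp as [Hp E]. destruct (Req_dec e p) as [E'|]; [rewrite E' in Lt|]; lra. }
      assert (Q : forall l, e <= l < p -> 0 < g v l 1) by (intros; apply near_root with p; auto; lra).
      split; [|left; split; auto; apply Q; lra].
      intros l Hl E. specialize (Q l Hl). lra.
    - exists 0. split; [|right; destruct Hm as [Hm|Hm]; [lra|exact Hm]].
      assert (p = e) by (apply (root_unique v); auto; split; lra). subst p.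
      intros l Hl E. apply (branch_zero _ _ _ _ _ HB) in E; [|lra]. rewrite clamp_id in E by lra.
      assert (Q := branch_up _ _ _ _ _ HB l e). lra. }
  destruct Hroot as [m [Root Hm']].
  assert (Arg : forall n s, pn n < s -> g (vn n) s 1 <= 0).
  { intros n s Hs. apply above_root with (pn n); auto; [apply Hpn|lra]. }
  assert (Conv : forall eps, 0 < eps -> exists N, forall n, (N <= n)%nat ->
     forall s c, Rabs (g (vn n) s c - g v s c) <= eps).
  { intros eps Heps. destruct (branch_lipschitz _ _ _ _ _ HB (q e)) as [K [HK P]]; [lra|].
    destruct (Sv (eps / K)) as [N HN]; [apply Rdiv_lt_0_compat; lra|].
    exists N. intros n Hn s c. eapply Rle_trans; [apply P; auto; lra|].
    specialize (HN n Hn). replace eps with (K * (eps / K)) by (field; lra).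
    apply Rmult_le_compat_l; lra. }
  assert (Hpp : seq_to pn p) by (apply (root_continuous vn pn v p); auto; intros n; apply Hpn).
  assert (Pn := fun n => branch_persistent _ _ _ _ _ HB (vn n) (Hvn n)).
  assert (Yn := fun n => proj1 (HL n)). assert (Tn := fun n => proj2 (Hpn n)).
  assert (HP := branch_persistent _ _ _ _ _ HB v (proj1 Hv)).
  split.
  - destruct (left_limsup (g v) M L cb C (HG v ltac:(lra)) HC HP (fun n => g (vn n)) yn pn p m)
      as [y [Y [Lp Ls]]]; auto.
    exists y. split; [split; eauto|apply Ls].
  - destruct (left_liminf (g v) M L cb C (HG v ltac:(lra)) HC HP (fun n => g (vn n)) yn pn p m)
      as [y [Y [Lp Ls]]]; auto.
    exists y. split; [split; eauto|apply Ls].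
Qed.
End Branch.

(** * The flux function *)

Record flux (f fs fc fss : R -> R -> R) : Prop := {
  flux_C1 : C1_square f fs fc;
  flux_fs : partial1 fs fss;
  flux_fs_cont : continuous_on_square fs;
  flux_0 : forall c, unit_interval c -> f 0 c = 0;
  flux_1 : forall c, unit_interval c -> f 1 c = 1;
  flux_pos : forall s c, 0 < s < 1 -> unit_interval c -> 0 < fs s c;
  flux_fs_0 : forall c, unit_interval c -> fs 0 c = 0;
  flux_fs_1 : forall c, unit_interval c -> fs 1 c = 0;
  flux_inflection : F3 fss;
  flux_valley : F4 fc }.

(** The slope of the chord from (-d, 0) to the graph of f(., c). With d = a(1) its level sets at c =
    0 and c = 1 are the possible end states of a shock; with d = 0 it gives the chords through the
    origin that occur in the second s-wave. [tangency] is the numerator of its s-derivative. *)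
Definition quot (f : R -> R -> R) (d s c : R) : R := f s c / (s + d).
Definition tangency (f fs : R -> R -> R) (d s c : R) : R := fs s c * (s + d) - f s c.

Definition peak (f : R -> R -> R) (d c sT : R) : Prop :=
  0 < sT < 1 /\
  (forall x y, 0 <= x -> x < y -> y <= sT -> quot f d x c < quot f d y c) /\
  (forall x y, sT <= x -> x < y -> y <= 1 -> quot f d y c < quot f d x c).

Section Flux.
Variables (f fs fc fss : R -> R -> R).
Hypothesis H : flux f fs fc fss.

Lemma flux_D_in c : unit_interval c -> forall x, unit_interval x ->
  D_in (fun x => f x c) (fun x => fs x c) unit_interval x.
Proof. intros Hc x Hx. apply (proj1 (flux_C1 _ _ _ _ H)); auto. Qed.

Lemma flux_D2_in s : unit_interval s -> forall x, unit_interval x ->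
  D_in (fun x => f s x) (fun x => fc s x) unit_interval x.
Proof. intros Hs x Hx. apply (proj1 (proj2 (flux_C1 _ _ _ _ H))); auto. Qed.

Lemma flux_increasing c x y : unit_interval c -> 0 <= x -> x < y -> y <= 1 -> f x c < f y c.
Proof.
  intros Hc Hx Hxy Hy. apply (unit_increasing (fun x => f x c) (fun x => fs x c)); auto.
  - apply flux_D_in, Hc.
  - intros z Hz. apply (flux_pos _ _ _ _ H); auto; lra.
Qed.

Lemma flux_range s c : unit_interval s -> unit_interval c -> 0 <= f s c <= 1.
Proof.
  intros Hs Hc. unfold unit_interval in *. assert (E0 := flux_0 _ _ _ _ H c Hc). assert (E1 := flux_1 _ _ _ _ H c Hc).
  split.
  - destruct (Req_dec s 0) as [->|]; [lra|]. assert (Q := flux_increasing c 0 s Hc). lra.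
  - destruct (Req_dec s 1) as [->|]; [lra|]. assert (Q := flux_increasing c s 1 Hc). lra.
Qed.

Lemma fs_bounded : exists B, 0 < B /\ forall s c, 0 <= s <= 1 -> 0 <= c <= 1 -> Rabs (fs s c) <= B.
Proof. apply square_bounded, (flux_fs_cont _ _ _ _ H). Qed.

Lemma tangency_D_in d c : unit_interval c -> forall x, unit_interval x ->
  D_in (fun x => tangency f fs d x c) (fun x => fss x c * (x + d)) unit_interval x.
Proof.
  intros Hc x Hx. apply eps_D_in. intros e He.
  assert (D1 := flux_fs _ _ _ _ H x c Hx Hc). assert (D2 := flux_D_in c Hc x Hx).
  assert (D3 := Dadd _ _ _ _ _ _ (Rderiv.Dx unit_interval x) (Dconst unit_interval d x)).
  assert (D4 := Dmult _ _ _ _ _ _ D1 D3).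
  assert (D5 := Dminus _ _ _ _ _ _ D4 D2).
  destruct (D_in_eps _ _ _ _ D5 e He) as [del [Hd K]].
  exists del; split; auto. intros y Hy Hyx. specialize (K y Hy Hyx). unfold tangency.
  replace (fss x c * (x + d)) with (fss x c * (x + d) + fs x c * (1 + 0) - fs x c) by ring.
  exact K.
Qed.

(** The s-derivative is fss (s + d), so the function rises from 0 up to the inflection point and
    then falls to -1, with exactly one zero on the falling part. *)
Lemma tangency_shape d c : 0 <= d -> unit_interval c -> exists sI sT, 0 < sI < sT /\ sT < 1 /\
  (forall s, 0 < s < sT -> 0 < tangency f fs d s c) /\ tangency f fs d sT c = 0 /\
  (forall s, sT < s <= 1 -> tangency f fs d s c < 0) /\
  (forall x y, sI <= x -> x < y -> y <= 1 -> fs y c < fs x c).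
Proof.
  intros Hd Hc. destruct (flux_inflection _ _ _ _ H c Hc) as [sI [HsI [Pos Neg]]].
  set (g := fun x => tangency f fs d x c).
  assert (Dg := tangency_D_in d c Hc). fold g in Dg.
  assert (g0 : g 0 = 0).
  { unfold g, tangency. rewrite (flux_fs_0 _ _ _ _ H), (flux_0 _ _ _ _ H) by auto. ring. }
  assert (g1 : g 1 = -1).
  { unfold g, tangency. rewrite (flux_fs_1 _ _ _ _ H), (flux_1 _ _ _ _ H) by auto. ring. }
  assert (Up : forall x y, 0 <= x -> x < y -> y <= sI -> g x < g y).
  { intros x y Hx Hxy Hy. eapply unit_increasing; [exact Dg|lra|lra|lra|].
    intros z Hz. simpl. apply Rmult_lt_0_compat; [apply Pos|]; lra. }
  assert (Dn : forall x y, sI <= x -> x < y -> y <= 1 -> g y < g x).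
  { intros x y Hx Hxy Hy. eapply unit_decreasing; [exact Dg|lra|lra|lra|].
    intros z Hz. simpl. assert (Q := Neg z ltac:(lra)). nra. }
  assert (gI : 0 < g sI) by (rewrite <- g0; apply Up; lra).
  destruct (IVT_cor (linear_ext g (fun x => fss x c * (x + d))) sI 1) as [sT [HsT E]]; try lra.
  { intros x. apply derivable_continuous_pt. exists (fss (clamp x) c * (clamp x + d)).
    apply is_derive_Reals. apply (linear_ext_derive g (fun x => fss x c * (x + d)) Dg). }
  { rewrite !linear_ext_in by lra. rewrite g1. nra. }
  rewrite linear_ext_in in E by lra.
  assert (sT <> sI) by (intros ->; lra). assert (sT <> 1) by (intros ->; lra).
  exists sI, sT. split; [lra|]. split; [lra|]. split; [|split; [exact E|split]].
  - intros s Hs. fold (g s). destruct (Rle_lt_dec s sI).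
    + rewrite <- g0. apply Up; lra.
    + rewrite <- E. apply Dn; lra.
  - intros s Hs. fold (g s). rewrite <- E. apply Dn; lra.
  - intros x y Hx Hxy Hy. apply (unit_decreasing (fun x => fs x c) (fun x => fss x c)); try lra.
    + intros z Hz. apply (flux_fs _ _ _ _ H); auto.
    + intros z Hz. apply Neg; lra.
Qed.

Lemma quot_derive d c x : unit_interval c -> 0 <= x <= 1 -> 0 < x + d ->
  is_derive (fun s => linear_ext (fun s => f s c) (fun s => fs s c) s / (s + d)) x
    (tangency f fs d x c / (x + d) ^ 2).
Proof.
  intros Hc Hx Hd.
  assert (D1 := linear_ext_derive _ _ (flux_D_in c Hc) x). simpl in D1.
  auto_derive.
  - split; [|split; [lra|auto]]. eexists; exact D1.
  - match goal with |- context [Derive ?g x] =>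
      replace (Derive g x) with (fs (clamp x) c) by (symmetry; apply is_derive_unique; exact D1) end.
    rewrite clamp_id, linear_ext_in by lra.
    unfold tangency. field; lra.
Qed.

Lemma quot_increasing d c x y : unit_interval c -> 0 <= x -> 0 < x + d -> x < y -> y <= 1 ->
  (forall z, x < z < y -> 0 < tangency f fs d z c) -> quot f d x c < quot f d y c.
Proof.
  intros Hc Hx Hd Hxy Hy P.
  assert (Q : forall z, 0 <= z <= 1 ->
    quot f d z c = linear_ext (fun s => f s c) (fun s => fs s c) z / (z + d)).
  { intros z Hz. unfold quot. rewrite linear_ext_in by lra. reflexivity. }
  rewrite !Q by lra.
  apply (derive_increasing (fun s => linear_ext (fun s => f s c) (fun s => fs s c) s / (s + d))
    (fun z => tangency f fs d z c / (z + d) ^ 2)); auto.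
  - intros z Hz. apply quot_derive; auto; lra.
  - intros z Hz. apply Rdiv_lt_0_compat; [apply P; auto|apply pow_lt; lra].
Qed.

Lemma quot_decreasing d c x y : unit_interval c -> 0 <= x -> 0 < x + d -> x < y -> y <= 1 ->
  (forall z, x < z < y -> tangency f fs d z c < 0) -> quot f d y c < quot f d x c.
Proof.
  intros Hc Hx Hd Hxy Hy P.
  assert (Q : forall z, 0 <= z <= 1 ->
    quot f d z c = linear_ext (fun s => f s c) (fun s => fs s c) z / (z + d)).
  { intros z Hz. unfold quot. rewrite linear_ext_in by lra. reflexivity. }
  rewrite !Q by lra.
  destruct (MVT_R (fun s => linear_ext (fun s => f s c) (fun s => fs s c) s / (s + d))
    (fun z => tangency f fs d z c / (z + d) ^ 2) x y) as [z [Hz E]]; auto.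
  - intros z Hz. apply quot_derive; auto; lra.
  - assert (0 < (- tangency f fs d z c) / (z + d) ^ 2).
    { apply Rdiv_lt_0_compat; [specialize (P z Hz); lra|apply pow_lt; lra]. }
    cbv beta in E.
    replace (tangency f fs d z c / (z + d) ^ 2) with (- (- tangency f fs d z c / (z + d) ^ 2)) in E
      by (field; lra).
    nra.
Qed.

Lemma exists_peak d c : 0 < d -> unit_interval c -> exists sT, peak f d c sT /\
  (forall s, 0 < s < sT -> 0 < tangency f fs d s c) /\
  (forall s, sT < s <= 1 -> tangency f fs d s c < 0) /\ tangency f fs d sT c = 0 /\
  exists sI, 0 < sI < sT /\ (forall x y, sI <= x -> x < y -> y <= 1 -> fs y c < fs x c).
Proof.
  intros Hd Hc. destruct (tangency_shape d c ltac:(lra) Hc) as [sI [sT [H1 [H2 [P [Z [N Dc]]]]]]].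
  exists sT. split; [|split; [exact P|split; [exact N|split; [exact Z|exists sI; auto]]]].
  split; [lra|split].
  - intros x y Hx Hxy Hy. apply quot_increasing; auto; try lra. intros; apply P; lra.
  - intros x y Hx Hxy Hy. apply quot_decreasing; auto; try lra. intros; apply N; lra.
Qed.

Lemma valley s : 0 < s < 1 -> exists cs, 0 < cs < 1 /\
  (forall x y, 0 <= x -> x < y -> y <= cs -> f s y < f s x) /\
  (forall x y, cs <= x -> x < y -> y <= 1 -> f s x < f s y).
Proof.
  intros Hs. destruct (flux_valley _ _ _ _ H s Hs) as [cs [Hcs [N P]]].
  assert (Us : unit_interval s) by (red; lra).
  exists cs. split; auto. split; intros x y Hx Hxy Hy.
  - apply (unit_decreasing (fun x => f s x) (fun x => fc s x)); try lra.
    + apply flux_D2_in, Us.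
    + intros z Hz; apply N; lra.
  - apply (unit_increasing (fun x => f s x) (fun x => fc s x)); try lra.
    + apply flux_D2_in, Us.
    + intros z Hz; apply P; lra.
Qed.

Lemma valley_min s : unit_interval s -> exists cs, 0 < cs < 1 /\
  (forall c, 0 <= c <= 1 -> f s cs <= f s c) /\
  (0 < s < 1 -> (forall x y, 0 <= x -> x < y -> y <= cs -> f s y < f s x) /\
    (forall x y, cs <= x -> x < y -> y <= 1 -> f s x < f s y)).
Proof.
  unfold unit_interval. intros Hs.
  destruct (Req_dec s 0) as [->|H0].
  (* At s = 0, and likewise at s = 1, f is constant in c and any interior point is a minimiser. *)
  { exists (1/2). split; [lra|]. split; [|lra]. intros c Hc.
    rewrite !(flux_0 _ _ _ _ H) by (red; lra). lra. }
  destruct (Req_dec s 1) as [->|H1].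
  { exists (1/2). split; [lra|]. split; [|lra]. intros c Hc.
    rewrite !(flux_1 _ _ _ _ H) by (red; lra). lra. }
  destruct (valley s ltac:(lra)) as [cs [Hcs [D I]]]. exists cs. split; auto. split; auto.
  intros c Hc. destruct (Rtotal_order c cs) as [Hl|[->|Hl]]; [|lra|].
  - left; apply D; lra.
  - left; apply I; lra.
Qed.

Lemma quot_lipschitz d : 0 < d -> exists K, 0 < K /\ forall x y c, 0 <= x <= 1 -> 0 <= y <= 1 ->
  0 <= c <= 1 -> Rabs (quot f d y c - quot f d x c) <= K * Rabs (y - x).
Proof.
  intros Hd. destruct fs_bounded as [B [HB K]].
  exists ((B * (1 + d) + 1) / d ^ 2).
  assert (Hd2 : 0 < d ^ 2) by (apply pow_lt; lra).
  split. { apply Rdiv_lt_0_compat; auto. nra. }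
  assert (P : forall x y c, 0 <= x -> x < y -> y <= 1 -> 0 <= c <= 1 ->
    Rabs (quot f d y c - quot f d x c) <= (B * (1 + d) + 1) / d ^ 2 * Rabs (y - x)).
  { intros x y c Hx Hxy Hy Hc.
    assert (Q : forall z, 0 <= z <= 1 ->
      quot f d z c = linear_ext (fun s => f s c) (fun s => fs s c) z / (z + d)).
    { intros z Hz. unfold quot. rewrite linear_ext_in by lra. reflexivity. }
    rewrite !Q by lra.
    destruct (MVT_R (fun s => linear_ext (fun s => f s c) (fun s => fs s c) s / (s + d))
      (fun z => tangency f fs d z c / (z + d) ^ 2) x y) as [z [Hz ->]]; auto.
    - intros z Hz. apply quot_derive; auto; lra.
    - rewrite Rabs_mult. apply Rmult_le_compat_r; [apply Rabs_pos|].
      assert (Hzd : d ^ 2 <= (z + d) ^ 2) by (apply pow_incr; lra).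
      unfold Rdiv. rewrite Rabs_mult. apply Rmult_le_compat; try apply Rabs_pos.
      + unfold tangency. assert (R1 := K z c ltac:(lra) Hc). assert (R2 := flux_range z c ltac:(red; lra) Hc).
        apply Rabs_le_between in R1. apply Rabs_le. nra.
      + rewrite Rabs_pos_eq by (left; apply Rinv_0_lt_compat; lra).
        apply Rinv_le_contravar; lra. }
  intros x y c Hx Hy Hc. destruct (Rtotal_order x y) as [Hl|[->|Hl]].
  - apply P; lra.
  - rewrite !Rminus_diag, Rabs_R0. lra.
  - rewrite Rabs_minus_sym, (Rabs_minus_sym y). apply P; lra.
Qed.

Lemma quot_lt d s c c' : 0 < s + d -> f s c < f s c' -> quot f d s c < quot f d s c'.
Proof. intros Hd Hl. unfold quot, Rdiv. apply Rmult_lt_compat_r; auto. apply Rinv_0_lt_compat; auto. Qed.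

Lemma quot_le d s c c' : 0 < s + d -> f s c <= f s c' -> quot f d s c <= quot f d s c'.
Proof. intros Hd Hl. unfold quot, Rdiv. apply Rmult_le_compat_r; auto. left; apply Rinv_0_lt_compat; auto. Qed.

(* At the maximiser sb of s |-> min_c f/(s+d), with minimiser cb, the s-derivative of f/(s+d) vanishes
   (the minimisers are stable), and unimodality in s makes (sb,cb) a saddle point. *)
Lemma exists_saddle d : 0 < d -> exists sb cb, 0 < sb < 1 /\ 0 < cb < 1 /\
  (forall c, 0 <= c <= 1 -> quot f d sb cb <= quot f d sb c) /\
  (forall s, 0 <= s <= 1 -> quot f d s cb <= quot f d sb cb) /\
  quot f d sb cb < quot f d sb 0 /\ quot f d sb cb < quot f d sb 1 /\
  1 / (1 + d) < quot f d sb cb.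
Proof.
  intros Hd.
  assert (CH : exists cm : R -> R, forall s, unit_interval s -> 0 < cm s < 1 /\
    (forall c, 0 <= c <= 1 -> f s (cm s) <= f s c) /\
    (0 < s < 1 -> (forall x y, 0 <= x -> x < y -> y <= cm s -> f s y < f s x) /\
    (forall x y, cm s <= x -> x < y -> y <= 1 -> f s x < f s y))).
  { apply (functional_choice (fun s cs => unit_interval s -> 0 < cs < 1 /\
    (forall c, 0 <= c <= 1 -> f s cs <= f s c) /\
    (0 < s < 1 -> (forall x y, 0 <= x -> x < y -> y <= cs -> f s y < f s x) /\
    (forall x y, cs <= x -> x < y -> y <= 1 -> f s x < f s y)))).
    intros s. destruct (classic (unit_interval s)) as [Us|N].
    - destruct (valley_min s Us) as [cs Q]. exists cs; auto.
    - exists 0; tauto. }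
  destruct CH as [cm CM].
  destruct (quot_lipschitz d Hd) as [K [HK LK]].
  set (m := fun s => quot f d (clamp s) (cm (clamp s))).
  assert (Min : forall s c, 0 <= s <= 1 -> 0 <= c <= 1 -> m s <= quot f d s c).
  { intros s c Hs Hc. unfold m. rewrite clamp_id by auto. apply quot_le; [lra|].
    apply CM; auto. }
  (* A minimum over c of functions that are K-Lipschitz in s, uniformly in c, is K-Lipschitz,
     however the minimisers [cm] jump. *)
  assert (Mlip : forall s s', m s' <= m s + K * Rabs (s' - s)).
  { intros s s'. destruct (CM _ (clamp_unit s)) as [Uc _].
    destruct (CM _ (clamp_unit s')) as [Uc' [Mi _]].
    assert (Q := LK (clamp s) (clamp s') (cm (clamp s)) (clamp_unit s) (clamp_unit s') ltac:(lra)).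
    apply Rabs_le_between in Q.
    assert (Q2 := clamp_lip s s').
    assert (Q3 : quot f d (clamp s') (cm (clamp s')) <= quot f d (clamp s') (cm (clamp s))).
    { apply quot_le; [|apply Mi; lra]. assert (X := clamp_unit s'). lra. }
    unfold m. nra. }
  destruct (continuity_ab_maj m 0 1) as [sb [Max Hsb]]; [lra| |].
  { intros s _. apply continuity_pt_filterlim. apply (lipschitz_continuous m K HK). intros x y.
    assert (Q1 := Mlip x y). assert (Q2 := Mlip y x). rewrite Rabs_minus_sym in Q2.
    apply Rabs_le. lra. }
  set (cb := cm sb). destruct (CM sb Hsb) as [Ucb [Mcb Vcb]]. fold cb in Ucb, Mcb, Vcb.
  assert (Emb : m sb = quot f d sb cb) by (unfold m; rewrite clamp_id by auto; reflexivity).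
  assert (Em0 : m 0 = 0).
  { unfold m, quot. rewrite clamp_id by lra. rewrite (flux_0 _ _ _ _ H); [unfold Rdiv; ring|].
    destruct (CM 0); red; lra. }
  assert (Em1 : m 1 = 1 / (1 + d)).
  { unfold m, quot. rewrite clamp_id by lra. rewrite (flux_1 _ _ _ _ H); [reflexivity|].
    destruct (CM 1); red; lra. }
  assert (H1d : 0 < 1 / (1 + d)) by (apply Rdiv_lt_0_compat; lra).
  assert (Hsb0 : sb <> 0). { intros E. rewrite E in Max. assert (Q := Max 1 ltac:(lra)). lra. }
  (* Near s = 1 the slope fs is small and f close to 1, uniformly in c, so the quotient strictly
     decreases there for every c, and m is larger just to the left of 1. *)
  assert (Hsb1 : sb <> 1).
  { intros E. rewrite E in Max.
    destruct fs_bounded as [B [HB KB]].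
    destruct (square_uc fs (flux_fs_cont _ _ _ _ H) (1 / (2 * (1 + d)))) as [del [Hdel KD]].
    { apply Rdiv_lt_0_compat; lra. }
    assert (0 < 1 / (2 * B)) by (apply Rdiv_lt_0_compat; lra).
    destruct (exists_below (1 / 2) (del / 2) (1 / (2 * B))) as [h [Hh [X1 [X2 X3]]]]; try lra.
    pose (x := 1 - h). assert (Ex : x = 1 - h) by reflexivity. clearbody x.
    assert (Q := Max x ltac:(lra)). rewrite Em1 in Q.
    destruct (CM x) as [Ux _]; [red; lra|].
    assert (quot f d 1 (cm x) < quot f d x (cm x)).
    { apply quot_decreasing; try lra; [red; lra|]. intros z Hz.
      assert (Q1 := KD 1 z (cm x) (cm x) ltac:(apply Rabs_def1; lra)
        ltac:(rewrite Rminus_diag, Rabs_R0; lra)).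
      rewrite !clamped_in, (flux_fs_1 _ _ _ _ H) in Q1 by (try red; lra).
      apply Rabs_def2 in Q1.
      destruct (MVT_unit (fun s => f s (cm x)) (fun s => fs s (cm x)) z 1) as [w [Hw E']]; try lra.
      { apply flux_D_in; red; lra. }
      rewrite (flux_1 _ _ _ _ H) in E' by (red; lra).
      assert (Q2 := KB w (cm x) ltac:(lra) ltac:(lra)). apply Rabs_le_between in Q2.
      assert (1 - f z (cm x) < 1 / 2).
      { rewrite E'. assert (fs w (cm x) * (1 - z) <= B * (1 - z)) by (apply Rmult_le_compat_r; lra).
        assert (B * (1 - z) < B * (1 / (2 * B))) by (apply Rmult_lt_compat_l; lra).
        replace (B * (1 / (2 * B))) with (1 / 2) in * by (field; lra). lra. }
      unfold tangency.
      assert (fs z (cm x) * (z + d) <= 1 / (2 * (1 + d)) * (1 + d)).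
      { apply Rmult_le_compat; try lra. left; apply (flux_pos _ _ _ _ H); [lra|red; lra]. }
      replace (1 / (2 * (1 + d)) * (1 + d)) with (1 / 2) in * by (field; lra). lra. }
    assert (quot f d 1 (cm x) = 1 / (1 + d)).
    { unfold quot. rewrite (flux_1 _ _ _ _ H); [reflexivity|red; lra]. }
    assert (m x = quot f d x (cm x)) by (unfold m; rewrite clamp_id by lra; reflexivity).
    lra. }
  assert (Hs : 0 < sb < 1) by lra.
  destruct (Vcb Hs) as [Dec Inc].
  (* Stability of the minimiser: at sb, leaving the del-neighbourhood of cb costs at least eta,
     whereas moving s costs at most K |s - sb|. The last inequality says that m s <= m sb, compared
     at the minimiser of s. *)
  assert (Crit : forall del, 0 < del -> exists th, 0 < th /\ forall s, 0 <= s <= 1 ->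
     Rabs (s - sb) < th -> exists c, 0 <= c <= 1 /\ Rabs (c - cb) < del /\
        quot f d s c <= quot f d sb c).
  { intros del0 Hdel0.
    destruct (exists_below del0 (cb / 2) ((1 - cb) / 2)) as [del [Hdel [D1 [D2 D3]]]]; try lra.
    set (eta := Rmin (quot f d sb (cb - del)) (quot f d sb (cb + del)) - quot f d sb cb).
    assert (Heta : 0 < eta).
    { assert (A1 : quot f d sb cb < quot f d sb (cb - del)) by (apply quot_lt; [lra|apply Dec; lra]).
      assert (A2 : quot f d sb cb < quot f d sb (cb + del)) by (apply quot_lt; [lra|apply Inc; lra]).
      unfold eta, Rmin; destruct Rle_dec; lra. }
    exists (eta / K). split; [apply Rdiv_lt_0_compat; lra|]. intros s Us Hss.
    assert (Hk : K * Rabs (s - sb) < eta).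
    { replace eta with (K * (eta / K)) by (field; lra). apply Rmult_lt_compat_l; lra. }
    exists (cm s). destruct (CM s Us) as [Uc _]. split; [lra|].
    assert (Q := Max s Us). rewrite Emb in Q. unfold m in Q. rewrite clamp_id in Q by auto.
    assert (Q2 := Min sb (cm s) Hsb ltac:(lra)). rewrite Emb in Q2.
    split; [|lra].
    assert (LL := LK sb s (cm s) Hsb Us ltac:(lra)). apply Rabs_le_between in LL.
    assert (E1 : quot f d sb (cm s) < quot f d sb cb + eta) by lra.
    apply Rnot_le_lt. intros Hge.
    assert (E2 : cm s <= cb - del \/ cb + del <= cm s).
    { unfold Rabs in Hge. destruct Rcase_abs; lra. }
    assert (quot f d sb cb + eta <= quot f d sb (cm s)); [|lra].
    destruct E2 as [E2|E2].
    - apply Rle_trans with (quot f d sb (cb - del)).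
      + unfold eta. assert (X := Rmin_l (quot f d sb (cb - del)) (quot f d sb (cb + del))). lra.
      + apply quot_le; [lra|]. destruct (Req_dec (cm s) (cb - del)) as [->|]; [lra|].
        left; apply Dec; lra.
    - apply Rle_trans with (quot f d sb (cb + del)).
      + unfold eta. assert (X := Rmin_r (quot f d sb (cb - del)) (quot f d sb (cb + del))). lra.
      + apply quot_le; [lra|]. destruct (Req_dec (cm s) (cb + del)) as [->|]; [lra|].
        left; apply Inc; lra. }
  destruct (exists_peak d cb Hd ltac:(red; lra)) as [sT [[HsT [Up Dn]] [Pos [Neg _]]]].
  assert (Tc : forall e, 0 < e -> exists del, 0 < del /\ forall s c, 0 <= s <= 1 -> 0 <= c <= 1 ->
     Rabs (s - sb) < del -> Rabs (c - cb) < del ->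
     Rabs (tangency f fs d s c - tangency f fs d sb cb) < e).
  { intros e He.
    destruct (continuous_on_square_eps fs (flux_fs_cont _ _ _ _ H) sb cb Hsb ltac:(lra)
       (e / (2 * (2 + d)))) as [d1 [Hd1 K1]]. { apply Rdiv_lt_0_compat; lra. }
    destruct (continuous_on_square_eps f (proj1 (proj2 (proj2 (flux_C1 _ _ _ _ H)))) sb cb Hsb
       ltac:(lra) (e / 4) ltac:(lra)) as [d2 [Hd2 K2]].
    destruct fs_bounded as [B [HB KB]].
    set (d3 := e / (4 * B)). assert (Hd3 : 0 < d3) by (apply Rdiv_lt_0_compat; lra).
    destruct (exists_below d1 d2 d3) as [del [Hdel [D1 [D2 D3]]]]; auto.
    exists del. split; auto. intros s c Us Uc A1 A2.
    specialize (K1 s c Us Uc ltac:(lra) ltac:(lra)). specialize (K2 s c Us Uc ltac:(lra) ltac:(lra)).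
    specialize (KB sb cb Hsb ltac:(lra)).
    unfold tangency.
    replace (fs s c * (s + d) - f s c - (fs sb cb * (sb + d) - f sb cb)) with
      ((fs s c - fs sb cb) * (s + d) + fs sb cb * (s - sb) - (f s c - f sb cb)) by ring.
    assert (B1 : Rabs ((fs s c - fs sb cb) * (s + d)) <= e / 2).
    { rewrite Rabs_mult, (Rabs_pos_eq (s + d)) by lra.
      replace (e / 2) with (e / (2 * (2 + d)) * (2 + d)) by (field; lra).
      apply Rmult_le_compat; try lra. apply Rabs_pos. }
    assert (B2 : Rabs (fs sb cb * (s - sb)) < e / 4).
    { rewrite Rabs_mult. replace (e / 4) with (B * d3) by (unfold d3; field; lra).
      apply Rle_lt_trans with (B * Rabs (s - sb)).
      - apply Rmult_le_compat_r; [apply Rabs_pos|auto].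
      - apply Rmult_lt_compat_l; lra. }
    apply Rabs_le_between in B1. apply Rabs_def2 in B2. apply Rabs_def2 in K2.
    apply Rabs_def1; lra. }
  assert (Hcrit : tangency f fs d sb cb = 0).
  (* If the derivative were not zero it would keep its sign near (sb, cb), and a small step of s in
     the rising direction would raise the quotient for every c near cb, contrary to [Crit]. *)
  { destruct (Rtotal_order (tangency f fs d sb cb) 0) as [Hn|[Hz|Hp]]; auto; exfalso.
    - destruct (Tc (- tangency f fs d sb cb) ltac:(lra)) as [del [Hdel KT]].
      destruct (Crit del Hdel) as [th [Hth KC]].
      destruct (exists_below (sb / 2) (th / 2) (del / 2)) as [w [Hw [W1 [W2 W3]]]]; try lra.
      destruct (KC (sb - w)) as [c [Uc [Hc Q]]]; [lra|apply Rabs_def1; lra|].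
      assert (quot f d sb c < quot f d (sb - w) c); [|lra].
      apply quot_decreasing; auto; try lra. intros z Hz.
      assert (X := KT z c ltac:(lra) Uc ltac:(apply Rabs_def1; lra) Hc).
      apply Rabs_def2 in X. lra.
    - destruct (Tc (tangency f fs d sb cb) ltac:(lra)) as [del [Hdel KT]].
      destruct (Crit del Hdel) as [th [Hth KC]].
      destruct (exists_below ((1 - sb) / 2) (th / 2) (del / 2)) as [w [Hw [W1 [W2 W3]]]]; try lra.
      destruct (KC (sb + w)) as [c [Uc [Hc Q]]]; [lra|apply Rabs_def1; lra|].
      assert (quot f d sb c < quot f d (sb + w) c); [|lra].
      apply quot_increasing; auto; try lra. intros z Hz.
      assert (X := KT z c ltac:(lra) Uc ltac:(apply Rabs_def1; lra) Hc).
      apply Rabs_def2 in X. lra. }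
  assert (EsT : sb = sT).
  { destruct (Rtotal_order sb sT) as [Hl|[E|Hl]]; auto.
    - assert (X := Pos sb ltac:(lra)). lra.
    - assert (X := Neg sb ltac:(lra)). lra. }
  exists sb, cb. split; [lra|]. split; [lra|]. split; [|split; [|split; [|split]]].
  - intros c Hc. apply quot_le; [lra|auto].
  - intros s Us. destruct (Rtotal_order s sb) as [Hl|[->|Hl]]; [|lra|].
    + left. apply Up; lra.
    + left. apply Dn; lra.
  - apply quot_lt; [lra|apply Dec; lra].
  - apply quot_lt; [lra|apply Inc; lra].
  - replace (1 / (1 + d)) with (quot f d 1 cb).
    + apply Dn; lra.
    + unfold quot. rewrite (flux_1 _ _ _ _ H); [reflexivity|red; lra].
Qed.
End Flux.

(** * The concentration profile *)

Section Clock.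
Variables (h : R -> R) (K cb : R).
Hypotheses (HK : 0 < K) (Hcb : 0 < cb < 1) (Hpos : forall x, 0 < x < 1 -> 0 < h x)
  (H0 : h 0 = 0) (H1 : h 1 = 0)
  (HL : forall x y, 0 <= x <= 1 -> 0 <= y <= 1 -> Rabs (h y - h x) <= K * Rabs (y - x)).

(** Separation of variables for c' = -h(c); the sign makes the time grow as c falls from 1 to 0. *)
Definition travel_time (x : R) : R := - RInt (fun y => / h y) cb x.

Lemma inv_rate_continuous x : 0 < x < 1 -> continuous (fun y => / h y) x.
Proof.
  intros Hx. apply (continuous_comp h Rinv).
  - apply continuity_eps. intros e He.
    destruct (exists_below (e / K) x (1 - x)) as [d [Hd [D1 [D2 D3]]]]; try lra.
    { apply Rdiv_lt_0_compat; lra. }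
    exists d. split; auto. intros y Hy. assert (Hy' := Rabs_def2 _ _ Hy).
    eapply Rle_lt_trans; [apply HL; lra|].
    replace e with (K * (e / K)) by (field; lra). apply Rmult_lt_compat_l; lra.
  - apply continuous_Rinv. assert (Q := Hpos x Hx). lra.
Qed.

Lemma travel_time_derive x : 0 < x < 1 -> is_derive travel_time x (- / h x).
Proof.
  intros Hx. unfold travel_time. apply (is_derive_opp (fun x => RInt (fun y => / h y) cb x)).
  apply (is_derive_RInt (fun y => / h y) (fun x => RInt (fun y => / h y) cb x) cb x).
  - apply locally_eps. exists (Rmin x (1 - x)). split; [apply Rmin_pos; lra|].
    intros y Hy.
    assert (Y3 := Rlt_le_trans _ _ _ Hy (Rmin_l _ _)).
    assert (Y4 := Rlt_le_trans _ _ _ Hy (Rmin_r _ _)).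
    apply Rabs_def2 in Y3. apply Rabs_def2 in Y4.
    apply (RInt_correct (fun y => / h y) cb y).
    apply (ex_RInt_continuous (fun y => / h y)). intros z Hz. apply inv_rate_continuous.
    unfold Rmin, Rmax in Hz. destruct Rle_dec; lra.
  - apply inv_rate_continuous, Hx.
Qed.

Lemma travel_time_decreasing x y : 0 < x -> x < y -> y < 1 -> travel_time y < travel_time x.
Proof.
  intros Hx Hxy Hy.
  destruct (MVT_R travel_time (fun x => - / h x) x y) as [z [Hz E]]; auto.
  { intros z Hz; apply travel_time_derive; lra. }
  assert (0 < / h z) by (apply Rinv_0_lt_compat, Hpos; lra). nra.
Qed.

Lemma travel_time_injective x y : 0 < x < 1 -> 0 < y < 1 -> travel_time x = travel_time y -> x = y.
Proof.
  intros Hx Hy E. destruct (Rtotal_order x y) as [L|[L|L]]; auto.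
  - assert (Q := travel_time_decreasing x y). lra.
  - assert (Q := travel_time_decreasing y x). lra.
Qed.

Lemma travel_time_at_cb : travel_time cb = 0.
Proof. unfold travel_time. rewrite RInt_point. unfold zero; simpl. ring. Qed.

(** Since h x <= K x near the equilibrium 0, the approach is at most exponentially fast, so the time
    to reach it is infinite. *)
Lemma travel_time_near_0 x : 0 < x <= cb -> (ln cb - ln x) / K <= travel_time x.
Proof.
  intros Hx. assert (Q : travel_time cb + ln cb / K <= travel_time x + ln x / K).
  { apply (derive_nonincreasing (fun x => travel_time x + ln x / K)
      (fun x => - / h x + / x / K)); try lra.
    - intros z Hz. apply (is_derive_plus travel_time (fun x => ln x / K)).
      + apply travel_time_derive; lra.
      + auto_derive; [lra|]. field; lra.
    - intros z Hz. assert (h z <= K * z).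
      { assert (B := HL 0 z ltac:(lra) ltac:(lra)). rewrite H0 in B.
        replace (h z - 0) with (h z) in B by ring. replace (z - 0) with z in B by ring.
        rewrite (Rabs_pos_eq z) in B by lra. assert (X := Rle_abs (h z)). lra. }
      assert (/ (K * z) <= / h z) by (apply Rinv_le_contravar; [apply Hpos; lra|auto]).
      replace (/ z / K) with (/ (K * z)) by (field; lra). lra. }
  rewrite travel_time_at_cb in Q. unfold Rdiv in *. lra.
Qed.

Lemma travel_time_near_1 x : cb <= x < 1 -> travel_time x <= (ln (1 - x) - ln (1 - cb)) / K.
Proof.
  intros Hx. assert (Q : travel_time x - ln (1 - x) / K <= travel_time cb - ln (1 - cb) / K).
  { apply (derive_nonincreasing (fun x => travel_time x - ln (1 - x) / K)
      (fun x => - / h x - (- / (1 - x) / K))); try lra.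
    - intros z Hz. apply (is_derive_minus travel_time (fun x => ln (1 - x) / K)).
      + apply travel_time_derive; lra.
      + auto_derive; [lra|]. field; lra.
    - intros z Hz. assert (h z <= K * (1 - z)).
      { assert (B := HL 1 z ltac:(lra) ltac:(lra)). rewrite H1 in B.
        replace (h z - 0) with (h z) in B by ring. rewrite (Rabs_left (z - 1)) in B by lra.
        assert (X := Rle_abs (h z)). lra. }
      assert (/ (K * (1 - z)) <= / h z) by (apply Rinv_le_contravar; [apply Hpos; lra|auto]).
      replace (- / (1 - z) / K) with (- / (K * (1 - z))) by (field; lra). lra. }
  rewrite travel_time_at_cb in Q. unfold Rdiv in *. lra.
Qed.

Lemma travel_time_onto t : exists x, 0 < x < 1 /\ travel_time x = t.
Proof.
  (* With this factor the logarithmic bounds at x0 and x1 become exactly |t| + 1 and -(|t| + 1),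
     which enclose t. *)
  set (E := exp (- (K * (Rabs t + 1)))).
  assert (HE : 0 < E) by apply exp_pos.
  assert (Ht : 0 <= Rabs t) by apply Rabs_pos.
  assert (HE1 : E < 1).
  { rewrite <- exp_0. apply exp_increasing. nra. }
  set (x0 := cb * E). set (x1 := 1 - (1 - cb) * E).
  assert (X0 : 0 < x0 < cb) by (unfold x0; nra).
  assert (X1 : cb < x1 < 1) by (unfold x1; nra).
  assert (Q0 := travel_time_near_0 x0 ltac:(lra)).
  assert (Q1 := travel_time_near_1 x1 ltac:(lra)).
  unfold x0 in Q0 at 1. rewrite ln_mult in Q0 by lra.
  unfold x1 in Q1 at 2. replace (1 - (1 - (1 - cb) * E)) with ((1 - cb) * E) in Q1 by ring.
  rewrite ln_mult in Q1 by lra. unfold E in Q0 at 1, Q1 at 1. rewrite ln_exp in Q0, Q1.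
  replace ((ln cb - (ln cb + - (K * (Rabs t + 1)))) / K) with (Rabs t + 1) in Q0 by (field; lra).
  replace ((ln (1 - cb) + - (K * (Rabs t + 1)) - ln (1 - cb)) / K) with (- (Rabs t + 1)) in Q1
    by (field; lra).
  assert (A1 := Rle_abs t). assert (A2 := Rle_abs (- t)). rewrite Rabs_Ropp in A2.
  destruct (IVT_interv (fun x => t - travel_time x) x0 x1) as [z [Hz Ez]]; try lra.
  - intros a Ha. apply continuity_pt_filterlim.
    apply (continuous_minus (fun _ => t) travel_time).
    + apply continuous_const.
    + apply (is_derive_cont _ _ _ (travel_time_derive a ltac:(lra))).
  - exists z. split; lra.
Qed.

Lemma exists_clock : exists C, clock C cb /\ (forall t, travel_time (C t) = t) /\
  forall t, is_derive C t (- h (C t)).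
Proof.
  destruct (functional_choice (fun t x => 0 < x < 1 /\ travel_time x = t) travel_time_onto)
    as [C HC].
  assert (U : forall t, 0 < C t < 1) by (intros t; apply HC).
  assert (E : forall t, travel_time (C t) = t) by (intros t; apply HC).
  assert (Dec : forall t t', t < t' -> C t' < C t).
  { intros t t' Ht. destruct (Rlt_le_dec (C t') (C t)) as [|Hle]; auto.
    destruct (Req_dec (C t) (C t')) as [Eq|Ne].
    - assert (t = t') by (rewrite <- (E t), <- (E t'), Eq; reflexivity). lra.
    - assert (Q := travel_time_decreasing (C t) (C t')).
      assert (X := U t). assert (Y := U t'). rewrite !E in Q. lra. }
  assert (Bh : forall x, 0 <= x <= 1 -> h x <= K).
  { intros x Hx. assert (B := HL 0 x ltac:(lra) Hx). rewrite H0 in B.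
    replace (h x - 0) with (h x) in B by ring. replace (x - 0) with x in B by ring.
    rewrite (Rabs_pos_eq x) in B by lra. assert (X := Rle_abs (h x)). nra. }
  assert (Inc : forall t t', t < t' -> exists z, C t' < z < C t /\ C t' - C t = - h z * (t' - t)).
  { intros t t' Ht. assert (X := U t). assert (Y := U t').
    destruct (MVT_R travel_time (fun x => - / h x) (C t') (C t)) as [z [Hz Q]]; auto.
    { intros z Hz; apply travel_time_derive; lra. }
    exists z. split; auto. rewrite !E in Q. assert (P := Hpos z ltac:(lra)).
    replace (t' - t) with (/ h z * (C t - C t')) by lra. field; lra. }
  assert (Lip : forall t t', Rabs (C t' - C t) <= K * Rabs (t' - t)).
  { assert (P : forall t t', t < t' -> Rabs (C t' - C t) <= K * Rabs (t' - t)).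
    { intros t t' Ht. destruct (Inc t t' Ht) as [z [Hz ->]].
      assert (X := U t). assert (Y := U t').
      rewrite Rabs_mult, Rabs_Ropp. apply Rmult_le_compat_r; [apply Rabs_pos|].
      assert (Q := Hpos z ltac:(lra)). rewrite Rabs_pos_eq by lra. apply Bh; lra. }
    intros t t'. destruct (Rtotal_order t t') as [L|[->|L]]; auto.
    - rewrite !Rminus_diag, Rabs_R0. lra.
    - rewrite Rabs_minus_sym, (Rabs_minus_sym t'). auto. }
  exists C. split; [split|split]; auto.
  - apply travel_time_injective; auto. rewrite E, travel_time_at_cb. reflexivity.
  - exists K; auto.
  - intros e He. set (x := Rmax (1 - e / 2) (1 / 2)).
    assert (Hx : 1 / 2 <= x < 1 /\ 1 - e < x) by (unfold x, Rmax; destruct Rle_dec; lra).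
    exists (travel_time x). intros t Ht. assert (X := U t).
    destruct (Rlt_le_dec (C t) x) as [L|L]; [|apply Rabs_def1; lra].
    assert (Q := travel_time_decreasing (C t) x). rewrite E in Q. lra.
  - intros e He. set (x := Rmin (e / 2) (1 / 2)).
    assert (Hx : 0 < x <= 1 / 2 /\ x < e) by (unfold x, Rmin; destruct Rle_dec; lra).
    exists (travel_time x). intros t Ht. assert (X := U t).
    destruct (Rlt_le_dec x (C t)) as [L|L]; [|apply Rabs_def1; lra].
    assert (Q := travel_time_decreasing x (C t)). rewrite E in Q. lra.
  - intros t. apply is_derive_eps. intros e He.
    (* The difference quotient of C is -h z with z between the two values of C. One factor K bounds
       |z - C t| by K |r - t|, the other is the Lipschitz constant of h. *)
    exists (e / (K * K)). split; [apply Rdiv_lt_0_compat; nra|]. intros r Hr.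
    assert (Q : exists z, 0 <= z <= 1 /\ Rabs (z - C t) <= K * Rabs (r - t) /\
      C r - C t = - h z * (r - t)).
    { assert (X := U t). assert (Y := U r). assert (LL := Lip t r).
      destruct (Rtotal_order t r) as [L|[->|L]].
      - destruct (Inc t r L) as [z [Hz Ez]]. exists z. split; [lra|]. split; auto.
        rewrite Rabs_left in LL by lra. rewrite Rabs_left by lra. lra.
      - exists (C r). split; [lra|]. split; [|ring]. rewrite !Rminus_diag, Rabs_R0; lra.
      - destruct (Inc r t L) as [z [Hz Ez]]. exists z. split; [lra|]. split; [|lra].
        rewrite (Rabs_pos_eq (C r - C t)) in LL by lra. rewrite Rabs_pos_eq by lra. lra. }
    destruct Q as [z [Uz [Dz Ez]]]. rewrite Ez.
    replace (- h z * (r - t) - - h (C t) * (r - t)) with (- (h z - h (C t)) * (r - t)) by ring.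
    rewrite Rabs_mult, Rabs_Ropp. apply Rmult_le_compat_r; [apply Rabs_pos|].
    assert (X := U t). eapply Rle_trans; [apply HL; lra|].
    assert (K * K * Rabs (r - t) <= e).
    { replace e with (K * K * (e / (K * K))) by (field; lra).
      apply Rmult_le_compat_l; [nra|lra]. }
    nra.
Qed.

(** The equation for c is autonomous: [travel_time (c x)] grows at the constant rate 1 / k, so c is
    a rescaled translate of C. *)
Lemma clock_time_change C k (c : R -> R) : (forall t, 0 < C t < 1) ->
  (forall t, travel_time (C t) = t) -> 0 < k -> (forall x, 0 < c x < 1) ->
  (forall x, is_derive c x (- h (c x) / k)) ->
  exists x0, forall t, c (k * t + x0) = C t.
Proof.
  intros U E Hk Uc Dc.
  assert (D : forall x, is_derive (fun x => travel_time (c x) - x / k) x 0).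
  { intros x. assert (P := Hpos (c x) (Uc x)).
    evar_last.
    { apply (is_derive_minus (fun x => travel_time (c x)) (fun x => x / k)).
      - apply (is_derive_comp travel_time c).
        + apply travel_time_derive, Uc.
        + apply Dc.
      - instantiate (1 := / k). auto_derive; auto. field; lra. }
    unfold minus, plus, opp, scal; simpl. unfold mult; simpl. field; lra. }
  set (T0 := travel_time (c 0)).
  assert (Cst : forall x, travel_time (c x) = x / k + T0).
  { intros x. destruct (Rtotal_order x 0) as [L|[->|L]].
    - destruct (MVT_R (fun x => travel_time (c x) - x / k) (fun _ => 0) x 0) as [z [_ Q]]; auto.
      fold T0 in Q. unfold Rdiv in *. lra.
    - unfold T0, Rdiv; ring.
    - destruct (MVT_R (fun x => travel_time (c x) - x / k) (fun _ => 0) 0 x) as [z [_ Q]]; auto.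
      fold T0 in Q. unfold Rdiv in *. lra. }
  exists (- k * T0). intros t. apply travel_time_injective; auto.
  rewrite E, Cst. field; lra.
Qed.
End Clock.

(** * The adsorption isotherm and its excess over the chord *)

Section Isotherm.
Variables (a a1 a2 : R -> R).
Hypotheses (hA1 : A1 a a1 a2) (hA2 : A2 a1) (hA3 : A3 a2).

Lemma isotherm_positive : 0 < a 1.
Proof.
  destruct hA1 as [[D _] E]. rewrite <- E.
  apply (unit_increasing a a1); auto; try lra.
Qed.

Definition excess (c : R) : R := a c - a 1 * c.

Lemma excess_0 : excess 0 = 0.
Proof. unfold excess. destruct hA1 as [_ E]. rewrite E. ring. Qed.

Lemma excess_1 : excess 1 = 0.
Proof. unfold excess. ring. Qed.

(** The excess equals c (1 - c) (a1 x - a1 y) for some x < c < y, and a1 is strictly decreasing. *)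
Lemma excess_positive c : 0 < c < 1 -> 0 < excess c.
Proof.
  intros Hc. destruct hA1 as [[D [D2 _]] E].
  destruct (MVT_unit a a1 0 c) as [x [Hx Ex]]; auto; try lra.
  destruct (MVT_unit a a1 c 1) as [y [Hy Ey]]; auto; try lra.
  assert (Q : a1 y < a1 x) by (apply (unit_decreasing a1 a2); auto; try lra; intros; apply hA3; lra).
  rewrite E in Ex. unfold excess.
  replace (a c - a 1 * c) with ((1 - c) * (a c - 0) - c * (a 1 - a c)) by ring.
  rewrite Ex, Ey. assert (0 < c * (1 - c)) by nra. nra.
Qed.

Lemma excess_lipschitz : exists K, 0 < K /\ forall x y, 0 <= x <= 1 -> 0 <= y <= 1 ->
  Rabs (excess y - excess x) <= K * Rabs (y - x).
Proof.
  destruct hA1 as [[D [D2 _]] E].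
  assert (Dl := linear_ext_derive a1 a2 D2).
  destruct (continuity_ab_maj (linear_ext a1 a2) 0 1) as [Mx [HMx _]]; [lra| |].
  { intros c _. apply continuity_pt_filterlim. apply (is_derive_cont _ _ _ (Dl c)). }
  destruct (continuity_ab_min (linear_ext a1 a2) 0 1) as [mx [Hmx _]]; [lra| |].
  { intros c _. apply continuity_pt_filterlim. apply (is_derive_cont _ _ _ (Dl c)). }
  set (Mm := linear_ext a1 a2 Mx) in *. set (mm := linear_ext a1 a2 mx) in *.
  set (K := Rabs Mm + Rabs mm + Rabs (a 1) + 1).
  assert (P0 := Rabs_pos Mm). assert (P1 := Rabs_pos mm). assert (P2 := Rabs_pos (a 1)).
  exists K. split; [unfold K; lra|].
  assert (P : forall x y, 0 <= x -> x < y -> y <= 1 -> Rabs (excess y - excess x) <= K * Rabs (y - x)).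
  { intros x y Hx Hxy Hy. destruct (MVT_unit a a1 x y) as [z [Hz Ez]]; auto.
    replace (excess y - excess x) with ((a1 z - a 1) * (y - x)).
    - rewrite Rabs_mult. apply Rmult_le_compat_r; [apply Rabs_pos|].
      specialize (HMx z ltac:(lra)). specialize (Hmx z ltac:(lra)).
      rewrite linear_ext_in in HMx, Hmx by lra.
      assert (Q1 := Rle_abs Mm). assert (Q2 := Rle_abs (- mm)). rewrite Rabs_Ropp in Q2.
      assert (Q3 := Rle_abs (a 1)). assert (Q4 := Rle_abs (- a 1)). rewrite Rabs_Ropp in Q4.
      unfold K. apply Rabs_le. lra.
    - unfold excess. lra. }
  intros x y Hx Hy. destruct (Rtotal_order x y) as [L|[->|L]].
  - apply P; lra.
  - rewrite !Rminus_diag, Rabs_R0. lra.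
  - rewrite Rabs_minus_sym, (Rabs_minus_sym y). apply P; lra.
Qed.
End Isotherm.

(** * Connecting orbits *)

Lemma square_mult g1 g2 : continuous_on_square g1 -> continuous_on_square g2 ->
  continuous_on_square (fun s c => g1 s c * g2 s c).
Proof.
  intros H1 H2 x Hx.
  apply (filterlim_comp_2 (fun p : R * R => g1 (fst p) (snd p)) (fun p => g2 (fst p) (snd p)) Rmult
    (H1 x Hx) (H2 x Hx)).
  apply (filterlim_mult (K := R_AbsRing)).
Qed.

Lemma square_plus g1 g2 : continuous_on_square g1 -> continuous_on_square g2 ->
  continuous_on_square (fun s c => g1 s c + g2 s c).
Proof.
  intros H1 H2 x Hx.
  apply (filterlim_comp_2 (fun p : R * R => g1 (fst p) (snd p)) (fun p => g2 (fst p) (snd p)) Rplus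
    (H1 x Hx) (H2 x Hx)).
  apply (filterlim_plus (K := R_AbsRing) (V := R_NormedModule)).
Qed.

Lemma square_of_continuous (g : R * R -> R) : (forall p, continuous g p) ->
  continuous_on_square (fun s c => g (s, c)).
Proof.
  intros H [s c] _ P HP. apply filter_le_within. specialize (H (s, c) P HP).
  revert H. unfold filtermap. apply filter_imp. intros [x y]; auto.
Qed.

Lemma square_inv g : continuous_on_square g -> (forall s c, unit_interval s -> unit_interval c ->
  g s c <> 0) -> continuous_on_square (fun s c => / g s c).
Proof.
  intros H N x [Hx Hy].
  apply (filterlim_comp _ _ _ (fun p : R * R => g (fst p) (snd p)) Rinv _ _ _ (H x (conj Hx Hy))).
  apply continuous_Rinv, N; auto.
Qed.

Definition raw_speed (f A : R -> R -> R) (d kappa v s c : R) : R :=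
  kappa * d * v * (f s c - v * (s + d)) / A s c.

(* The right-hand side of the profile equation in the time for which c' = -(a c - a 1 * c). *)
Definition speed (f A : R -> R -> R) (d kappa v : R) : R -> R -> R :=
  clamped (raw_speed f A d kappa v).

(** * The saturation equation: its end states, its orbits and the selected velocity *)

Section Model.
Variables (f fs fc fss A : R -> R -> R) (d Amin Amax : R).
Hypotheses (HF : flux f fs fc fss) (Hd : 0 < d) (HA : continuous_on_square A) (HAm : 0 < Amin)
  (HAb : forall s c, unit_interval s -> unit_interval c -> Amin <= A s c <= Amax).

Lemma speed_eq kappa v s c : speed f A d kappa v s c =
  (kappa * d * v / A (clamp s) (clamp c)) * (f (clamp s) (clamp c) - v * (clamp s + d)).
Proof. unfold speed, clamped, raw_speed, Rdiv. ring. Qed.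

Lemma A_clamp s c : Amin <= A (clamp s) (clamp c) <= Amax.
Proof. apply HAb; apply clamp_unit. Qed.

Lemma weight_positive kappa v s c : 0 < kappa -> 0 < v ->
  0 < kappa * d * v / A (clamp s) (clamp c).
Proof.
  intros Hk Hv. assert (Q := A_clamp s c). apply Rdiv_lt_0_compat; [|lra].
  repeat apply Rmult_lt_0_compat; auto.
Qed.

Lemma quot_gap s c v : 0 <= s -> f s c - v * (s + d) = (quot f d s c - v) * (s + d).
Proof. intros Hs. unfold quot. field. lra. Qed.

Lemma speed_positive kappa v s c : 0 < kappa -> 0 < v ->
  0 < speed f A d kappa v s c <-> v < quot f d (clamp s) (clamp c).
Proof.
  intros Hk Hv. rewrite speed_eq. assert (W := weight_positive kappa v s c Hk Hv).
  assert (U := clamp_unit s). rewrite quot_gap by lra. split; intros Q.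
  - apply Rnot_le_lt. intros N.
    assert ((quot f d (clamp s) (clamp c) - v) * (clamp s + d) <= 0) by nra. nra.
  - apply Rmult_lt_0_compat; auto. apply Rmult_lt_0_compat; lra.
Qed.

Lemma speed_nonpositive kappa v s c : 0 < kappa -> 0 < v ->
  speed f A d kappa v s c <= 0 <-> quot f d (clamp s) (clamp c) <= v.
Proof.
  intros Hk Hv. assert (Q := speed_positive kappa v s c Hk Hv). split; intros.
  - apply Rnot_lt_le. intros N. apply Q in N. lra.
  - apply Rnot_lt_le. intros N. apply Q in N. lra.
Qed.

Lemma speed_root kappa v s c : 0 < kappa -> 0 < v ->
  speed f A d kappa v s c = 0 -> quot f d (clamp s) (clamp c) = v.
Proof.
  intros Hk Hv E. rewrite speed_eq in E. assert (W := weight_positive kappa v s c Hk Hv).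
  assert (U := clamp_unit s). rewrite quot_gap in E by lra.
  apply Rmult_integral in E. destruct E as [E|E]; [lra|].
  apply Rmult_integral in E. lra.
Qed.

Lemma speed_nonnegative kappa v s c : 0 < kappa -> 0 < v ->
  v <= quot f d (clamp s) (clamp c) -> 0 <= speed f A d kappa v s c.
Proof.
  intros Hk Hv Q. rewrite speed_eq. assert (W := weight_positive kappa v s c Hk Hv).
  assert (U := clamp_unit s). rewrite quot_gap by lra.
  apply Rmult_le_pos; [lra|]. apply Rmult_le_pos; lra.
Qed.

(** Division by A destroys the Lipschitz property in s, but A affects only a positive weight bounded
    by W. The remaining factor f - v (s + d) is Lipschitz in s, so its sign at b bounds it on one
    side at s, and the weight preserves such a bound. *)
Lemma speed_field kappa V : 0 < kappa -> 0 < V -> exists M L, forall v, 0 < v <= V ->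
  field (speed f A d kappa v) M L.
Proof.
  intros Hk HV. destruct (fs_bounded f fs fc fss HF) as [B [HB KB]].
  assert (Lip : forall b s c, Rabs (f (clamp s) (clamp c) - f (clamp b) (clamp c)) <= B * Rabs (s - b)).
  { assert (P : forall x y c, 0 <= x -> x < y -> y <= 1 -> 0 <= c <= 1 ->
      Rabs (f y c - f x c) <= B * Rabs (y - x)).
    { intros x y c Hx Hxy Hy Hc.
      destruct (MVT_unit (fun s => f s c) (fun s => fs s c) x y) as [z [Hz E]]; auto.
      { apply (flux_D_in f fs fc fss HF); auto. }
      rewrite E, Rabs_mult. apply Rmult_le_compat_r; [apply Rabs_pos|]. apply KB; lra. }
    intros b s c. apply Rle_trans with (B * Rabs (clamp s - clamp b)).
    - assert (U1 := clamp_unit b). assert (U2 := clamp_unit s). assert (U3 := clamp_unit c).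
      destruct (Rtotal_order (clamp b) (clamp s)) as [L|[->|L]].
      + apply P; lra.
      + rewrite !Rminus_diag, Rabs_R0; lra.
      + rewrite Rabs_minus_sym, (Rabs_minus_sym (clamp s)). apply P; lra.
    - apply Rmult_le_compat_l; [lra|apply clamp_lip]. }
  set (W := kappa * d * V / Amin).
  assert (HW : 0 < W) by (apply Rdiv_lt_0_compat; auto; repeat apply Rmult_lt_0_compat; auto).
  assert (Wle : forall v s c, 0 < v <= V ->
    kappa * d * v / A (clamp s) (clamp c) <= W).
  { intros v s c Hv. assert (Q := A_clamp s c). unfold W, Rdiv.
    assert (0 < kappa * d) by (apply Rmult_lt_0_compat; auto).
    apply Rmult_le_compat.
    - apply Rmult_le_pos; lra.
    - left; apply Rinv_0_lt_compat; lra.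
    - apply Rmult_le_compat_l; lra.
    - apply Rinv_le_contravar; lra. }
  exists (W * (B + V)), (W * (1 + V * (1 + d))). intros v Hv. split.
  - apply square_uc.
    assert (C1 : continuous_on_square (fun s c => f s c - v * (s + d))).
    { apply (square_plus f (fun s c => - (v * (s + d)))); [apply (flux_C1 _ _ _ _ HF)|].
      apply (square_of_continuous (fun p => - (v * (fst p + d)))). intros p.
      apply (continuous_opp (fun p : R * R => v * (fst p + d))).
      apply (continuous_scal_r v (fun p : R * R => fst p + d)).
      apply (continuous_plus (fun p : R * R => fst p) (fun _ => d)).
      - apply continuous_fst.
      - apply continuous_const. }
    assert (C2 : continuous_on_square (fun s c => kappa * d * v)).
    { apply (square_of_continuous (fun p => kappa * d * v)). intros p; apply continuous_const. }
    unfold raw_speed, Rdiv. apply square_mult.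
    + apply (square_mult (fun _ _ => kappa * d * v) _ C2 C1).
    + apply square_inv; auto. intros s c Us Uc. specialize (HAb s c Us Uc). lra.
  - intros s c. rewrite speed_eq, Rabs_mult.
    assert (W0 := weight_positive kappa v s c Hk ltac:(lra)). rewrite Rabs_pos_eq by lra.
    assert (U1 := clamp_unit s). assert (U2 := clamp_unit c).
    assert (R1 := flux_range f fs fc fss HF (clamp s) (clamp c) U1 U2).
    assert (W1 := Wle v s c Hv).
    apply Rmult_le_compat; try lra; [apply Rabs_pos|].
    assert (0 <= v * (clamp s + d) <= V * (1 + d)).
    { split; [apply Rmult_le_pos; lra|apply Rmult_le_compat; lra]. }
    apply Rabs_le. lra.
  - intros b s c Hc Hb.
    assert (W0 := weight_positive kappa v s c Hk ltac:(lra)).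
    assert (W1 := Wle v s c Hv).
    apply speed_nonpositive in Hb; try lra.
    assert (U1 := clamp_unit b).
    assert (F0 : f (clamp b) (clamp c) - v * (clamp b + d) <= 0) by (rewrite quot_gap by lra; nra).
    assert (L1 := Lip b s c). apply Rabs_le_between in L1.
    assert (L2 := clamp_lip b s). apply Rabs_le_between in L2.
    rewrite speed_eq. assert (P := Rabs_pos (s - b)).
    assert (Q : f (clamp s) (clamp c) - v * (clamp s + d) <= (B + V) * Rabs (s - b)).
    { assert (v * (clamp b - clamp s) <= V * Rabs (s - b)) by nra. nra. }
    rewrite (Rmult_assoc W).
    apply Rle_trans with (kappa * d * v / A (clamp s) (clamp c) * ((B + V) * Rabs (s - b))).
    + apply Rmult_le_compat_l; lra.
    + apply Rmult_le_compat_r; [|lra]. apply Rmult_le_pos; lra.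
  - intros b s c Hc Hb.
    assert (W0 := weight_positive kappa v s c Hk ltac:(lra)).
    assert (Wb := weight_positive kappa v b c Hk ltac:(lra)).
    assert (W1 := Wle v s c Hv).
    assert (F0 : 0 <= f (clamp b) (clamp c) - v * (clamp b + d)).
    { rewrite speed_eq in Hb. apply Rnot_lt_le. intros N. nra. }
    assert (L1 := Lip b s c). apply Rabs_le_between in L1.
    assert (L2 := clamp_lip b s). apply Rabs_le_between in L2.
    rewrite speed_eq. assert (P := Rabs_pos (s - b)).
    assert (Q : - ((B + V) * Rabs (s - b)) <= f (clamp s) (clamp c) - v * (clamp s + d)).
    { assert (v * (clamp s - clamp b) <= V * Rabs (s - b)) by nra. nra. }
    rewrite (Rmult_assoc W).
    assert (kappa * d * v / A (clamp s) (clamp c) * (- ((B + V) * Rabs (s - b))) <=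
      kappa * d * v / A (clamp s) (clamp c) * (f (clamp s) (clamp c) - v * (clamp s + d))).
    { apply Rmult_le_compat_l; lra. }
    assert (kappa * d * v / A (clamp s) (clamp c) * ((B + V) * Rabs (s - b)) <=
      W * ((B + V) * Rabs (s - b))).
    { apply Rmult_le_compat_r; [|lra]. apply Rmult_le_pos; lra. }
    lra.
Qed.

Lemma speed_lipschitz_v kappa V : 0 < kappa -> 0 < V -> exists K, 0 < K /\ forall v v' s c,
  0 < v <= V -> 0 < v' <= V ->
  Rabs (speed f A d kappa v' s c - speed f A d kappa v s c) <= K * Rabs (v' - v).
Proof.
  intros Hk HV. exists (kappa * d / Amin * (1 + 2 * V * (1 + d))).
  assert (HW : 0 < kappa * d / Amin).
  { apply Rdiv_lt_0_compat; auto. apply Rmult_lt_0_compat; auto. }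
  split. { apply Rmult_lt_0_compat; auto. assert (0 < V * (1 + d)) by (apply Rmult_lt_0_compat; lra). lra. }
  intros v v' s c Hv Hv'. rewrite !speed_eq.
  assert (Q := A_clamp s c). assert (U1 := clamp_unit s). assert (U2 := clamp_unit c).
  assert (R1 := flux_range f fs fc fss HF (clamp s) (clamp c) U1 U2).
  set (x := f (clamp s) (clamp c)) in *. set (a := A (clamp s) (clamp c)) in *.
  set (z := clamp s) in *.
  replace (kappa * d * v' / a * (x - v' * (z + d)) - kappa * d * v / a * (x - v * (z + d)))
    with (kappa * d / a * ((x - (v' + v) * (z + d)) * (v' - v))) by (field; lra).
  rewrite !Rabs_mult, Rmult_assoc.
  assert (P := Rabs_pos (v' - v)).
  apply Rmult_le_compat; try apply Rabs_pos.
  - apply Rmult_le_pos; apply Rabs_pos.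
  - rewrite Rabs_pos_eq.
    + unfold Rdiv. apply Rmult_le_compat_l; [apply Rmult_le_pos; lra|].
      apply Rinv_le_contravar; lra.
    + apply Rmult_le_pos; [apply Rmult_le_pos; lra|]. left; apply Rinv_0_lt_compat; lra.
  - apply Rmult_le_compat_r; auto.
    assert (0 <= (v' + v) * (z + d) <= 2 * V * (1 + d)).
    { split; [apply Rmult_le_pos; lra|]. apply Rmult_le_compat; lra. }
    apply Rabs_le. lra.
Qed.

Variables (sb cb vm s0 s1 : R).
Hypotheses (Hsb : 0 < sb < 1) (Hcb : 0 < cb < 1)
  (Hrow : forall c, 0 <= c <= 1 -> vm <= quot f d sb c)
  (Hcol : forall s, 0 <= s <= 1 -> quot f d s cb <= vm)
  (Hsb0 : vm < quot f d sb 0) (Hsb1 : vm < quot f d sb 1) (Hvm : 1 / (1 + d) < vm)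
  (Hp0 : peak f d 0 s0) (Hp1 : peak f d 1 s1).

Lemma vm_positive : 0 < vm.
Proof. assert (0 < 1 / (1 + d)) by (apply Rdiv_lt_0_compat; lra). lra. Qed.

(* Above the level vm the valley c |-> f s c has been left behind on the way from cb to c. *)
Lemma quot_persistent s c c' : 0 <= s <= 1 -> 0 <= c' <= 1 ->
  cb <= c <= c' \/ c' <= c <= cb -> vm < quot f d s c -> quot f d s c <= quot f d s c'.
Proof.
  intros Hs Hc' Hcc Q. assert (Q0 := Hcol s Hs).
  assert (Hc : f s cb < f s c).
  { apply Rnot_le_lt. intros N. assert (X := quot_le f d s c cb ltac:(lra) N). lra. }
  destruct (Req_dec c c') as [->|]; [lra|].
  assert (c <> cb) by (intros ->; lra).
  apply quot_le; [lra|].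
  destruct (valley_min f fs fc fss HF s Hs) as [cs [Hcs [Min V]]].
  destruct (Req_dec s 0) as [->|]. { rewrite !(flux_0 _ _ _ _ HF) by (red; lra). lra. }
  destruct (Req_dec s 1) as [->|]. { rewrite !(flux_1 _ _ _ _ HF) by (red; lra). lra. }
  destruct (V ltac:(lra)) as [D I].
  destruct Hcc as [Hcc|Hcc]; destruct (Rle_lt_dec c cs) as [L|L].
  - assert (f s c < f s cb) by (apply D; lra). lra.
  - left; apply I; lra.
  - left; apply D; lra.
  - assert (f s c < f s cb) by (apply I; lra). lra.
Qed.

Lemma quot_at_0 c : unit_interval c -> quot f d 0 c = 0.
Proof. intros Hc. unfold quot. rewrite (flux_0 _ _ _ _ HF) by auto. unfold Rdiv; ring. Qed.

Lemma quot_at_1 c : unit_interval c -> quot f d 1 c = 1 / (1 + d).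
Proof. intros Hc. unfold quot. rewrite (flux_1 _ _ _ _ HF) by auto. reflexivity. Qed.

Lemma vm_below_peaks : vm < quot f d s1 1 /\ vm < quot f d s0 0.
Proof.
  assert (P : forall c sT, peak f d c sT -> vm < quot f d sb c -> vm < quot f d sT c).
  { intros c sT [HT [Up Dn]] Q. destruct (Rtotal_order sb sT) as [L|[<-|L]]; auto.
    - assert (X := Up sb sT). lra.
    - assert (X := Dn sT sb). lra. }
  split; apply P; auto.
Qed.

Lemma left_branch kappa : 0 < kappa ->
  branch (speed f A d kappa) cb vm s1 (fun s => quot f d s 1).
Proof.
  intros Hk. assert (V0 := vm_positive). destruct Hp1 as [HT [Up Dn]].
  split; auto; try apply vm_below_peaks.
  - intros V HV. apply speed_field; auto.
  - intros V HV. apply speed_lipschitz_v; auto.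
  - intros v Hv s c c' H1 H2 H3 P. apply speed_positive in P; try lra. apply speed_positive; try lra.
    rewrite (clamp_id c) in P by lra. rewrite (clamp_id c') by lra.
    assert (Q := quot_persistent (clamp s) c c' (clamp_unit s)). lra.
  - intros v s Hv. rewrite speed_positive by lra. rewrite (clamp_id 1) by lra. reflexivity.
  - intros v s Hv E. apply speed_root in E; try lra. rewrite (clamp_id 1) in E by lra. exact E.
  - destruct (quot_lipschitz f fs fc fss HF d Hd) as [K [HK P]]. exists K. split; auto.
    intros x y Hx Hy. apply P; lra.
  - rewrite quot_at_1 by (red; lra). lra.
Qed.

(** The reflection turns the rising part of the quotient at c = 0, which carries the lower root,
    into the falling part required by [branch]. *)
Lemma right_branch kappa : 0 < kappa ->
  branch (fun v => refl_field (speed f A d kappa v)) (1 - cb) vm (1 - s0)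
    (fun s => quot f d (1 - s) 0).
Proof.
  intros Hk. assert (V0 := vm_positive). destruct Hp0 as [HT [Up Dn]].
  assert (E1 : forall v s, refl_field (speed f A d kappa v) s 1 = speed f A d kappa v (1 - s) 0).
  { intros v s. unfold refl_field. replace (1 - 1) with 0 by ring. reflexivity. }
  split; auto; try lra.
  - intros V HV. destruct (speed_field kappa V Hk HV) as [M [L P]]. exists M, L. intros v Hv.
    apply refl_field_field; auto.
  - intros V HV. destruct (speed_lipschitz_v kappa V Hk HV) as [K [HK P]]. exists K. split; auto.
    intros v v' s c Hv Hv'. apply P; auto.
  - intros v Hv s c c' H1 H2 H3 P. unfold refl_field in *.
    apply speed_positive in P; try lra. apply speed_positive; try lra.
    rewrite (clamp_id (1 - c)) in P by lra. rewrite (clamp_id (1 - c')) by lra.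
    assert (Q := quot_persistent (clamp (1 - s)) (1 - c) (1 - c') (clamp_unit (1 - s))). lra.
  - intros v s Hv. rewrite E1, speed_positive, clamp_opp, (clamp_id 0) by lra. reflexivity.
  - intros v s Hv E. rewrite E1 in E. apply speed_root in E; try lra.
    rewrite clamp_opp, (clamp_id 0) in E by lra. exact E.
  - intros x y Hx Hxy Hy. apply Dn; lra.
  - intros x y Hx Hxy Hy. apply Up; lra.
  - destruct (quot_lipschitz f fs fc fss HF d Hd) as [K [HK P]]. exists K. split; auto.
    intros x y Hx Hy. replace (y - x) with (- ((1 - y) - (1 - x))) by ring. rewrite Rabs_Ropp.
    apply P; lra.
  - replace (1 - 1) with 0 by ring. rewrite quot_at_0 by (red; lra). lra.
  - replace (1 - (1 - s0)) with s0 by ring. apply vm_below_peaks.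
Qed.

(** On the falling side of the quotient fs <= v, on the rising side fs >= v. These are the
    inequalities that compatibility imposes at the left and the right end of the shock. *)
Definition top : R -> R -> Prop := root (fun s => quot f d s 1) s1.
Definition bottom (v r : R) : Prop := 0 <= r <= s0 /\ quot f d r 0 = v.

Lemma bottom_root v r : bottom v r <-> root (fun s => quot f d (1 - s) 0) (1 - s0) v (1 - r).
Proof.
  unfold bottom, root. replace (1 - (1 - r)) with r by ring.
  split; intros [H1 H2]; split; auto; lra.
Qed.

Lemma bottom_inside v r : vm <= v -> bottom v r -> 0 < r < 1.
Proof.
  intros Hv Hr. apply bottom_root in Hr.
  assert (Q := root_inside _ _ _ _ _ (right_branch 1 Rlt_0_1) v _ Hv Hr). lra.
Qed.

Lemma bottom_increasing v v' r r' : v < v' -> bottom v r -> bottom v' r' -> r < r'.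
Proof.
  intros Hv Hr Hr'. apply bottom_root in Hr. apply bottom_root in Hr'.
  assert (Q := root_decreasing _ _ _ _ _ (right_branch 1 Rlt_0_1) v v' _ _ Hv Hr Hr'). lra.
Qed.

Lemma bottom_unique v r r' : bottom v r -> bottom v r' -> r = r'.
Proof.
  intros Hr Hr'. apply bottom_root in Hr. apply bottom_root in Hr'.
  assert (Q := root_unique _ _ _ _ _ (right_branch 1 Rlt_0_1) v _ _ Hr Hr'). lra.
Qed.

Lemma top_inside v p : vm <= v -> top v p -> 0 < p < 1.
Proof. exact (root_inside _ _ _ _ _ (left_branch 1 Rlt_0_1) v p). Qed.

Lemma top_decreasing v v' p p' : v < v' -> top v p -> top v' p' -> p' < p.
Proof. exact (root_decreasing _ _ _ _ _ (left_branch 1 Rlt_0_1) v v' p p'). Qed.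

Lemma top_unique v p p' : top v p -> top v p' -> p = p'.
Proof. exact (root_unique _ _ _ _ _ (left_branch 1 Rlt_0_1) v p p'). Qed.

Lemma top_le_peak v p : top v p -> v <= quot f d s1 1.
Proof. exact (root_le_peak _ _ _ _ _ (left_branch 1 Rlt_0_1) v p). Qed.

Variable C : R -> R.
Hypothesis HC : clock C cb.

Definition left_sol (kappa : R) : R -> (R -> R) -> Prop :=
  departs (speed f A d kappa) (fun s => quot f d s 1) s1 C.

Definition right_sol (kappa v : R) (y : R -> R) : Prop :=
  departs (fun v => refl_field (speed f A d kappa v)) (fun s => quot f d (1 - s) 0) (1 - s0)
    (refl C) v (refl y).

Lemma right_sol_iff kappa v y : right_sol kappa v y <->
  orbit (speed f A d kappa v) C y /\ exists r, bottom v r /\ tends_right y r.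
Proof.
  unfold right_sol, departs. split.
  - intros [Y [p [Hp Lp]]]. apply refl_orbit_inv in Y. apply refl_tends_right in Lp.
    rewrite refl_involutive in Y, Lp. split; auto. exists (1 - p). split; auto.
    apply bottom_root. replace (1 - (1 - p)) with p by ring. exact Hp.
  - intros [Y [r [Hr Rr]]]. split; [apply refl_orbit, Y|]. exists (1 - r).
    split; [apply bottom_root, Hr|apply refl_tends_left, Rr].
Qed.

Lemma left_sol_facts kappa v y p : 0 < kappa -> vm <= v -> orbit (speed f A d kappa v) C y ->
  top v p -> tends_left y p -> forall t, t <= 0 -> speed f A d kappa v (y t) (C t) <= 0 /\ y t <= p.
Proof. intros Hk. apply (departs_facts _ cb vm s1 _ C (left_branch kappa Hk) HC). Qed.

Lemma right_sol_facts kappa v y r : 0 < kappa -> vm <= v -> orbit (speed f A d kappa v) C y ->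
  bottom v r -> tends_right y r -> forall t, 0 <= t -> speed f A d kappa v (y t) (C t) <= 0 /\ r <= y t.
Proof.
  intros Hk Hv Y Hr Rr t Ht.
  destruct (departs_facts _ _ vm _ _ _ (right_branch kappa Hk) (refl_clock C cb HC) v (refl y) (1 - r)
    Hv (refl_orbit _ _ _ Y) (proj1 (bottom_root v r) Hr) (refl_tends_left _ _ Rr) (- t)) as [Q1 Q2].
  { lra. }
  unfold refl_field, refl in Q1, Q2. rewrite Ropp_involutive in Q1, Q2.
  replace (1 - (1 - y t)) with (y t) in Q1 by ring.
  replace (1 - (1 - C t)) with (C t) in Q1 by ring. split; [exact Q1|lra].
Qed.

Lemma exists_left_sol kappa v : 0 < kappa -> vm <= v < quot f d s1 1 -> exists y, left_sol kappa v y.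
Proof. intros Hk. apply (exists_departing _ cb vm s1 _ C (left_branch kappa Hk) HC). Qed.

Lemma exists_right_sol kappa v : 0 < kappa -> vm <= v < quot f d s0 0 -> exists y, right_sol kappa v y.
Proof.
  intros Hk Hv.
  destruct (exists_departing _ _ vm _ _ _ (right_branch kappa Hk) (refl_clock C cb HC) v) as [w Hw].
  { replace (1 - (1 - s0)) with s0 by ring. exact Hv. }
  exists (refl w). unfold right_sol. rewrite refl_involutive. exact Hw.
Qed.

Lemma sb_below_top p : top vm p -> sb < p.
Proof.
  intros [Hp E]. destruct Hp1 as [HT [_ Dn]]. apply Rnot_le_lt. intros N.
  destruct (Req_dec p sb) as [E'|]; [rewrite E' in E; lra|].
  assert (Q := Dn p sb ltac:(lra) ltac:(lra) ltac:(lra)). lra.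
Qed.

Lemma sb_above_bottom r : bottom vm r -> r < sb.
Proof.
  intros [Hp E]. destruct Hp0 as [HT [Up _]]. apply Rnot_le_lt. intros N.
  destruct (Req_dec r sb) as [E'|]; [rewrite E' in E; lra|].
  assert (Q := Up sb r ltac:(lra) ltac:(lra) ltac:(lra)). lra.
Qed.

Lemma speed_at_saddle_row kappa c : 0 < kappa -> 0 <= speed f A d kappa vm sb c.
Proof.
  intros Hk. apply speed_nonnegative; auto; [apply vm_positive|]. rewrite (clamp_id sb) by lra.
  apply Hrow, clamp_unit.
Qed.

(** At v = vm the field is nonnegative along the whole row s = sb, by the saddle property, and the
    left root lies above this row. *)
Lemma left_sol_above_saddle kappa y : 0 < kappa -> left_sol kappa vm y -> forall t, sb <= y t.
Proof.
  intros Hk [Y [p [Hp Lp]]] t. assert (V0 := vm_positive).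
  destruct (speed_field kappa vm Hk V0) as [M [L HG]].
  apply (lower_from_left _ M L cb C y p sb t (HG vm ltac:(lra)) HC Y Lp (sb_below_top p Hp)).
  intros r _. apply speed_at_saddle_row, Hk.
Qed.

Lemma right_sol_below_saddle kappa y : 0 < kappa -> right_sol kappa vm y -> forall t, y t <= sb.
Proof.
  intros Hk HR t. apply right_sol_iff in HR. destruct HR as [Y [r [Hr Rr]]].
  assert (V0 := vm_positive). destruct (speed_field kappa vm Hk V0) as [M [L HG]].
  assert (Q : 1 - sb <= refl y (- t)).
  { apply (lower_from_left _ M L (1 - cb) (refl C) (refl y) (1 - r) (1 - sb) (- t)
      (refl_field_field _ _ _ (HG vm ltac:(lra))) (refl_clock C cb HC) (refl_orbit _ _ _ Y)
      (refl_tends_left _ _ Rr)).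
    - assert (Q := sb_above_bottom r Hr). lra.
    - intros q _. unfold refl_field. replace (1 - (1 - sb)) with sb by ring.
      apply speed_at_saddle_row, Hk. }
  unfold refl in Q. rewrite Ropp_involutive in Q. lra.
Qed.

Definition connection (kappa v p r : R) (y : R -> R) : Prop :=
  orbit (speed f A d kappa v) C y /\ top v p /\ bottom v r /\ tends_left y p /\ tends_right y r.

Lemma connection_of_sols kappa v y : left_sol kappa v y -> right_sol kappa v y ->
  exists p r, connection kappa v p r y.
Proof.
  intros [Y [p [Hp Lp]]] HR. apply right_sol_iff in HR. destruct HR as [_ [r [Hr Rr]]].
  exists p, r. unfold connection. tauto.
Qed.

Lemma no_connection_at_saddle kappa p r y : 0 < kappa -> ~ connection kappa vm p r y.
Proof.
  intros Hk [Y [Hp [Hr [Lp Rr]]]].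
  assert (Q := left_sol_above_saddle kappa y Hk (conj Y (ex_intro _ p (conj Hp Lp)))).
  assert (Q2 := sb_above_bottom r Hr).
  destruct (Rr (sb - r) ltac:(lra)) as [T K]. specialize (K T ltac:(lra)). specialize (Q T).
  apply Rabs_def2 in K. lra.
Qed.

Lemma seq_to_squeeze vn v : (forall n, Rabs (vn n - v) <= / INR (S n)) -> seq_to vn v.
Proof.
  intros P e He. destruct (INR_unbounded (/ e)) as [N HN]. exists N. intros n Hn.
  eapply Rle_lt_trans; [apply P|]. rewrite <- (Rinv_inv e).
  assert (0 < / e) by (apply Rinv_0_lt_compat; auto).
  assert (INR N <= INR n) by (apply le_INR; lia).
  apply Rinv_lt_contravar; [|rewrite S_INR; lra].
  apply Rmult_lt_0_compat; [lra|apply lt_0_INR; lia].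
Qed.

Lemma exists_connection kappa : 0 < kappa -> exists v p r y, vm < v /\ connection kappa v p r y.
Proof.
  intros Hk. assert (V0 := vm_positive). assert (VP := vm_below_peaks).
  (* Both end roots exist exactly up to the smaller of the two maxima. *)
  set (vt := Rmin (quot f d s1 1) (quot f d s0 0)).
  assert (Ht1 : vt <= quot f d s1 1) by apply Rmin_l.
  assert (Ht0 : vt <= quot f d s0 0) by apply Rmin_r.
  assert (Hvt : vm < vt) by (apply Rmin_glb_lt; apply VP).
  assert (Main : exists v y, vm <= v /\ left_sol kappa v y /\ right_sol kappa v y).
  2: { destruct Main as [v [y [Hv [HL HR]]]].
    destruct (connection_of_sols kappa v y HL HR) as [p [r Hc]].
    exists v, p, r, y. split; auto. destruct (Req_dec vm v) as [E|]; [|lra].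
    subst v. elim (no_connection_at_saddle kappa p r y Hk Hc). }
  set (E := fun v => vm <= v < vt /\ exists Y Z, left_sol kappa v Y /\ right_sol kappa v Z /\ Z 0 <= Y 0).
  assert (Evm : E vm).
  { split; [lra|].
    destruct (exists_left_sol kappa vm Hk ltac:(lra)) as [Y HY].
    destruct (exists_right_sol kappa vm Hk ltac:(lra)) as [Z HZ].
    exists Y, Z. split; auto. split; auto.
    assert (Q1 := left_sol_above_saddle kappa Y Hk HY 0).
    assert (Q2 := right_sol_below_saddle kappa Z Hk HZ 0). lra. }
  destruct (completeness E) as [v0 [Ub Lub]].
  { exists vt. intros v [Hv _]. lra. }
  { exists vm. exact Evm. }
  assert (Hv0 : vm <= v0) by (apply Ub, Evm).
  assert (Hv0t : v0 <= vt) by (apply Lub; intros v [Hv _]; lra).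
  (* The supremum v0 keeps the order: along velocities in the set tending to v0, the upper limit of
     the departing orbits lies above the lower limit of the arriving ones. The latter is an upper
     limit after reflection. *)
  assert (Upper : exists Y Z, left_sol kappa v0 Y /\ right_sol kappa v0 Z /\ Z 0 <= Y 0).
  { assert (Sq : forall n : nat, exists x : R * ((R -> R) * (R -> R)),
      vm <= fst x /\ v0 - / INR (S n) < fst x <= v0 /\
      left_sol kappa (fst x) (fst (snd x)) /\ right_sol kappa (fst x) (snd (snd x)) /\
      snd (snd x) 0 <= fst (snd x) 0).
    { intros n. assert (Hn : 0 < / INR (S n)) by (apply Rinv_0_lt_compat, lt_0_INR; lia).
      destruct (classic (exists v, E v /\ v0 - / INR (S n) < v)) as [[v [Ev Hv]]|N].
      - assert (v <= v0) by (apply Ub, Ev). destruct Ev as [Hv' [Y [Z [HY [HZ HYZ]]]]].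
        exists (v, (Y, Z)). simpl. repeat split; auto; try lra; apply HY || apply HZ.
      - assert (v0 <= v0 - / INR (S n)); [|lra]. apply Lub. intros v Ev.
        apply Rnot_lt_le. intros L. apply N. eauto. }
    destruct (functional_choice _ Sq) as [x Hx].
    assert (Sv : seq_to (fun n => fst (x n)) v0).
    { apply seq_to_squeeze. intros n. destruct (Hx n) as [_ [H1 _]]. apply Rabs_le. lra. }
    (* These bounds at time 0 serve the case in which v0 = vt and an end root is double. *)
    assert (Bn : forall n, 0 <= snd (snd (x n)) 0 /\ fst (snd (x n)) 0 <= 1).
    { intros n. destruct (Hx n) as [H1 [_ [[HY [p [Hp Lp]]] [HR _]]]].
      apply right_sol_iff in HR. destruct HR as [HZ [r [Hr Rr]]].
      assert (Q1 := left_sol_facts kappa _ _ p Hk H1 HY Hp Lp 0 ltac:(lra)).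
      assert (Q2 := right_sol_facts kappa _ _ r Hk H1 HZ Hr Rr 0 ltac:(lra)).
      destruct Hp as [Hp _]. destruct Hr as [Hr _]. lra. }
    destruct (departing_closure _ _ _ _ _ _ (left_branch kappa Hk) HC (fun n => fst (x n)) v0
      (fun n => fst (snd (x n)))) as [[Y [HY LY]] _]; auto; try lra.
    { intros n; apply Hx. } { intros n; apply Hx. }
    { right. intros n. destruct (Hx n) as [_ [_ [_ [_ Q]]]]. destruct (Bn n). lra. }
    destruct (departing_closure _ _ _ _ _ _ (right_branch kappa Hk) (refl_clock C cb HC)
      (fun n => fst (x n)) v0 (fun n => refl (snd (snd (x n))))) as [[w [HZ LZ]] _]; auto.
    { replace (1 - (1 - s0)) with s0 by ring. lra. }
    { intros n; apply Hx. } { intros n; apply Hx. }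
    { right. intros n. rewrite refl_0. destruct (Hx n) as [_ [_ [_ [_ Q]]]]. destruct (Bn n). lra. }
    exists Y, (refl w). split; [exact HY|]. unfold right_sol. rewrite refl_involutive.
    split; [exact HZ|]. rewrite refl_0.
    apply Rnot_lt_le. intros L. set (e := (1 - w 0 - Y 0) / 3).
    destruct (LY (mkposreal e ltac:(unfold e; lra))) as [_ [N1 K1]].
    destruct (LZ (mkposreal e ltac:(unfold e; lra))) as [_ [N2 K2]]. simpl in K1, K2.
    specialize (K1 (N1 + N2)%nat ltac:(lia)). specialize (K2 (N1 + N2)%nat ltac:(lia)).
    rewrite refl_0 in K2.
    destruct (Hx (N1 + N2)%nat) as [_ [_ [_ [_ Q]]]]. unfold e in *. lra. }
  destruct Upper as [Y [Z [HY [HZ HYZ]]]].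
  destruct (Rlt_le_dec v0 vt) as [Lt|Ge].
  (* Velocities strictly between v0 and vt, within 1/(n+1) of v0. They lie outside the set, so every
     pair of orbits there has the reversed order, and in the limit both orders are available at
     v0. *)
  - set (w := fun n : nat => v0 + (vt - v0) / 2 * Rmin 1 (/ INR (S n) / (vt - v0))).
    assert (Hw : forall n, v0 < w n < vt /\ Rabs (w n - v0) <= / INR (S n)).
    { intros n. assert (Hn : 0 < / INR (S n)) by (apply Rinv_0_lt_compat, lt_0_INR; lia).
      unfold w. set (z := / INR (S n)) in *.
      assert (H1 : 0 < z / (vt - v0)) by (apply Rdiv_lt_0_compat; lra).
      assert (H2 : 0 < Rmin 1 (z / (vt - v0))) by (apply Rmin_pos; lra).
      assert (H3 := Rmin_l 1 (z / (vt - v0))). assert (H4 := Rmin_r 1 (z / (vt - v0))).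
      set (y := Rmin 1 (z / (vt - v0))) in *.
      assert (H5 : y * (vt - v0) <= z).
      { replace z with (z / (vt - v0) * (vt - v0)) by (field; lra).
        apply Rmult_le_compat_r; lra. }
      split; [nra|]. rewrite Rabs_pos_eq by nra. nra. }
    destruct (functional_choice (fun n y => left_sol kappa (w n) y)) as [Yn HYn].
    { intros n. destruct (Hw n). apply exists_left_sol; auto; lra. }
    destruct (functional_choice (fun n y => right_sol kappa (w n) y)) as [Zn HZn].
    { intros n. destruct (Hw n). apply exists_right_sol; auto; lra. }
    assert (Ord : forall n, Yn n 0 < Zn n 0).
    { intros n. apply Rnot_le_lt. intros N. destruct (Hw n) as [H1 _].
      assert (w n <= v0); [|lra]. apply Ub. split; [lra|]. exists (Yn n), (Zn n). auto. }
    assert (Sw : seq_to w v0) by (apply seq_to_squeeze; intros n; apply Hw).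
    destruct (departing_closure _ _ _ _ _ _ (left_branch kappa Hk) HC w v0 Yn)
      as [_ [Y' [HY' LY']]]; auto; try lra.
    { intros n; destruct (Hw n); lra. }
    destruct (departing_closure _ _ _ _ _ _ (right_branch kappa Hk) (refl_clock C cb HC) w v0
      (fun n => refl (Zn n))) as [_ [z [HZ' LZ']]]; auto.
    { replace (1 - (1 - s0)) with s0 by ring. lra. }
    { intros n; destruct (Hw n); lra. }
    { left. replace (1 - (1 - s0)) with s0 by ring. lra. }
    assert (Low : Y' 0 <= refl z 0).
    { rewrite refl_0. apply Rnot_lt_le. intros L. set (e := (Y' 0 - (1 - z 0)) / 3).
      destruct (LY' (mkposreal e ltac:(unfold e; lra))) as [_ [N1 K1]].
      destruct (LZ' (mkposreal e ltac:(unfold e; lra))) as [_ [N2 K2]]. simpl in K1, K2.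
      specialize (K1 (N1 + N2)%nat ltac:(lia)). specialize (K2 (N1 + N2)%nat ltac:(lia)).
      rewrite refl_0 in K2. specialize (Ord (N1 + N2)%nat). unfold e in *. lra. }
    assert (HR' : right_sol kappa v0 (refl z)) by (unfold right_sol; rewrite refl_involutive; exact HZ').
    apply right_sol_iff in HZ. apply right_sol_iff in HR'.
    destruct HY as [OY [p [Hp Lp]]]. destruct HZ as [OZ [r [Hr Rr]]].
    destruct HY' as [OY' [p' [Hp' Lp']]]. destruct HR' as [OZ' [r' [Hr' Rr']]].
    rewrite <- (top_unique v0 p p' Hp Hp') in Lp'.
    rewrite <- (bottom_unique v0 r r' Hr Hr') in Rr'.
    destruct (connect_pairs _ p r Y Z Y' (refl z) OY OZ OY' OZ' Lp Lp' Rr Rr' HYZ Low)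
      as [y [Oy [Ly Ry]]].
    exists v0, y. split; [lra|]. split; [split; eauto|]. apply right_sol_iff. eauto.
  (* At vt the end with the smaller maximum has a double root, and [saddle_node_connection] extends
     the orbit of the other end to it; for the right end this is done after reflection. *)
  - assert (Ev : v0 = vt) by lra. apply right_sol_iff in HZ.
    destruct HY as [OY [p [Hp Lp]]]. destruct HZ as [OZ [r [Hr Rr]]].
    destruct (speed_field kappa v0 Hk ltac:(lra)) as [M [L HG]].
    assert (Y1 := left_sol_facts kappa v0 Y p Hk Hv0 OY Hp Lp 0 ltac:(lra)).
    assert (Z0 := right_sol_facts kappa v0 Z r Hk Hv0 OZ Hr Rr 0 ltac:(lra)).
    assert (Up := proj1 Hp). assert (Ur := proj1 Hr).
    assert (HP := branch_persistent _ _ _ _ _ (left_branch kappa Hk) v0 Hv0).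
    assert (HPr := branch_persistent _ _ _ _ _ (right_branch kappa Hk) v0 Hv0).
    destruct (Rle_lt_dec (quot f d s1 1) (quot f d s0 0)) as [Le|Gt].
    + assert (E1 : v0 = quot f d s1 1) by (rewrite Ev; apply Rmin_left; auto).
      assert (p = s1) by (apply (top_unique v0); auto; split; [destruct Hp1; lra|auto]). subst p.
      destruct (saddle_node_connection _ M L cb C Y Z s1 (HG v0 ltac:(lra)) HC HP OY OZ Lp)
        as [y [Oy [Ly Ey]]]; try lra.
      * intros s Hs. apply (above_root _ _ _ _ _ (left_branch kappa Hk) v0 s1); auto; lra.
      * intros b c Hb. apply speed_nonpositive; auto; try lra. rewrite clamp_low by auto.
        rewrite quot_at_0 by apply clamp_unit. lra.
      * intros l Hl Q. apply speed_root in Q; try lra. rewrite !clamp_id in Q by lra.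
        destruct Hp1 as [_ [U1 _]]. assert (X := U1 l s1). lra.
      * exists v0, y. split; auto. split; [split; eauto|]. apply right_sol_iff. split; auto.
        exists r. split; auto. apply tends_right_ext with Z 0; auto. intros t Ht. symmetry; auto.
    + assert (E1 : v0 = quot f d s0 0) by (rewrite Ev; apply Rmin_right; lra).
      assert (r = s0) by (apply (bottom_unique v0); auto; split; [destruct Hp0; lra|auto]). subst r.
      destruct (saddle_node_connection _ M L (1 - cb) (refl C) (refl Z) (refl Y) (1 - s0)
        (refl_field_field _ _ _ (HG v0 ltac:(lra))) (refl_clock C cb HC) HPr
        (refl_orbit _ _ _ OZ) (refl_orbit _ _ _ OY) (refl_tends_left _ _ Rr)) as [y [Oy [Ly Ey]]].
      * intros s Hs. apply (above_root _ _ _ _ _ (right_branch kappa Hk) v0 (1 - s0)); auto; try lra.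
        apply bottom_root, Hr.
      * rewrite !refl_0. lra.
      * intros b c Hb. unfold refl_field. apply speed_nonpositive; auto; try lra.
        rewrite clamp_high by lra. rewrite quot_at_1 by apply clamp_unit. lra.
      * intros l Hl Q. apply (branch_zero _ _ _ _ _ (right_branch kappa Hk)) in Q; auto.
        rewrite clamp_id in Q by lra. destruct Hp0 as [_ [_ Dn]]. assert (X := Dn s0 (1 - l)). lra.
      * exists v0, (refl y). split; auto. apply refl_orbit_inv in Oy.
        split; [split; auto; exists p; split; auto|apply right_sol_iff; split; auto; exists s0; split; auto].
        -- apply tends_left_ext with Y 0; auto. intros t Ht. unfold refl at 1. rewrite Ey by lra.
           unfold refl. rewrite Ropp_involutive. ring.
        -- replace s0 with (1 - (1 - s0)) by ring. apply refl_tends_right, Ly.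
Qed.

Lemma connection_nonpositive kappa v p r y : 0 < kappa -> vm <= v -> connection kappa v p r y ->
  forall t, speed f A d kappa v (y t) (C t) <= 0.
Proof.
  intros Hk Hv [Y [Hp [Hr [Lp Rr]]]] t. destruct (Rle_lt_dec t 0).
  - apply (left_sol_facts kappa v y p); auto.
  - apply (right_sol_facts kappa v y r); auto; lra.
Qed.

Lemma connection_decreasing kappa v p r y : 0 < kappa -> vm <= v -> connection kappa v p r y ->
  forall t t', t <= t' -> y t' <= y t.
Proof.
  intros Hk Hv Hc t t' Ht. apply derive_nonincreasing with
    (g1 := fun t => speed f A d kappa v (y t) (C t)); auto.
  - intros z _. apply (proj1 Hc).
  - intros z _. apply (connection_nonpositive kappa v p r y Hk Hv Hc).
Qed.

Lemma connection_range kappa v p r y : 0 < kappa -> vm <= v -> connection kappa v p r y ->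
  forall t, r <= y t <= p.
Proof.
  intros Hk Hv Hc t. assert (Dec := connection_decreasing kappa v p r y Hk Hv Hc).
  destruct Hc as [Y [Hp [Hr [Lp Rr]]]]. split.
  - apply Rnot_lt_le. intros N. destruct (Rr (r - y t) ltac:(lra)) as [T K].
    specialize (K (Rmax T t) (Rmax_l _ _)). specialize (Dec t (Rmax T t) (Rmax_r _ _)).
    apply Rabs_def2 in K. lra.
  - apply Rnot_lt_le. intros N. destruct (Lp (y t - p) ltac:(lra)) as [T K].
    specialize (K (Rmin T t) (Rmin_l _ _)). specialize (Dec (Rmin T t) t (Rmin_r _ _)).
    apply Rabs_def2 in K. lra.
Qed.

(** The speed is (d / A) (kappa v) (f - v (s + d)). Raising v strictly lowers the last factor, and a
    larger kappa v enlarges a negative product in size; the nonpositive sign is essential. *)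
Lemma speed_compare kappa kappa' v v' s c : 0 < kappa -> vm <= v -> v < v' ->
  kappa * v <= kappa' * v' -> speed f A d kappa v s c <= 0 ->
  speed f A d kappa' v' s c < speed f A d kappa v s c.
Proof.
  intros Hk Hv Hvv Hkv N. assert (V0 := vm_positive). rewrite speed_eq in N. rewrite !speed_eq.
  assert (Q := A_clamp s c). assert (U := clamp_unit s).
  set (a := A (clamp s) (clamp c)) in *. set (x := f (clamp s) (clamp c)) in *.
  set (z := clamp s) in *.
  assert (HW : 0 < d / a) by (apply Rdiv_lt_0_compat; lra).
  assert (Hkv0 : 0 < kappa * v) by (apply Rmult_lt_0_compat; lra).
  replace (kappa * d * v / a) with (d / a * (kappa * v)) in * by (field; lra).
  replace (kappa' * d * v' / a) with (d / a * (kappa' * v')) by (field; lra).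
  assert (F1 : x - v * (z + d) <= 0).
  { apply Rnot_lt_le. intros P.
    assert (0 < d / a * (kappa * v) * (x - v * (z + d))); [|lra].
    apply Rmult_lt_0_compat; [apply Rmult_lt_0_compat; auto|lra]. }
  assert (F2 : x - v' * (z + d) < x - v * (z + d)).
  { assert (v * (z + d) < v' * (z + d)) by (apply Rmult_lt_compat_r; lra). lra. }
  rewrite !(Rmult_assoc (d / a)). apply Rmult_lt_compat_l; auto.
  apply Rlt_le_trans with (kappa' * v' * (x - v * (z + d))).
  - apply Rmult_lt_compat_l; lra.
  - assert ((kappa' * v' - kappa * v) * (x - v * (z + d)) <= 0); [|lra].
    assert (0 <= (kappa' * v' - kappa * v) * - (x - v * (z + d))) by (apply Rmult_le_pos; lra). lra.
Qed.

Lemma connection_comparison kappa kappa' v v' p p' r r' y y' : 0 < kappa -> vm <= v -> v < v' ->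
  connection kappa v p r y -> connection kappa' v' p' r' y' -> kappa' * v' < kappa * v.
Proof.
  intros Hk Hv Hvv Hc Hc'. apply Rnot_le_lt. intros Hkv.
  assert (NP := connection_nonpositive kappa v p r y Hk Hv Hc).
  destruct Hc as [Y [Hp [Hr [Lp Rr]]]]. destruct Hc' as [Y' [Hp' [Hr' [Lp' Rr']]]].
  assert (P1 := top_decreasing v v' p p' Hvv Hp Hp').
  assert (R1 := bottom_increasing v v' r r' Hvv Hr Hr').
  destruct (Lp ((p - p') / 2) ltac:(lra)) as [T1 K1].
  destruct (Lp' ((p - p') / 2) ltac:(lra)) as [T2 K2].
  destruct (Rr ((r' - r) / 2) ltac:(lra)) as [T3 K3].
  destruct (Rr' ((r' - r) / 2) ltac:(lra)) as [T4 K4].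
  set (t0 := Rmin 0 (Rmin T1 T2)). set (t1 := Rmax 1 (Rmax T3 T4)).
  assert (A0 : t0 <= 0) by apply Rmin_l.
  assert (A1 : t0 <= Rmin T1 T2) by apply Rmin_r.
  assert (A2 := Rle_trans _ _ _ A1 (Rmin_l _ _)). assert (A3 := Rle_trans _ _ _ A1 (Rmin_r _ _)).
  assert (B0 : 1 <= t1) by apply Rmax_l.
  assert (B1 : Rmax T3 T4 <= t1) by apply Rmax_r.
  assert (B2 := Rle_trans _ _ _ (Rmax_l _ _) B1). assert (B3 := Rle_trans _ _ _ (Rmax_r _ _) B1).
  specialize (K1 t0 A2). specialize (K2 t0 A3). specialize (K3 t1 B2). specialize (K4 t1 B3).
  apply Rabs_def2 in K1. apply Rabs_def2 in K2. apply Rabs_def2 in K3. apply Rabs_def2 in K4.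
  (* The roots at c = 1 put y' below y at t0, those at c = 0 put it above at t1. At the last
     crossing the difference has the negative derivative l, so it would be negative just
     afterwards. *)
  destruct (last_zero (fun t => y' t - y t) t0 t1) as [t [Ht [Zt Pt]]]; try lra.
  { intros t _. apply (continuous_minus y' y).
    - exact (is_derive_cont _ _ _ (Y' t)).
    - exact (is_derive_cont _ _ _ (Y t)). }
  assert (D : is_derive (fun t => y' t - y t) t
    (speed f A d kappa' v' (y' t) (C t) - speed f A d kappa v (y t) (C t)))
    by (apply (is_derive_minus y' y); [apply Y'|apply Y]).
  replace (y' t) with (y t) in D by lra.
  assert (Q := speed_compare kappa kappa' v v' (y t) (C t) Hk Hv Hvv Hkv (NP t)).
  set (l := speed f A d kappa' v' (y t) (C t) - speed f A d kappa v (y t) (C t)) in *.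
  destruct (proj1 (is_derive_eps _ _ _) D (- l / 2)) as [e [He K]]; [unfold l; lra|].
  set (h := Rmin (e / 2) (t1 - t)).
  assert (Hh : 0 < h) by (apply Rmin_pos; lra).
  assert (Hh1 : h <= e / 2) by apply Rmin_l. assert (Hh2 : h <= t1 - t) by apply Rmin_r.
  specialize (K (t + h) ltac:(apply Rabs_def1; lra)).
  specialize (Pt (t + h) ltac:(lra)).
  replace (t + h - t) with h in K by ring. rewrite (Rabs_pos_eq h) in K by lra.
  apply Rabs_le_between in K. assert (l < 0) by (unfold l; lra). nra.
Qed.

(* Near c = cb the whole interval of saturations moves down at a rate proportional to kappa. *)
Lemma kappa_bounded_above_saddle e : 0 < e -> exists K, forall kappa v p r y, 0 < kappa ->
  vm + e <= v -> connection kappa v p r y -> kappa <= K.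
Proof.
  intros He. assert (V0 := vm_positive).
  destruct (square_uc f (proj1 (proj2 (proj2 (flux_C1 _ _ _ _ HF)))) (e * d / 2)) as [del [Hdel U]].
  { assert (0 < e * d) by (apply Rmult_lt_0_compat; auto). lra. }
  destruct (clock_lipschitz _ _ HC) as [KC [HKC LC]].
  set (T := del / (2 * KC)). assert (HT : 0 < T) by (apply Rdiv_lt_0_compat; lra).
  assert (HAM : 0 < Amax) by (assert (Q := A_clamp 0 0); lra).
  (* Up to time T the concentration stays within del of cb, and s falls at least at the rate w kappa
     / T. The total fall is at most 1, hence kappa <= 1 / w. *)
  set (w := d * vm / Amax * (e * d / 2) * T).
  assert (Hw : 0 < w).
  { unfold w. apply Rmult_lt_0_compat; auto. apply Rmult_lt_0_compat.
    - apply Rdiv_lt_0_compat; auto. apply Rmult_lt_0_compat; auto.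
    - assert (0 < e * d) by (apply Rmult_lt_0_compat; auto). lra. }
  exists (/ w). intros kappa v p r y Hk Hv Hc.
  assert (Rg := connection_range kappa v p r y Hk ltac:(lra) Hc).
  destruct Hc as [Y [Hp [Hr _]]].
  assert (Ip := top_inside v p ltac:(lra) Hp). assert (Ir := bottom_inside v r ltac:(lra) Hr).
  destruct (MVT_R y (fun t => speed f A d kappa v (y t) (C t)) 0 T) as [z [Hz E]]; auto.
  (* In the column c = cb the quotient is at most vm <= v - e, so the expression is at most -e d;
     half of this pays for the distance of C z from cb. *)
  assert (Fz : f (y z) (C z) - v * (y z + d) <= - (e * d / 2)).
  { assert (Rz := Rg z). assert (Uz := clock_unit _ _ HC z).
    assert (Q := U (y z) (y z) cb (C z) ltac:(rewrite Rminus_diag, Rabs_R0; lra)).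
    rewrite !clamped_in in Q by lra.
    assert (X : Rabs (C z - cb) < del).
    { rewrite <- (clock_0 _ _ HC). eapply Rle_lt_trans; [apply LC|].
      rewrite Rabs_pos_eq by lra. apply Rle_lt_trans with (KC * T).
      - apply Rmult_le_compat_l; lra.
      - unfold T. replace (KC * (del / (2 * KC))) with (del / 2) by (field; lra). lra. }
    specialize (Q X). apply Rabs_def2 in Q.
    assert (Q2 := Hcol (y z) ltac:(lra)).
    assert (Q3 : f (y z) cb = quot f d (y z) cb * (y z + d)) by (unfold quot; field; lra).
    assert (quot f d (y z) cb * (y z + d) <= vm * (y z + d)) by (apply Rmult_le_compat_r; lra).
    assert ((vm + e) * (y z + d) <= v * (y z + d)) by (apply Rmult_le_compat_r; lra).
    assert (e * d <= e * (y z + d)) by (apply Rmult_le_compat_l; lra). lra. }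
  assert (Rz := Rg z). assert (Uz := clock_unit _ _ HC z).
  rewrite speed_eq in E. rewrite !clamp_id in E by lra.
  assert (Az := HAb (y z) (C z) ltac:(red; lra) ltac:(red; lra)).
  assert (W1 : kappa * (d * vm / Amax) <= kappa * d * v / A (y z) (C z)).
  { replace (kappa * (d * vm / Amax)) with (kappa * d * vm * / Amax) by (field; lra).
    unfold Rdiv. apply Rmult_le_compat.
    - repeat apply Rmult_le_pos; lra.
    - left; apply Rinv_0_lt_compat; lra.
    - apply Rmult_le_compat_l; [|lra]. apply Rmult_le_pos; lra.
    - apply Rinv_le_contravar; lra. }
  set (W := kappa * d * v / A (y z) (C z)) in *.
  assert (W0 : 0 <= kappa * (d * vm / Amax)).
  { apply Rmult_le_pos; [lra|]. apply Rdiv_le_0_compat; auto. apply Rmult_le_pos; lra. }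
  assert (W2 : kappa * (d * vm / Amax) * (e * d / 2) <= W * - (f (y z) (C z) - v * (y z + d))).
  { apply Rmult_le_compat; auto; try lra. assert (0 < e * d) by (apply Rmult_lt_0_compat; auto). lra. }
  assert (W3 : kappa * w <= 1).
  { unfold w. assert (R0 := Rg 0). assert (RT := Rg T).
    assert (kappa * (d * vm / Amax) * (e * d / 2) * T <=
            W * - (f (y z) (C z) - v * (y z + d)) * T) by (apply Rmult_le_compat_r; lra).
    lra. }
  apply Rmult_le_reg_r with w; auto. rewrite Rinv_l by lra. exact W3.
Qed.
End Model.

(** * Travelling waves of the dissipative system *)

Lemma is_lim_m_infty_eps (y : R -> R) (p : R) : is_lim y m_infty p <-> tends_left y p.
Proof.
  split.
  - intros H e He. apply is_lim_spec in H. destruct (H (mkposreal e He)) as [T K].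
    exists (T - 1). intros t Ht. apply K. lra.
  - intros H. apply is_lim_spec. intros e. destruct (H e (cond_pos e)) as [T K].
    exists T. intros t Ht. apply K. lra.
Qed.

Lemma is_lim_p_infty_eps (y : R -> R) (p : R) : is_lim y p_infty p <-> tends_right y p.
Proof.
  split.
  - intros H e He. apply is_lim_spec in H. destruct (H (mkposreal e He)) as [T K].
    exists (T + 1). intros t Ht. apply K. lra.
  - intros H. apply is_lim_spec. intros e. destruct (H e (cond_pos e)) as [T K].
    exists T. intros t Ht. apply K. lra.
Qed.

Lemma tends_left_affine y p k x0 : 0 < k -> tends_left y p -> tends_left (fun t => y (k * t + x0)) p.
Proof.
  intros Hk H e He. destruct (H e He) as [T K]. exists ((T - x0) / k). intros t Ht. apply K.
  assert (k * t <= k * ((T - x0) / k)) by (apply Rmult_le_compat_l; lra).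
  replace (k * ((T - x0) / k)) with (T - x0) in * by (field; lra). lra.
Qed.

Lemma tends_right_affine y p k x0 : 0 < k -> tends_right y p -> tends_right (fun t => y (k * t + x0)) p.
Proof.
  intros Hk H e He. destruct (H e He) as [T K]. exists ((T - x0) / k). intros t Ht. apply K.
  assert (k * ((T - x0) / k) <= k * t) by (apply Rmult_le_compat_l; lra).
  replace (k * ((T - x0) / k)) with (T - x0) in * by (field; lra). lra.
Qed.

Lemma derive_affine (y : R -> R) k x0 t l : is_derive y (k * t + x0) l ->
  is_derive (fun t => y (k * t + x0)) t (k * l).
Proof.
  intros H. evar_last. { apply (is_derive_comp y (fun t => k * t + x0)).
    - exact H. - auto_derive; auto. }
  unfold scal; simpl; unfold mult; simpl. ring.
Qed.

Lemma C1_intro (g g1 : R -> R) : (forall x, is_derive g x (g1 x)) -> (forall x, continuous g1 x) -> C1 g.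
Proof.
  intros D K x. split; [exists (g1 x); apply D|].
  apply (continuous_ext g1); [|apply K]. intros z. symmetry. apply is_derive_unique, D.
Qed.

Lemma travelling_Dx g v ec x t l : ec <> 0 -> is_derive g ((x - v * t) / ec) l ->
  Dx (travelling g v ec) x t = l / ec.
Proof.
  intros He H. unfold Dx, travelling. apply is_derive_unique.
  evar_last. { apply (is_derive_comp g (fun y => (y - v * t) / ec)); [exact H|].
    instantiate (1 := / ec). auto_derive; auto. field; auto. }
  unfold scal; simpl; unfold mult; simpl. field; auto.
Qed.

Lemma travelling_Dt g v ec x t l : ec <> 0 -> is_derive g ((x - v * t) / ec) l ->
  Dt (travelling g v ec) x t = - v * l / ec.
Proof.
  intros He H. unfold Dt, travelling. apply is_derive_unique.
  evar_last. { apply (is_derive_comp g (fun y => (x - v * y) / ec)); [exact H|].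
    instantiate (1 := - v / ec). auto_derive; auto. field; auto. }
  unfold scal; simpl; unfold mult; simpl. field; auto.
Qed.

Lemma filterlim_ray_right (y : R -> R) p z : tends_right y p -> 0 < z ->
  filterlim (fun ec => y (z / ec)) (at_right 0) (locally p).
Proof.
  intros H Hz. apply filterlim_locally. intros e. destruct (H e (cond_pos e)) as [T K].
  set (B := Rabs T + 1). assert (HB : 0 < B) by (unfold B; assert (Q := Rabs_pos T); lra).
  assert (HT : T < B) by (unfold B; assert (Q := Rle_abs T); lra).
  exists (mkposreal (z / B) ltac:(apply Rdiv_lt_0_compat; lra)). intros ec Hb Hec.
  apply K. assert (Hb' : Rabs (ec - 0) < z / B) by exact Hb. rewrite Rabs_pos_eq in Hb' by lra.
  apply Rle_trans with B; [lra|].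
  apply Rmult_le_reg_r with ec; [lra|]. replace (z / ec * ec) with z by (field; lra).
  replace z with (B * (z / B)) by (field; lra). apply Rmult_le_compat_l; lra.
Qed.

Lemma filterlim_ray_left (y : R -> R) p z : tends_left y p -> z < 0 ->
  filterlim (fun ec => y (z / ec)) (at_right 0) (locally p).
Proof.
  intros H Hz.
  apply (filterlim_ext (fun ec => (fun t => y (- t)) ((- z) / ec))).
  { intros ec. f_equal. unfold Rdiv. ring. }
  apply (filterlim_ray_right (fun t => y (- t)) p (- z)); [|lra].
  intros e He. destruct (H e He) as [T K]. exists (- T). intros t Ht. apply K. lra.
Qed.

(** * From connecting orbits to travelling waves *)

Section Profile.
Variables (f fs fc fss A : R -> R -> R) (a a1 a2 : R -> R) (Amin Amax cb : R) (C : R -> R).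
Hypotheses (HF : flux f fs fc fss) (hA1 : A1 a a1 a2) (Hd : 0 < a 1)
  (HA : continuous_on_square A) (HAm : 0 < Amin)
  (HAb : forall s c, unit_interval s -> unit_interval c -> Amin <= A s c <= Amax)
  (HC : clock C cb) (DC : forall t, is_derive C t (- excess a (C t))).

(** In the variable xi the orbit satisfies A s' = F with F = f - v (s + d), so A s' is continuously
    differentiable although A need not be. The first two equations are derivatives of this relation
    and of c times it, since alpha = d c. *)
Lemma orbit_admissible kappa v p r y : 0 < kappa -> 0 < v -> orbit (speed f A (a 1) kappa v) C y ->
  tends_left y p -> tends_right y r -> (forall t, 0 <= y t <= 1) ->
  admissible f a A kappa (p, 1) (r, 0) v.
Proof.
  intros Hk Hv Y Lp Rr Uy. set (d := a 1) in *.
  set (k := kappa * d * v). assert (Pk : 0 < k) by (repeat apply Rmult_lt_0_compat; auto).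
  (* The factor k = kappa d v converts xi to clock time; the summand 0 matches the form of the
     affine lemmas, which allow a shift. *)
  set (s := fun x => y (/ k * x + 0)). set (c := fun x => C (/ k * x + 0)).
  set (alpha := fun x => d * c x).
  assert (Pik : 0 < / k) by (apply Rinv_0_lt_compat; auto).
  assert (Us : forall x, 0 <= s x <= 1) by (intros; apply Uy).
  assert (Uc : forall x, 0 <= c x <= 1) by (intros x; destruct (clock_unit _ _ HC (/ k * x + 0)); unfold c; lra).
  set (F := fun x => f (s x) (c x) - v * (s x + d)).
  set (g1 := fun x => F x / A (s x) (c x)).
  set (c1 := fun x => - excess a (c x) / k).
  assert (Apos : forall x, 0 < A (s x) (c x)).
  { intros x. assert (Q := HAb (s x) (c x) (Us x) (Uc x)). lra. }
  assert (Ds : forall x, is_derive s x (g1 x)).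
  { intros x. replace (g1 x) with (/ k * speed f A d kappa v (y (/ k * x + 0)) (C (/ k * x + 0))).
    - apply (derive_affine y), Y.
    - rewrite speed_eq, !clamp_id by (apply Us || apply Uc).
      unfold g1, F. fold (s x) (c x). fold d. unfold k. specialize (Apos x). field.
      repeat split; lra. }
  assert (Dc : forall x, is_derive c x (c1 x)).
  { intros x. replace (c1 x) with (/ k * - excess a (C (/ k * x + 0))).
    - apply (derive_affine C), DC.
    - unfold c1, c. unfold Rdiv. ring. }
  assert (Ks : forall x, continuous s x) by (intros x; exact (is_derive_cont _ _ _ (Ds x))).
  assert (Kc : forall x, continuous c x) by (intros x; exact (is_derive_cont _ _ _ (Dc x))).
  destruct (flux_C1 _ _ _ _ HF) as [P1 [P2 [Kf [Kfs Kfc]]]].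
  assert (KF : forall x, continuous F x).
  { intros x. apply (continuous_minus (fun x => f (s x) (c x)) (fun x => v * (s x + d))).
    - apply square_comp_continuous; auto.
    - apply (continuous_scal_r v (fun x => s x + d)).
      apply (continuous_plus s (fun _ => d)); [auto|apply continuous_const]. }
  assert (Kg1 : forall x, continuous g1 x).
  { intros x. apply (continuous_mult F (fun x => / A (s x) (c x))); auto.
    apply (continuous_comp (fun x => A (s x) (c x)) Rinv).
    - apply square_comp_continuous; auto.
    - apply continuous_Rinv. specialize (Apos x). lra. }
  destruct (excess_lipschitz a a1 a2 hA1) as [K [HK LE]].
  assert (Kc1 : forall x, continuous c1 x).
  { intros x. apply (continuous_mult (fun x => - excess a (c x)) (fun _ => / k)); [|apply continuous_const].
    apply (continuous_opp (fun x => excess a (c x))). apply continuity_eps. intros e He.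
    destruct (proj1 (continuity_eps _ _) (Kc x) (e / K)) as [del [Hdel Q]].
    { apply Rdiv_lt_0_compat; lra. }
    exists del. split; auto. intros z Hz. eapply Rle_lt_trans; [apply LE; auto|].
    replace e with (K * (e / K)) by (field; lra). apply Rmult_lt_compat_l; auto. }
  set (F1 := fun x => fs (s x) (c x) * g1 x + fc (s x) (c x) * c1 x - v * g1 x).
  assert (Df : forall x, is_derive (fun x => f (s x) (c x)) x (fs (s x) (c x) * g1 x + fc (s x) (c x) * c1 x)).
  { intros x. apply square_chain; auto. apply (flux_C1 _ _ _ _ HF). }
  assert (DF : forall x, is_derive F x (F1 x)).
  { intros x. apply (is_derive_minus (fun x => f (s x) (c x)) (fun x => v * (s x + d))); auto.
    apply (is_derive_scal (fun x => s x + d)).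
    replace (g1 x) with (g1 x + 0) by ring. apply (is_derive_plus s (fun _ => d)); auto.
    apply (is_derive_const d x). }
  assert (KF1 : forall x, continuous F1 x).
  { intros x. apply (continuous_minus (fun x => fs (s x) (c x) * g1 x + fc (s x) (c x) * c1 x)
      (fun x => v * g1 x)).
    - apply (continuous_plus (fun x => fs (s x) (c x) * g1 x) (fun x => fc (s x) (c x) * c1 x)).
      + apply (continuous_mult (fun x => fs (s x) (c x)) g1); auto. apply square_comp_continuous; auto.
      + apply (continuous_mult (fun x => fc (s x) (c x)) c1); auto. apply square_comp_continuous; auto.
    - apply (continuous_scal_r v g1); auto. }
  assert (Da : forall x, is_derive alpha x (d * c1 x)) by (intros x; apply (is_derive_scal c), Dc).
  assert (Eflux : forall x, A (s x) (c x) * Derive s x = F x).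
  { intros x. rewrite (is_derive_unique _ _ _ (Ds x)). unfold g1. specialize (Apos x). field; lra. }
  assert (Ls : tends_left s p) by (apply (tends_left_affine y); auto).
  assert (Rs : tends_right s r) by (apply (tends_right_affine y); auto).
  assert (Lc : tends_left c 1) by (apply (tends_left_affine C); auto; apply (clock_left _ _ HC)).
  assert (Rc : tends_right c 0) by (apply (tends_right_affine C); auto; apply (clock_right _ _ HC)).
  exists s, c, alpha. split; [|split; [|split; [|split; [|split]]]].
  - split; [|split; [|split]].
    + apply C1_intro with g1; auto.
    + apply C1_intro with c1; auto.
    + apply C1_intro with (fun x => d * c1 x); auto. intros x. apply (continuous_scal_r d c1); auto.
    + apply C1_intro with F1; auto. intros x. apply (is_derive_ext F); auto.
  - simpl. split; [apply is_lim_m_infty_eps|apply is_lim_p_infty_eps]; auto.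
  - simpl. split; [apply is_lim_m_infty_eps|apply is_lim_p_infty_eps]; auto.
  - simpl. assert (a0 : a 0 = 0) by apply hA1. rewrite a0. fold d.
    split.
    + replace (Finite d) with (Rbar_mult d 1) by (simpl; f_equal; ring).
      apply is_lim_scal_l, is_lim_m_infty_eps, Lc.
    + replace (Finite 0) with (Rbar_mult d 0) by (simpl; f_equal; ring).
      apply is_lim_scal_l, is_lim_p_infty_eps, Rc.
  - intros ec er Hec Her Hr x t Ht. set (xi := (x - v * t) / ec).
    assert (Nec : ec <> 0) by lra.
    split; [apply Us|]. split; [apply Uc|]. split; [|split].
    + rewrite (travelling_Dt s v ec x t (g1 xi) Nec (Ds xi)).
      change (Dx (fun y0 r0 => f (travelling s v ec y0 r0) (travelling c v ec y0 r0)) x t)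
        with (Dx (travelling (fun x => f (s x) (c x)) v ec) x t).
      rewrite (travelling_Dx (fun x : R => f (s x) (c x)) v ec x t _ Nec (Df xi)).
      assert (E : Dx (fun y0 r0 => A (travelling s v ec y0 r0) (travelling c v ec y0 r0) *
          Dx (travelling s v ec) y0 r0) x t = Dx (travelling (fun x => / ec * F x) v ec) x t).
      { unfold Dx at 1 3. apply Derive_ext. intros z. cbv beta.
        rewrite (travelling_Dx s v ec z t _ Nec (Ds ((z - v * t) / ec))).
        unfold travelling. rewrite <- Eflux, (is_derive_unique _ _ _ (Ds ((z - v * t) / ec))).
        field; auto. }
      rewrite E, (travelling_Dx (fun x : R => / ec * F x) v ec x t (/ ec * F1 xi) Nec).
      * unfold F1. fold xi. field; auto.
      * apply (is_derive_scal F), DF.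
    + change (Dt (fun y0 r0 => travelling c v ec y0 r0 * travelling s v ec y0 r0 +
          travelling alpha v ec y0 r0) x t)
        with (Dt (travelling (fun x => c x * s x + alpha x) v ec) x t).
      rewrite (travelling_Dt (fun x : R => c x * s x + alpha x) v ec x t (c1 xi * s xi + c xi * g1 xi + d * c1 xi) Nec).
      2: { apply (is_derive_plus (fun x => c x * s x) alpha); auto.
           apply (is_derive_mult c s); auto. intros; apply Rmult_comm. }
      change (Dx (fun y0 r0 => travelling c v ec y0 r0 *
          f (travelling s v ec y0 r0) (travelling c v ec y0 r0)) x t)
        with (Dx (travelling (fun x => c x * f (s x) (c x)) v ec) x t).
      rewrite (travelling_Dx (fun x : R => c x * f (s x) (c x)) v ec x t (c1 xi * f (s xi) (c xi) + c xi *
        (fs (s xi) (c xi) * g1 xi + fc (s xi) (c xi) * c1 xi)) Nec).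
      2: { apply (is_derive_mult c (fun x => f (s x) (c x))); auto. intros; apply Rmult_comm. }
      assert (E : Dx (fun y0 r0 => travelling c v ec y0 r0 *
          A (travelling s v ec y0 r0) (travelling c v ec y0 r0) *
          Dx (travelling s v ec) y0 r0) x t = Dx (travelling (fun x => / ec * (c x * F x)) v ec) x t).
      { unfold Dx at 1 3. apply Derive_ext. intros z. cbv beta.
        rewrite (travelling_Dx s v ec z t _ Nec (Ds ((z - v * t) / ec))).
        unfold travelling. rewrite <- Eflux, (is_derive_unique _ _ _ (Ds ((z - v * t) / ec))).
        field; auto. }
      rewrite E, (travelling_Dx (fun x : R => / ec * (c x * F x)) v ec x t (/ ec * (c1 xi * F xi + c xi * F1 xi)) Nec).
      * unfold F1, F. field; auto.
      * apply (is_derive_scal (fun x => c x * F x)).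
        apply (is_derive_mult c F); auto. intros; apply Rmult_comm.
    + rewrite (travelling_Dt alpha v ec x t (d * c1 xi) Nec (Da xi)).
      unfold travelling. fold xi. unfold alpha, c1, k, excess. fold d.
      replace er with (kappa * ec) by (rewrite <- Hr; field; auto). field. repeat split; lra.
  - intros x t Ht Hx.
    assert (Pair : forall p q : R,
      filterlim (fun ec => travelling s v ec x t) (at_right 0) (locally p) ->
      filterlim (fun ec => travelling c v ec x t) (at_right 0) (locally q) ->
      filterlim (fun ec => (travelling s v ec x t, travelling c v ec x t)) (at_right 0)
        (locally (p, q))).
    { intros p' q' Q1 Q2. apply filterlim_locally. intros e.
      generalize (filter_and _ _ (proj1 (filterlim_locally _ _) Q1 e)
        (proj1 (filterlim_locally _ _) Q2 e)).
      apply filter_imp. intros ec [B1 B2]. split; assumption. }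
    unfold shock_function. destruct Rlt_dec.
    + apply Pair; [apply (filterlim_ray_left s)|apply (filterlim_ray_left c)]; auto; lra.
    + apply Pair; [apply (filterlim_ray_right s)|apply (filterlim_ray_right c)]; auto; lra.
Qed.
End Profile.

(** * From travelling waves to connecting orbits *)

Section Reduce.
Variables (f fs fc fss A : R -> R -> R) (a a1 a2 : R -> R) (Amin Amax cb : R) (C : R -> R).
Hypotheses (HF : flux f fs fc fss) (hA1 : A1 a a1 a2) (hA2 : A2 a1) (hA3 : A3 a2)
  (HAm : 0 < Amin)
  (HAb : forall s c, unit_interval s -> unit_interval c -> Amin <= A s c <= Amax)
  (Hcb : 0 < cb < 1)
  (HC : clock C cb) (TC : forall t, travel_time (excess a) cb (C t) = t).

Lemma zero_derivative_constant (g : R -> R) : (forall x, is_derive g x 0) -> forall x, g x = g 0.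
Proof.
  intros D x. destruct (Rtotal_order x 0) as [L|[->|L]]; auto.
  - destruct (MVT_R g (fun _ => 0) x 0) as [z [_ E]]; auto. lra.
  - destruct (MVT_R g (fun _ => 0) 0 x) as [z [_ E]]; auto. lra.
Qed.

Lemma admissible_orbit kappa v p r : 0 < kappa -> 0 < v ->
  admissible f a A kappa (p, 1) (r, 0) v ->
  exists y, orbit (speed f A (a 1) kappa v) C y /\ tends_left y p /\ tends_right y r.
Proof.
  intros Hk Hv [s [c [al [[Cs [Cc [Ca Cw]]] [[Ls Rs] [[Lc Rc] [[La Ra] [Eq _]]]]]]]].
  simpl in Ls, Rs, Lc, Rc, La, Ra.
  assert (Hd := isotherm_positive a a1 a2 hA1 hA2). set (d := a 1) in *.
  assert (Ds : forall x, is_derive s x (Derive s x)) by (intros x; apply Derive_correct, Cs).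
  assert (Dc : forall x, is_derive c x (Derive c x)) by (intros x; apply Derive_correct, Cc).
  assert (Da : forall x, is_derive al x (Derive al x)) by (intros x; apply Derive_correct, Ca).
  set (w := fun x => A (s x) (c x) * Derive s x) in *.
  assert (Dw : forall x, is_derive w x (Derive w x)) by (intros x; apply Derive_correct, Cw).
  (* One pair of parameters, ec = 1 and er = kappa, determines the profile equations; at the point
     (x + v, 1) the travelling variable equals x. *)
  assert (Eq1 : forall x, 0 <= s x <= 1 /\ 0 <= c x <= 1 /\
     Dt (travelling s v 1) (x + v) 1 + Dx (travelling (fun x => f (s x) (c x)) v 1) (x + v) 1
       = Dx (travelling w v 1) (x + v) 1 /\
     Dt (travelling (fun x => c x * s x + al x) v 1) (x + v) 1 +
       Dx (travelling (fun x => c x * f (s x) (c x)) v 1) (x + v) 1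
       = Dx (travelling (fun x => c x * w x) v 1) (x + v) 1 /\
     kappa * Dt (travelling al v 1) (x + v) 1 = a (c x) - al x).
  { intros x. destruct (Eq 1 kappa ltac:(lra) Hk ltac:(field) (x + v) 1 ltac:(lra))
      as [U1 [U2 [E1 [E2 E3]]]].
    assert (Ex : (x + v - v * 1) / 1 = x) by field.
    unfold travelling at 1 in U1. unfold travelling at 1 in U2. rewrite Ex in U1, U2.
    split; [exact U1|]. split; [exact U2|]. split; [|split].
    - rewrite Rmult_1_l in E1.
      etransitivity; [exact E1|]. unfold Dx at 1 3. apply Derive_ext. intros z. cbv beta.
      rewrite (travelling_Dx s v 1 z 1 _ ltac:(lra) (Ds ((z - v * 1) / 1))).
      unfold travelling, w. field.
    - rewrite Rmult_1_l in E2.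
      etransitivity; [exact E2|]. unfold Dx at 1 3. apply Derive_ext. intros z. cbv beta.
      rewrite (travelling_Dx s v 1 z 1 _ ltac:(lra) (Ds ((z - v * 1) / 1))).
      unfold travelling, w. field.
    - unfold travelling at 2 3 in E3. rewrite Ex in E3. exact E3. }
  assert (Us : forall x, 0 <= s x <= 1) by (intros x; apply Eq1).
  assert (Uc : forall x, 0 <= c x <= 1) by (intros x; apply Eq1).
  set (fd := fun x => fs (s x) (c x) * Derive s x + fc (s x) (c x) * Derive c x).
  assert (Df : forall x, is_derive (fun x => f (s x) (c x)) x (fd x)).
  { intros x. apply square_chain; auto. apply (flux_C1 _ _ _ _ HF). }
  assert (Dcf : forall x, is_derive (fun x => c x * f (s x) (c x)) x
     (Derive c x * f (s x) (c x) + c x * fd x)).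
  { intros x. apply (is_derive_mult c (fun x => f (s x) (c x))); auto. intros; apply Rmult_comm. }
  assert (Dcs : forall x, is_derive (fun x => c x * s x + al x) x
     (Derive c x * s x + c x * Derive s x + Derive al x)).
  { intros x. apply (is_derive_plus (fun x => c x * s x) al); auto.
    apply (is_derive_mult c s); auto. intros; apply Rmult_comm. }
  assert (Dcw : forall x, is_derive (fun x => c x * w x) x (Derive c x * w x + c x * Derive w x)).
  { intros x. apply (is_derive_mult c w); auto. intros; apply Rmult_comm. }
  assert (Eq2 : forall x, - v * Derive s x + fd x = Derive w x /\
     - v * (Derive c x * s x + c x * Derive s x + Derive al x) +
       (Derive c x * f (s x) (c x) + c x * fd x) = Derive c x * w x + c x * Derive w x /\
     kappa * (- v * Derive al x) = a (c x) - al x).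
  { intros x. destruct (Eq1 x) as [_ [_ [E1 [E2 E3]]]].
    assert (Ex : (x + v - v * 1) / 1 = x) by field.
    assert (N1 : 1 <> 0) by lra.
    assert (T : forall (g : R -> R) (l : R), is_derive g x l -> is_derive g ((x + v - v * 1) / 1) l)
      by (intros; rewrite Ex; auto).
    rewrite (travelling_Dt s v 1 (x + v) 1 _ N1 (T _ _ (Ds x))) in E1.
    rewrite (travelling_Dx (fun x : R => f (s x) (c x)) v 1 (x + v) 1 _ N1 (T _ _ (Df x))) in E1.
    rewrite (travelling_Dx w v 1 (x + v) 1 _ N1 (T _ _ (Dw x))) in E1.
    rewrite (travelling_Dt (fun x : R => c x * s x + al x) v 1 (x + v) 1 _ N1 (T _ _ (Dcs x))) in E2.
    rewrite (travelling_Dx (fun x : R => c x * f (s x) (c x)) v 1 (x + v) 1 _ N1 (T _ _ (Dcf x))) in E2.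
    rewrite (travelling_Dx (fun x : R => c x * w x) v 1 (x + v) 1 _ N1 (T _ _ (Dcw x))) in E2.
    rewrite (travelling_Dt al v 1 (x + v) 1 _ N1 (T _ _ (Da x))) in E3.
    split; [lra|split; lra]. }
  set (q1 := fun x => f (s x) (c x) - v * s x - w x).
  set (q2 := fun x => c x * f (s x) (c x) - v * (c x * s x + al x) - c x * w x).
  assert (K1 : forall x, q1 x = q1 0).
  { apply zero_derivative_constant. intros x.
    replace 0 with (fd x - v * Derive s x - Derive w x) by (destruct (Eq2 x) as [E _]; lra).
    apply (is_derive_minus (fun x => f (s x) (c x) - v * s x) w); auto.
    apply (is_derive_minus (fun x => f (s x) (c x)) (fun x => v * s x)); auto.
    apply (is_derive_scal s); auto. }
  assert (K2 : forall x, q2 x = q2 0).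
  { apply zero_derivative_constant. intros x.
    replace 0 with (Derive c x * f (s x) (c x) + c x * fd x -
      v * (Derive c x * s x + c x * Derive s x + Derive al x) -
      (Derive c x * w x + c x * Derive w x)) by (destruct (Eq2 x) as [_ [E _]]; lra).
    apply (is_derive_minus (fun x => c x * f (s x) (c x) - v * (c x * s x + al x))
      (fun x => c x * w x)); auto.
    apply (is_derive_minus (fun x => c x * f (s x) (c x)) (fun x => v * (c x * s x + al x))); auto.
    apply (is_derive_scal (fun x => c x * s x + al x)); auto. }
  (* Multiplying the first integral by c and subtracting the second eliminates w, so the limits of c
     and alpha alone determine both constants, and no limit of s' is needed. *)
  assert (Rel : forall x, c x * q1 0 - v * al x = q2 0).
  { intros x. rewrite <- (K2 x), <- (K1 x). unfold q1, q2. ring. }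
  assert (a0 : a 0 = 0) by apply hA1. rewrite a0 in Ra. fold d in La.
  assert (Lim : forall z l m, is_lim c z (Finite l) -> is_lim al z (Finite m) ->
     l * q1 0 - v * m = q2 0).
  { intros z l m Hc Ha.
    assert (Q : is_lim (fun x => c x * q1 0 - v * al x) z (l * q1 0 - v * m)).
    { apply (is_lim_minus' (fun x => c x * q1 0) (fun x => v * al x)).
      - apply (is_lim_scal_r c (q1 0) z l Hc).
      - apply (is_lim_scal_l al v z m Ha). }
    apply (is_lim_ext _ (fun _ => q2 0)) in Q; [|exact Rel].
    apply is_lim_unique in Q. rewrite Lim_const in Q. injection Q. auto. }
  assert (Z2 := Lim _ _ _ Rc Ra). assert (Z1 := Lim _ _ _ Lc La).
  assert (Z : q2 0 = 0) by lra. assert (Z' : q1 0 = v * d) by lra. clear Z1 Z2. rename Z into Z2, Z' into Z1.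
  apply is_lim_m_infty_eps in Ls. apply is_lim_p_infty_eps in Rs.
  apply is_lim_m_infty_eps in Lc. apply is_lim_p_infty_eps in Rc.
  assert (Eal : forall x, al x = d * c x).
  { intros x. assert (Y := Rel x). rewrite Z1, Z2 in Y. apply Rmult_eq_reg_l with v; lra. }
  assert (Ew : forall x, w x = f (s x) (c x) - v * (s x + d)).
  { intros x. assert (Y := K1 x). rewrite Z1 in Y. unfold q1 in Y. lra. }
  set (k := kappa * d * v). assert (Pk : 0 < k) by (repeat apply Rmult_lt_0_compat; auto).
  assert (Ec : forall x, Derive c x = - excess a (c x) / k).
  { intros x. destruct (Eq2 x) as [_ [_ E]].
    assert (D : Derive al x = d * Derive c x).
    { rewrite (Derive_ext al (fun x => d * c x)) by auto.
      apply is_derive_unique, (is_derive_scal c), Dc. }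
    rewrite D, Eal in E. unfold excess. fold d. unfold k.
    replace (- (a (c x) - d * c x)) with (kappa * v * d * Derive c x) by lra. field. lra. }
  destruct (excess_lipschitz a a1 a2 hA1) as [K [HK LE]].
  assert (Dc' : forall x, is_derive c x (- excess a (c x) / k)) by (intros x; rewrite <- Ec; apply Dc).
  (* The values 0 and 1 are equilibria of a Lipschitz equation. Touching 0 would force c = 0 at all
     earlier points, contrary to the limit 1 on the left; touching 1 would force c = 1 at all later
     points, contrary to the limit 0 on the right. *)
  assert (Ic : forall x, 0 < c x < 1).
  { assert (Ik : 0 < / k) by (apply Rinv_0_lt_compat; auto).
    intros x0. destruct (Uc x0) as [Lo Hi]. split.
    - destruct Lo as [|E]; auto. exfalso.
      assert (N : forall x, - x0 <= x -> c (- x) <= 0).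
      { intros x Hx. apply (gronwall_sign (fun x => c (- x)) (fun x => excess a (c (- x)) / k) (K / k)
          (- x0) x); auto.
        - intros t _. evar_last.
          { apply (is_derive_comp c Ropp); [apply Dc'|]. instantiate (1 := -1). auto_derive; auto. }
          unfold scal; simpl; unfold mult; simpl. unfold Rdiv. ring.
        - intros t _. assert (X := LE 0 (c (- t)) ltac:(lra) (Uc _)).
          rewrite (excess_0 a a1 a2 hA1), !Rminus_0_r in X.
          assert (Y := Rle_abs (excess a (c (- t)))). unfold Rdiv.
          rewrite (Rmult_comm K), Rmult_assoc, Rmult_comm. apply Rmult_le_compat_l; lra.
        - rewrite Ropp_involutive, <- E. lra. }
      destruct (Lc (1 / 2) ltac:(lra)) as [T X]. specialize (X (Rmin T x0) (Rmin_l _ _)).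
      assert (Y := Rmin_r T x0). specialize (N (- Rmin T x0) ltac:(lra)).
      rewrite Ropp_involutive in N. apply Rabs_def2 in X. lra.
    - destruct Hi as [|E]; auto. exfalso.
      assert (N : forall x, x0 <= x -> 1 - c x <= 0).
      { intros x Hx. apply (gronwall_sign (fun x => 1 - c x) (fun x => excess a (c x) / k) (K / k)
          x0 x); auto.
        - intros t _. replace (excess a (c t) / k) with (0 - - excess a (c t) / k) by (unfold Rdiv; ring).
          apply (is_derive_minus (fun _ => 1) c); [apply (is_derive_const 1 t)|auto].
        - intros t _. assert (X := LE 1 (c t) ltac:(lra) (Uc _)).
          rewrite (excess_1 a), Rminus_0_r, (Rabs_minus_sym (c t)) in X.
          assert (Y := Rle_abs (excess a (c t))). unfold Rdiv.
          rewrite (Rmult_comm K), Rmult_assoc, Rmult_comm. apply Rmult_le_compat_l; lra.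
        - lra. }
      destruct (Rc (1 / 2) ltac:(lra)) as [T X]. specialize (X (Rmax T x0) (Rmax_l _ _)).
      specialize (N (Rmax T x0) (Rmax_r _ _)). apply Rabs_def2 in X. lra. }
  destruct (clock_time_change (excess a) K cb HK Hcb (excess_positive a a1 a2 hA1 hA3) LE C k c
    (clock_unit _ _ HC) TC Pk Ic Dc') as [x0 Hx0].
  exists (fun t => s (k * t + x0)). split; [|split].
  - intros t. rewrite speed_eq, !clamp_id by (try apply Us; destruct (clock_unit _ _ HC t); lra).
    set (x := k * t + x0).
    replace (a 1) with d by reflexivity. fold k.
    assert (Q : C t = c x) by (unfold x; rewrite Hx0; reflexivity). rewrite Q.
    assert (QA := HAb (s x) (c x) (Us x) (Uc x)).
    replace (k / A (s x) (c x) * (f (s x) (c x) - v * (s x + d))) with (k * Derive s x).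
    + apply (derive_affine s), Ds.
    + rewrite <- Ew. unfold w. field. lra.
  - apply tends_left_affine; auto.
  - apply tends_right_affine; auto.
Qed.
End Reduce.

(** * Compatibility by speeds *)

(* An extreme point of the interval: lowering a concave function there keeps it concave. *)
Lemma envelope_at_extreme_point (D : R -> Prop) h hU e : upper_envelope D h hU -> D e ->
  (forall x y l, D x -> D y -> 0 < l < 1 -> l * x + (1 - l) * y = e -> x = e /\ y = e) ->
  hU e = h e.
Proof.
  intros [[Con Maj] Min] De Ext.
  set (g := fun x => if Req_EM_T x e then h e else hU x).
  assert (Le : forall x, D x -> g x <= hU x).
  { intros x Dx. unfold g. destruct Req_EM_T as [->|]; [apply Maj; auto|lra]. }
  assert (Q : hU e <= g e).
  { apply Min; auto. split.
    - intros x y l Dx Dy Hl.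
      destruct (Req_dec l 0) as [->|]. { rewrite !Rmult_0_l, Rminus_0_r, !Rmult_1_l, !Rplus_0_l. lra. }
      destruct (Req_dec l 1) as [->|].
      { rewrite Rminus_diag, !Rmult_0_l, !Rmult_1_l, !Rplus_0_r. lra. }
      destruct (Req_dec (l * x + (1 - l) * y) e) as [E|Ne].
      + destruct (Ext x y l Dx Dy ltac:(lra) E) as [-> ->]. rewrite E. lra.
      + assert (X := Con x y l Dx Dy Hl).
        assert (G : g (l * x + (1 - l) * y) = hU (l * x + (1 - l) * y)).
        { unfold g. destruct Req_EM_T; [contradiction|reflexivity]. }
        rewrite G. assert (A1 := Le x Dx). assert (A2 := Le y Dy).
        assert (l * g x <= l * hU x) by (apply Rmult_le_compat_l; lra).
        assert ((1 - l) * g y <= (1 - l) * hU y) by (apply Rmult_le_compat_l; lra). lra.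
    - intros x Dx. unfold g. destruct Req_EM_T as [->|]; [lra|apply Maj; auto]. }
  unfold g in Q. destruct Req_EM_T; [|contradiction]. assert (X := Maj e De). lra.
Qed.

Lemma envelope_ends h hU s2 s1 : s2 < s1 -> upper_envelope (fun x => s2 <= x <= s1) h hU ->
  hU s2 = h s2 /\ hU s1 = h s1.
Proof.
  intros Hs E. split.
  - apply (envelope_at_extreme_point _ h hU s2 E); [lra|]. intros x y l Hx Hy Hl Eq.
    assert (0 <= l * (x - s2)) by (apply Rmult_le_pos; lra).
    assert (0 <= (1 - l) * (y - s2)) by (apply Rmult_le_pos; lra).
    assert (E1 : l * (x - s2) = 0) by lra. assert (E2 : (1 - l) * (y - s2) = 0) by lra.
    apply Rmult_integral in E1. apply Rmult_integral in E2. lra.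
  - apply (envelope_at_extreme_point _ h hU s1 E); [lra|]. intros x y l Hx Hy Hl Eq.
    assert (0 <= l * (s1 - x)) by (apply Rmult_le_pos; lra).
    assert (0 <= (1 - l) * (s1 - y)) by (apply Rmult_le_pos; lra).
    assert (E1 : l * (s1 - x) = 0) by lra. assert (E2 : (1 - l) * (s1 - y) = 0) by lra.
    apply Rmult_integral in E1. apply Rmult_integral in E2. lra.
Qed.

Lemma D_in_restrict g g1 (D D' : R -> Prop) x : (forall y, D' y -> D y) ->
  D_in g g1 D x -> D_in g g1 D' x.
Proof.
  intros S H. apply eps_D_in. intros e He. destruct (D_in_eps _ _ _ _ H e He) as [d [Hd K]].
  exists d. split; auto.
Qed.

(** The envelope lies above f and meets it at both ends, so its slope is at least that of f at s2
    and at most that of f at s1. *)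
Lemma s_wave_end_speeds (f f1 : R -> R -> R) c s1 s2 g : 0 <= s2 -> s1 <= 1 ->
  (forall x, unit_interval x -> D_in (fun x => f x c) (fun x => f1 x c) unit_interval x) ->
  s_wave f c s1 s2 g -> f1 s2 c <= g s2 /\ g s1 <= f1 s1 c.
Proof.
  intros H2 H1 Df [Hs [U [E Dg]]].
  destruct (envelope_ends _ _ _ _ Hs E) as [E2 E1]. destruct E as [[_ Maj] _].
  split; apply Rnot_lt_le; intros L.
  (* The two linearisation errors add up to 2 e h, against a gap of 4 e h. *)
  - set (e := (f1 s2 c - g s2) / 4). assert (He : 0 < e) by (unfold e; lra).
    destruct (D_in_eps _ _ _ _ (Dg s2 ltac:(lra)) e He) as [d1 [Hd1 K1]].
    destruct (D_in_eps _ _ _ _ (Df s2 ltac:(red; lra)) e He) as [d2 [Hd2 K2]].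
    destruct (exists_below (s1 - s2) (d1 / 2) (d2 / 2)) as [h [Hh [A1 [A2 A3]]]]; try lra.
    specialize (K1 (s2 + h) ltac:(lra)). specialize (K2 (s2 + h) ltac:(red; lra)).
    specialize (Maj (s2 + h) ltac:(lra)).
    replace (s2 + h - s2) with h in * by ring. rewrite (Rabs_pos_eq h) in * by lra.
    specialize (K1 ltac:(lra)). specialize (K2 ltac:(lra)).
    apply Rabs_le_between in K1. apply Rabs_le_between in K2. rewrite E2 in K1.
    assert (f1 s2 c * h - e * h <= g s2 * h + e * h) by lra.
    assert (f1 s2 c * h = g s2 * h + 4 * e * h) by (unfold e; field).
    assert (0 < e * h) by (apply Rmult_lt_0_compat; auto). lra.
  - set (e := (g s1 - f1 s1 c) / 4). assert (He : 0 < e) by (unfold e; lra).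
    destruct (D_in_eps _ _ _ _ (Dg s1 ltac:(lra)) e He) as [d1 [Hd1 K1]].
    destruct (D_in_eps _ _ _ _ (Df s1 ltac:(red; lra)) e He) as [d2 [Hd2 K2]].
    destruct (exists_below (s1 - s2) (d1 / 2) (d2 / 2)) as [h [Hh [A1 [A2 A3]]]]; try lra.
    specialize (K1 (s1 - h) ltac:(lra)). specialize (K2 (s1 - h) ltac:(red; lra)).
    specialize (Maj (s1 - h) ltac:(lra)).
    replace (s1 - h - s1) with (- h) in * by ring. rewrite Rabs_Ropp, (Rabs_pos_eq h) in * by lra.
    specialize (K1 ltac:(lra)). specialize (K2 ltac:(lra)).
    apply Rabs_le_between in K1. apply Rabs_le_between in K2. rewrite E1 in K1.
    assert (g s1 * h - e * h <= f1 s1 c * h + e * h) by lra.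
    assert (g s1 * h = f1 s1 c * h + 4 * e * h) by (unfold e; field).
    assert (0 < e * h) by (apply Rmult_lt_0_compat; auto). lra.
Qed.

Lemma concave_of_derivative U g lo hi : 0 <= lo -> hi <= 1 ->
  (forall x, unit_interval x -> D_in U g unit_interval x) ->
  (forall x y, lo <= x -> x <= y -> y <= hi -> g y <= g x) ->
  concave_on (fun x => lo <= x <= hi) U.
Proof.
  intros Hlo Hhi D Dec.
  assert (P : forall x y l, lo <= x -> x < y -> y <= hi -> 0 < l < 1 ->
    l * U x + (1 - l) * U y <= U (l * x + (1 - l) * y)).
  { intros x y l Hx Hxy Hy Hl. set (z := l * x + (1 - l) * y).
    assert (Z1 : z - x = (1 - l) * (y - x)) by (unfold z; ring).
    assert (Z2 : y - z = l * (y - x)) by (unfold z; ring).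
    assert (0 < (1 - l) * (y - x)) by (apply Rmult_lt_0_compat; lra).
    assert (0 < l * (y - x)) by (apply Rmult_lt_0_compat; lra).
    destruct (MVT_unit U g x z D ltac:(lra) ltac:(lra) ltac:(lra)) as [x1 [Hx1 E1]].
    destruct (MVT_unit U g z y D ltac:(lra) ltac:(lra) ltac:(lra)) as [x2 [Hx2 E2]].
    assert (G := Dec x1 x2 ltac:(lra) ltac:(lra) ltac:(lra)).
    rewrite Z1 in E1. rewrite Z2 in E2.
    replace (U z) with (l * U x + (1 - l) * U y + (l * (U z - U x) - (1 - l) * (U y - U z))) by ring.
    rewrite E1, E2.
    assert (0 <= l * ((1 - l) * (y - x)) * (g x1 - g x2)).
    { apply Rmult_le_pos; [|lra]. apply Rmult_le_pos; lra. }
    lra. }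
  intros x y l Hx Hy Hl.
  destruct (Req_dec l 0) as [->|]. { rewrite !Rmult_0_l, Rminus_0_r, !Rmult_1_l, !Rplus_0_l. lra. }
  destruct (Req_dec l 1) as [->|].
  { rewrite Rminus_diag, !Rmult_0_l, !Rmult_1_l, !Rplus_0_r. lra. }
  destruct (Rtotal_order x y) as [L|[->|L]].
  - apply P; lra.
  - replace (l * y + (1 - l) * y) with y by ring. lra.
  - assert (Q := P y x (1 - l) ltac:(lra) L ltac:(lra) ltac:(lra)).
    replace (1 - (1 - l)) with l in Q by ring.
    rewrite (Rplus_comm (l * x)), (Rplus_comm (l * U x)). exact Q.
Qed.

Lemma concave_above_chord D G lo hi x : concave_on D G -> D lo -> D hi -> lo <= x <= hi -> lo < hi ->
  (hi - x) / (hi - lo) * G lo + (x - lo) / (hi - lo) * G hi <= G x.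
Proof.
  intros Con Dlo Dhi Hx Hl. assert (Q := Con hi lo ((x - lo) / (hi - lo)) Dhi Dlo).
  assert (E1 : 1 - (x - lo) / (hi - lo) = (hi - x) / (hi - lo)) by (field; lra).
  assert (E2 : (x - lo) / (hi - lo) * hi + (1 - (x - lo) / (hi - lo)) * lo = x) by (field; lra).
  rewrite E2, E1 in Q. rewrite Rplus_comm. apply Q. split.
  - apply Rdiv_le_0_compat; lra.
  - apply Rmult_le_reg_r with (hi - lo); [lra|]. unfold Rdiv. rewrite Rmult_assoc, Rinv_l; lra.
Qed.

(** * The s-waves on either side of the shock *)

Section Waves.
Variables (f fs fc fss : R -> R -> R).
Hypothesis HF : flux f fs fc fss.

Lemma s_wave_concave c p sI : unit_interval c -> 0 <= sI <= p -> p < 1 ->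
  (forall x y, sI <= x -> x < y -> y <= 1 -> fs y c < fs x c) -> s_wave f c 1 p (fun s => fs s c).
Proof.
  intros Hc Hp Hp1 Dec. split; auto. exists (fun x => f x c). split; [split; [split|]|].
  - apply concave_of_derivative with (fun x => fs x c); try lra.
    + apply (flux_D_in f fs fc fss HF); auto.
    + intros x y Hx Hxy Hy. destruct (Req_dec x y) as [->|]; [lra|]. left; apply Dec; lra.
  - intros; lra.
  - intros g [_ Mg] x Hx. apply Mg, Hx.
  - intros s Hs. apply D_in_restrict with unit_interval; [intros y Hy; red; lra|].
    apply (flux_D_in f fs fc fss HF); auto. red; lra.
Qed.

(** As long as f(s)/s increases, the graph lies below the chord from the origin to r, and every
    concave majorant lies above it; the s-wave is a single shock. *)
Lemma s_wave_chord c r : unit_interval c -> 0 < r <= 1 ->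
  (forall s, 0 < s < r -> 0 < tangency f fs 0 s c) -> s_wave f c r 0 (fun _ => f r c / r).
Proof.
  intros Hc Hr Tan. split; [lra|]. exists (fun x => f r c / r * x). split; [split; [split|]|].
  - intros x y l _ _ _. lra.
  - intros x Hx. destruct (Req_dec x 0) as [->|]. { rewrite (flux_0 _ _ _ _ HF) by auto. lra. }
    destruct (Req_dec x r) as [->|]. { right; field; lra. }
    assert (Q := quot_increasing f fs fc fss HF 0 c x r Hc ltac:(lra) ltac:(lra) ltac:(lra) ltac:(lra)
      ltac:(intros; apply Tan; lra)).
    unfold quot in Q. rewrite !Rplus_0_r in Q.
    replace (f x c) with (f x c / x * x) by (field; lra). apply Rmult_le_compat_r; lra.
  - intros G [Con Maj] x Hx.
    assert (Q := concave_above_chord _ G 0 r x Con ltac:(lra) ltac:(lra) Hx ltac:(lra)).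
    assert (M0 := Maj 0 ltac:(lra)). assert (Mr := Maj r ltac:(lra)).
    rewrite (flux_0 _ _ _ _ HF) in M0 by auto. rewrite !Rminus_0_r in Q.
    assert (0 <= (r - x) / r * G 0).
    { apply Rmult_le_pos; auto. apply Rdiv_le_0_compat; lra. }
    assert (x / r * f r c <= x / r * G r).
    { apply Rmult_le_compat_l; auto. apply Rdiv_le_0_compat; lra. }
    replace (f r c / r * x) with (x / r * f r c) by (field; lra). lra.
  - intros s Hs. apply eps_D_in. intros e He. exists 1. split; [lra|]. intros y _ _.
    replace (f r c / r * y - f r c / r * s - f r c / r * (y - s)) with 0 by ring.
    rewrite Rabs_R0. apply Rmult_le_pos; [lra|apply Rabs_pos].
Qed.

(* The envelope follows the tangent through the origin up to the tangency point w, then the graph. *)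
Lemma s_wave_tangent c r sI w : unit_interval c -> 0 < sI < w -> w < r <= 1 ->
  (forall s, 0 < s < w -> 0 < tangency f fs 0 s c) -> tangency f fs 0 w c = 0 ->
  (forall x y, sI <= x -> x < y -> y <= 1 -> fs y c < fs x c) ->
  exists g, s_wave f c r 0 g /\ g r = fs r c.
Proof.
  intros Hc HsI Hw Tan Tw Dec.
  set (l := fs w c).
  assert (El : f w c = l * w) by (unfold tangency in Tw; unfold l; lra).
  set (U := fun x => if Rle_dec x w then l * x else f x c).
  set (g := fun x => if Rle_dec x w then l else fs x c).
  assert (Ulow : forall x, x <= w -> U x = l * x) by (intros; unfold U; destruct Rle_dec; [auto|lra]).
  assert (Uhigh : forall x, w <= x -> U x = f x c).
  { intros x Hx. unfold U; destruct Rle_dec; auto. replace x with w by lra. auto. }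
  assert (glow : forall x, x <= w -> g x = l) by (intros; unfold g; destruct Rle_dec; [auto|lra]).
  assert (ghigh : forall x, w <= x -> g x = fs x c).
  { intros x Hx. unfold g; destruct Rle_dec; auto. replace x with w by lra. auto. }
  assert (Df := flux_D_in f fs fc fss HF c Hc).
  assert (DU : forall x, unit_interval x -> D_in U g unit_interval x).
  { intros x Hx. apply eps_D_in. intros e He.
    destruct (D_in_eps _ _ _ _ (Df x Hx) e He) as [d [Hd K]].
    destruct (Rtotal_order x w) as [L|[E|L]].
    - exists (w - x). split; [lra|]. intros y Hy Hyx. apply Rabs_def2 in Hyx.
      rewrite !Ulow, glow by lra. replace (l * y - l * x - l * (y - x)) with 0 by ring.
      rewrite Rabs_R0. apply Rmult_le_pos; [lra|apply Rabs_pos].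
    - exists d. split; auto. intros y Hy Hyx. destruct (Rle_lt_dec y w).
      + rewrite !Ulow, glow by lra. replace (l * y - l * x - l * (y - x)) with 0 by ring.
        rewrite Rabs_R0. apply Rmult_le_pos; [lra|apply Rabs_pos].
      + rewrite !Uhigh, ghigh by lra. auto.
    - exists (Rmin d (x - w)). split; [apply Rmin_pos; lra|]. intros y Hy Hyx.
      assert (Y1 := Rlt_le_trans _ _ _ Hyx (Rmin_l _ _)).
      assert (Y2 := Rlt_le_trans _ _ _ Hyx (Rmin_r _ _)). apply Rabs_def2 in Y2.
      rewrite !Uhigh, ghigh by lra. auto. }
  exists g. split; [|apply ghigh; lra]. split; [lra|]. exists U. split; [split; [split|]|].
  - apply concave_of_derivative with g; auto; try lra. intros x y Hx Hxy Hy.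
    destruct (Rle_lt_dec y w) as [L|L].
    + rewrite !glow by lra. lra.
    + destruct (Rle_lt_dec x w) as [L'|L'].
      * rewrite (glow x), (ghigh y) by lra. unfold l. left; apply Dec; lra.
      * rewrite !ghigh by lra. destruct (Req_dec x y) as [->|]; [lra|]. left; apply Dec; lra.
  - intros x Hx. destruct (Rle_lt_dec w x) as [L|L]; [rewrite Uhigh by lra; lra|].
    rewrite Ulow by lra.
    destruct (Req_dec x 0) as [->|]. { rewrite (flux_0 _ _ _ _ HF) by auto. lra. }
    assert (Q := quot_increasing f fs fc fss HF 0 c x w Hc ltac:(lra) ltac:(lra) ltac:(lra) ltac:(lra)
      ltac:(intros; apply Tan; lra)).
    unfold quot in Q. rewrite !Rplus_0_r, El in Q.
    replace (l * w / w) with l in Q by (field; lra).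
    replace (f x c) with (f x c / x * x) by (field; lra). apply Rmult_le_compat_r; lra.
  - intros G [Con Maj] x Hx. destruct (Rle_lt_dec w x) as [L|L]; [rewrite Uhigh by lra; auto|].
    rewrite Ulow by lra.
    assert (Q := concave_above_chord _ G 0 w x Con ltac:(lra) ltac:(lra) ltac:(lra) ltac:(lra)).
    assert (M0 := Maj 0 ltac:(lra)). assert (Mr := Maj w ltac:(lra)).
    rewrite (flux_0 _ _ _ _ HF) in M0 by auto. rewrite !Rminus_0_r in Q.
    assert (0 <= (w - x) / w * G 0).
    { apply Rmult_le_pos; auto. apply Rdiv_le_0_compat; lra. }
    assert (x / w * f w c <= x / w * G w).
    { apply Rmult_le_compat_l; auto. apply Rdiv_le_0_compat; lra. }
    replace (l * x) with (x / w * f w c) by (rewrite El; field; lra). lra.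
  - intros s Hs. apply D_in_restrict with unit_interval; [intros y Hy; red; lra|].
    apply DU. red; lra.
Qed.
End Waves.

Theorem theorem1
  (f fs fc fss fsc fcs fcc : R -> R -> R) (a a1 a2 : R -> R) (A : R -> R -> R)
  (hF1 : F1 f fs fc fss fsc fcs fcc) (hF2 : F2 fs) (hF3 : F3 fss) (hF4 : F4 fc)
  (hA1 : A1 a a1 a2) (hA2 : A2 a1) (hA3 : A3 a2)
  (hA : capillary_pressure A) :
  exists vmin vmax : R,
    0 < vmin < vmax /\
    let good (kappa sm sp v : R) : Prop :=
      unit_interval sm /\ unit_interval sp /\ vmin <= v <= vmax /\
      c_shock f a (sm, 1) (sp, 0) v /\
      admissible f a A kappa (sm, 1) (sp, 0) v /\
      compatible_by_speeds f
        [SWave 1 1 sm; Shock (sm, 1) (sp, 0) v; SWave 0 sp 0] in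
    exists sm sp v : R -> R,
      (forall kappa, 0 < kappa ->
        good kappa (sm kappa) (sp kappa) (v kappa) /\
        forall sm' sp' v', good kappa sm' sp' v' ->
          sm' = sm kappa /\ sp' = sp kappa /\ v' = v kappa) /\
      monotone_on (fun kappa => 0 < kappa) v /\
      (forall kappa, 0 < kappa -> continuous v kappa) /\
      is_lim v p_infty vmin /\
      filterlim v (at_right 0) (locally vmax).
Proof.
  assert (HF : flux f fs fc fss).
  { destruct hF1 as [[C1f [C1fs _]] B]. destruct hF2 as [P2 E2].
    split; auto; try (intros; apply B; auto); try (intros; apply E2; auto); apply C1fs. }
  destruct hA as [HA [Amin [Amax [HAm HAb]]]].
  assert (Hd := isotherm_positive a a1 a2 hA1 hA2).
  assert (a0 : a 0 = 0) by apply hA1.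
  destruct (exists_saddle f fs fc fss HF (a 1) Hd) as
    [sb [cb [Hsb [Hcb [Hrow [Hcol [Hsb0 [Hsb1 Hvm]]]]]]]].
  set (vm := quot f (a 1) sb cb) in *.
  assert (U0 : unit_interval 0) by (red; lra). assert (U1 : unit_interval 1) by (red; lra).
  destruct (exists_peak f fs fc fss HF (a 1) 0 Hd U0) as [s0 [Hp0 [Pos0 [Neg0 [Z0 _]]]]].
  destruct (exists_peak f fs fc fss HF (a 1) 1 Hd U1) as
    [s1 [Hp1 [Pos1 [Neg1 [Z1 [sI [HsI Dec1]]]]]]].
  destruct (excess_lipschitz a a1 a2 hA1) as [K [HK LE]].
  destruct (exists_clock (excess a) K cb HK Hcb (excess_positive a a1 a2 hA1 hA3)
    (excess_0 a a1 a2 hA1) (excess_1 a) LE) as [C [HC [TC DC]]].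
  assert (V0 : 0 < vm) by exact (vm_positive (a 1) Hd vm Hvm).
  set (conn := connection f A (a 1) s0 s1 C).
  assert (Ex : forall kappa, 0 < kappa -> exists v p r y, vm < v /\ conn kappa v p r y).
  { exact (exists_connection f fs fc fss A (a 1) Amin Amax HF Hd HA HAm HAb sb cb vm s0 s1
      Hsb Hcb Hrow Hcol Hsb0 Hsb1 Hvm Hp0 Hp1 C HC). }
  assert (Cmp : forall k k' v v' p p' r r' y y', 0 < k -> vm <= v -> v < v' ->
    conn k v p r y -> conn k' v' p' r' y' -> k' * v' < k * v).
  { exact (connection_comparison f fs fc fss A (a 1) Amin Amax HF Hd HA HAm HAb sb cb vm s0 s1
      Hsb Hcb Hcol Hsb0 Hsb1 Hvm Hp0 Hp1 C HC). }
  (* For kappa <= 0 the chosen values are arbitrary; continuity is claimed only at positive kappa,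
     near which all arguments are positive. *)
  destruct (functional_choice (fun kappa (x : R * (R * R)) => 0 < kappa ->
    vm < fst x /\ exists y, conn kappa (fst x) (fst (snd x)) (snd (snd x)) y)) as [V HV].
  { intros kappa. destruct (Rlt_dec 0 kappa) as [Hk|Hk]; [|exists (0, (0, 0)); contradiction].
    destruct (Ex kappa Hk) as [v [p [r [y [Hv Hy]]]]]. exists (v, (p, r)). intros _. simpl. eauto. }
  set (v := fun kappa => fst (V kappa)). set (sm := fun kappa => fst (snd (V kappa))).
  set (sp := fun kappa => snd (snd (V kappa))).
  assert (HV' : forall kappa, 0 < kappa -> vm < v kappa /\
    exists y, conn kappa (v kappa) (sm kappa) (sp kappa) y) by exact HV.
  clearbody v sm sp. clear HV V.
  assert (Uniq : forall kappa w p r y, 0 < kappa -> vm <= w -> conn kappa w p r y ->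
    w = v kappa /\ p = sm kappa /\ r = sp kappa).
  { intros kappa w p r y Hk Hw Hc. destruct (HV' kappa Hk) as [Hv [y' Hc']].
    assert (E : w = v kappa).
    { destruct (Rtotal_order w (v kappa)) as [L|[E|L]]; auto.
      - assert (Q := Cmp _ _ _ _ _ _ _ _ _ _ Hk Hw L Hc Hc').
        assert (kappa * w < kappa * v kappa) by (apply Rmult_lt_compat_l; auto). lra.
      - assert (Q := Cmp _ _ _ _ _ _ _ _ _ _ Hk (Rlt_le _ _ Hv) L Hc' Hc).
        assert (kappa * v kappa < kappa * w) by (apply Rmult_lt_compat_l; auto). lra. }
    split; auto. rewrite <- E in Hc'. destruct Hc as [_ [Tp [Br _]]]. destruct Hc' as [_ [Tp' [Br' _]]].
    split.
    - exact (top_unique f fs fc fss A (a 1) Amin Amax HF Hd HA HAm HAb sb cb vm s0 s1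
      Hsb Hcb Hcol Hsb0 Hsb1 Hvm Hp0 Hp1 w _ _ Tp Tp').
    - exact (bottom_unique f fs fc fss A (a 1) Amin Amax HF Hd HA HAm HAb sb cb vm s0 s1
      Hsb Hcb Hcol Hsb0 Hsb1 Hvm Hp0 Hp1 w _ _ Br Br'). }
  (* The two opposite monotonicities, of v and of kappa v, are what makes v continuous later on. *)
  assert (Mono : forall x y, 0 < x -> x <= y -> v y <= v x /\ x * v x <= y * v y).
  { intros x y Hx Hxy. destruct (HV' x Hx) as [Hvx [yx Hcx]].
    destruct (HV' y ltac:(lra)) as [Hvy [yy Hcy]].
    assert (D : v y <= v x).
    { apply Rnot_lt_le. intros L.
      assert (Q := Cmp _ _ _ _ _ _ _ _ _ _ Hx (Rlt_le _ _ Hvx) L Hcx Hcy).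
      assert (x * v x <= y * v y) by (apply Rmult_le_compat; lra). lra. }
    split; auto. destruct (Req_dec (v y) (v x)) as [->|Ne].
    - apply Rmult_le_compat_r; lra.
    - assert (L : v y < v x) by (destruct D; [assumption|contradiction]).
      left. exact (Cmp _ _ _ _ _ _ _ _ _ _ (Rlt_le_trans _ _ _ Hx Hxy) (Rlt_le _ _ Hvy)
        L Hcy Hcx). }
  destruct (completeness (fun w => exists kappa, 0 < kappa /\ w = v kappa)) as [vmax [Ub Lub]].
  { exists (quot f (a 1) s1 1). intros w [kappa [Hk ->]]. destruct (HV' kappa Hk) as [_ [y Hc]].
    destruct Hc as [_ [Tp _]]. exact (top_le_peak f fs fc fss A (a 1) Amin Amax HF Hd HA HAm HAb sb cb vm s0 s1
      Hsb Hcb Hcol Hsb0 Hsb1 Hvm Hp0 Hp1 _ _ Tp). }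
  { exists (v 1), 1. split; [lra|auto]. }
  assert (Hvmax : forall kappa, 0 < kappa -> v kappa <= vmax) by (intros; apply Ub; eauto).
  exists vm, vmax. split.
  { assert (Q := Hvmax 1 ltac:(lra)). destruct (HV' 1 ltac:(lra)) as [Q1 _]. lra. }
  intros good. exists sm, sp, v. split; [|split; [|split; [|split]]].
  - intros kappa Hk. split.
    + destruct (HV' kappa Hk) as [Hv [y Hc]].
      assert (Rg := connection_range f fs fc fss A (a 1) Amin Amax HF Hd HA HAm HAb sb cb vm s0 s1
      Hsb Hcb Hcol Hsb0 Hsb1 Hvm Hp0 Hp1 C HC _ _ _ _ _ Hk (Rlt_le _ _ Hv) Hc).
      destruct Hc as [Y [Tp [Br [Lp Rr]]]].
      assert (Ip := top_inside f fs fc fss A (a 1) Amin Amax HF Hd HA HAm HAb sb cb vm s0 s1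
      Hsb Hcb Hcol Hsb0 Hsb1 Hvm Hp0 Hp1 _ _ (Rlt_le _ _ Hv) Tp).
      assert (Ir := bottom_inside f fs fc fss A (a 1) Amin Amax HF Hd HA HAm HAb sb cb vm s0 s1
      Hsb Hcb Hcol Hsb0 Hsb1 Hvm Hp0 Hp1 _ _ (Rlt_le _ _ Hv) Br).
      destruct Tp as [Tp Ep]. destruct Br as [Br Er].
      set (p := sm kappa) in *. set (r := sp kappa) in *. set (w := v kappa) in *.
      assert (Fp : f p 1 = w * (p + a 1)) by (rewrite <- Ep; unfold quot; field; lra).
      assert (Fr : f r 0 = w * (r + a 1)) by (rewrite <- Er; unfold quot; field; lra).
      (* Once f p is replaced by w (p + a 1), the sign of the tangency function at p is that of fs p
         - w; the same applies at r. *)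
      assert (Sp : fs p 1 <= w).
      { assert (Q : tangency f fs (a 1) p 1 <= 0).
        { destruct (Req_dec p s1) as [->|]; [lra|]. left; apply Neg1; lra. }
        unfold tangency in Q. rewrite Fp in Q. nra. }
      assert (Sr : w <= fs r 0).
      { assert (Q : 0 <= tangency f fs (a 1) r 0).
        { destruct (Req_dec r s0) as [->|]; [lra|]. left; apply Pos0; lra. }
        unfold tangency in Q. rewrite Fr in Q. nra. }
      split; [red; lra|]. split; [red; lra|].
      split; [split; [lra|apply Hvmax, Hk]|]. split; [|split].
      * split; [|simpl; lra]. simpl. rewrite Fp, Fr, a0. split; ring.
      * apply (orbit_admissible f fs fc fss A a a1 a2 Amin Amax cb C HF hA1 Hd HA HAm HAb HC DC
          kappa w p r y); auto; try lra.
        intros t. specialize (Rg t). lra.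
      * split; [|split; [|exact I]].
        -- split; [reflexivity|]. exists (fs 1 1), (fs p 1), w, w.
           split; [|split; [split; reflexivity|exact Sp]].
           exists (fun s => fs s 1). split; [|auto].
           apply (s_wave_concave f fs fc fss HF 1 p sI); auto; lra.
        -- split; [reflexivity|].
           assert (W : exists g, s_wave f 0 r 0 g /\ w <= g r).
           { destruct (tangency_shape f fs fc fss HF 0 0 ltac:(lra) U0)
               as [sJ [sW [HJ [HW [PosW [ZW [_ DecW]]]]]]].
             (* Up to the tangency point of the chord from the origin the wave is a shock of speed f
                r / r = w (r + a 1) / r > w; beyond it the initial speed is fs r >= w. *)
             destruct (Rle_lt_dec r sW) as [L|L].
             - exists (fun _ => f r 0 / r). split.
               + apply (s_wave_chord f fs fc fss HF 0 r U0); [lra|]. intros s Hs; apply PosW; lra.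
               + rewrite Fr. apply Rmult_le_reg_r with r; [lra|].
                 replace (w * (r + a 1) / r * r) with (w * r + w * a 1) by (field; lra).
                 assert (0 < w * a 1) by (apply Rmult_lt_0_compat; lra). lra.
             - destruct (s_wave_tangent f fs fc fss HF 0 r sJ sW U0 HJ ltac:(lra) PosW ZW DecW)
                 as [g [Hg Eg]]. exists g. split; [exact Hg|lra]. }
           destruct W as [g [Hg Wg]]. exists w, w, (g r), (g 0).
           split; [split; reflexivity|]. split; [exists g; auto|exact Wg].
    + intros sm' sp' v' [Um [Up [Hv' [[RH _] [Adm Comp]]]]].
      simpl in RH. destruct RH as [RH1 RH2]. rewrite a0 in RH2.
      (* At c = 0 the second jump condition involves the left state only; subtracting the first one
         gives the relation for the right state. *)
      assert (Fp : f sm' 1 = v' * (sm' + a 1)) by lra.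
      assert (Fr : f sp' 0 = v' * (sp' + a 1)) by lra.
      destruct Comp as [[_ [vi1 [vf1 [vi2 [vf2 [W1 [W2 Le12]]]]]]]
                        [[_ [wi1 [wf1 [wi2 [wf2 [W3 [W4 Le34]]]]]]] _]].
      simpl in W1, W2, W3, W4. destruct W2 as [-> ->]. destruct W3 as [-> ->].
      destruct W1 as [g1 [Hg1 [_ ->]]]. destruct W4 as [g2 [Hg2 [-> _]]].
      unfold unit_interval in Um, Up.
      assert (L1 := proj1 Hg1). assert (L2 := proj1 Hg2).
      assert (S1 := proj1 (s_wave_end_speeds f fs 1 1 sm' g1 ltac:(lra) ltac:(lra)
        (flux_D_in f fs fc fss HF 1 U1) Hg1)).
      assert (S2 := proj2 (s_wave_end_speeds f fs 0 sp' 0 g2 ltac:(lra) ltac:(lra)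
        (flux_D_in f fs fc fss HF 0 U0) Hg2)).
      (* A root on the rising side would have fs > v', while the envelope of the first wave ends
         with a slope at least fs and, by compatibility, at most v'. The bottom root is found in the
         same way. *)
      assert (Tp : top f (a 1) s1 v' sm').
      { split; [|unfold quot; rewrite Fp; field; lra]. split; [|lra]. apply Rnot_lt_le. intros L.
        destruct (Req_dec sm' 0) as [E|Ne].
        - rewrite E, (flux_0 _ _ _ _ HF) in Fp by auto.
          assert (0 < v' * (0 + a 1)) by (apply Rmult_lt_0_compat; lra). lra.
        - assert (Q := Pos1 sm' ltac:(lra)). unfold tangency in Q. rewrite Fp in Q. nra. }
      assert (Br : bottom f (a 1) s0 v' sp').
      { split; [|unfold quot; rewrite Fr; field; lra]. split; [lra|]. apply Rnot_lt_le. intros L.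
        assert (Q := Neg0 sp' ltac:(lra)). unfold tangency in Q. rewrite Fr in Q. nra. }
      destruct (admissible_orbit f fs fc fss A a a1 a2 Amin Amax cb C HF hA1 hA2 hA3 HAm HAb Hcb HC TC
        kappa v' sm' sp' Hk ltac:(lra) Adm) as [y [Y [Lp Rr]]].
      destruct (Uniq kappa v' sm' sp' y Hk ltac:(lra)) as [-> [-> ->]].
      { unfold conn, connection. auto. }
      auto.
  - right. intros x y Hx Hy Hxy. apply Mono; auto.
  - intros kappa Hk. apply continuity_eps. intros e He.
    destruct (HV' kappa Hk) as [Hv _]. assert (Hvk : 0 < v kappa) by lra.
    (* The monotonicity of kappa v bounds |v x - v kappa| by |x - kappa| v kappa / min(x, kappa),
       and x > kappa / 2. *)
    set (del := Rmin (kappa / 2) (e * kappa / (4 * v kappa))).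
    assert (Hdel : 0 < del).
    { apply Rmin_pos; [lra|]. apply Rdiv_lt_0_compat; [apply Rmult_lt_0_compat; lra|lra]. }
    exists del. split; auto. intros x Hx.
    assert (X1 := Rlt_le_trans _ _ _ Hx (Rmin_l _ _)).
    assert (X2 := Rlt_le_trans _ _ _ Hx (Rmin_r _ _)).
    apply Rabs_def2 in X1. assert (Hx0 : kappa / 2 < x) by lra.
    destruct (HV' x ltac:(lra)) as [Hvx _].
    assert (X3 : Rabs (x - kappa) * (4 * v kappa) < e * kappa).
    { replace (e * kappa) with (e * kappa / (4 * v kappa) * (4 * v kappa)) by (field; lra).
      apply Rmult_lt_compat_r; lra. }
    destruct (Rle_lt_dec kappa x) as [L|L].
    + destruct (Mono kappa x Hk L) as [M1 M2]. rewrite Rabs_pos_eq in X3 by lra.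
      assert (B : (v kappa - v x) * kappa < e * kappa).
      { assert ((x - kappa) * v x <= (x - kappa) * v kappa) by (apply Rmult_le_compat_l; lra).
        assert (0 <= (x - kappa) * v kappa) by (apply Rmult_le_pos; lra). lra. }
      apply Rmult_lt_reg_r in B; auto. apply Rabs_def1; lra.
    + destruct (Mono x kappa ltac:(lra) ltac:(lra)) as [M1 M2]. rewrite Rabs_left in X3 by lra.
      assert (B : (v x - v kappa) * x < e * x).
      { assert (e * kappa / 2 < e * x) by nra.
        assert (0 <= (kappa - x) * v kappa) by (apply Rmult_le_pos; lra). lra. }
      apply Rmult_lt_reg_r in B; [|lra]. apply Rabs_def1; lra.
  - apply is_lim_p_infty_eps. intros e He.
    assert (KB : exists K, forall kappa v p r y, 0 < kappa -> vm + e <= v -> conn kappa v p r y -> kappa <= K).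
    { exact (kappa_bounded_above_saddle f fs fc fss A (a 1) Amin Amax HF Hd HA HAm HAb sb cb vm s0 s1
      Hsb Hcb Hcol Hsb0 Hsb1 Hvm Hp0 Hp1 C HC e He). }
    destruct KB as [K' KB]. exists (Rmax 1 (K' + 1)). intros t Ht.
    assert (T1 := Rle_trans _ _ _ (Rmax_l _ _) Ht). assert (T2 := Rle_trans _ _ _ (Rmax_r _ _) Ht).
    destruct (HV' t ltac:(lra)) as [Hv [y Hc]].
    assert (v t < vm + e).
    { apply Rnot_le_lt. intros L. assert (Q := KB t (v t) (sm t) (sp t) y ltac:(lra) L Hc). lra. }
    apply Rabs_def1; lra.
  - apply filterlim_locally. intros e.
    assert (P : exists k, 0 < k /\ vmax - e < v k).
    { apply NNPP. intros N. assert (Q := cond_pos e). assert (vmax <= vmax - e); [|lra].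
      apply Lub. intros w [k [Hk ->]]. apply Rnot_lt_le. intros L. apply N; eauto. }
    destruct P as [k [Hk Hvk]]. exists (mkposreal k Hk). intros x Hb Hx.
    assert (Hb' : Rabs (x - 0) < k) by exact Hb. rewrite Rabs_pos_eq in Hb' by lra.
    destruct (Mono x k Hx ltac:(lra)) as [M1 _]. assert (Q := Hvmax x Hx).
    assert (E := cond_pos e).
    change (Rabs (v x - vmax) < e). apply Rabs_def1; lra.
Qed.
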